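(* Suppose that $u_0\in H^1_0(\Omega)$ and $f\in L^2(0,T;H^{-1}(\Omega))$. Let $u\in Y$ be the weak solution of the heat equation with source $f$ and initial datum $u_0$, let $f_1,\dots,f_N\in H^{-1}(\Omega)$ be arbitrary, let $u_1,\dots,u_N\in H^1_0(\Omega)$ be the corresponding implicit Euler approximations, and let $u_\tau$ and $U_\tau$ be their piecewise constant and continuous piecewise affine reconstructions in time (all as defined in the context). Then $$\|u-U_\tau\|_Y\le\eta_J+\eta_{\mathrm{osc},\tau,Y},\qquad \eta_J\le\|u-U_\tau\|_Y+\eta_{\mathrm{osc},\tau,Y},$$ where $\eta_J=\|u_\tau-U_\tau\|_X$ is the temporal jump estimator and $\eta_{\mathrm{osc},\tau,Y}=\|f-f_\tau\|_{L^2(0,T;H^{-1}(\Omega))}$.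
   Context: $\Omega\subset\mathbb{R}^d$, $d\ge1$, is a bounded open set with Lipschitz boundary and $T>0$. $\|\cdot\|_\Omega$, $(\cdot,\cdot)_\Omega$ are the $L^2(\Omega)$ norm and inner product. $H^{-1}(\Omega)$ is the dual of $H^1_0(\Omega)$ with pairing $\langle\cdot,\cdot\rangle$ and norm $\|\Phi\|_{H^{-1}(\Omega)}=\sup_{v\in H^1_0(\Omega)\setminus\{0\}}\langle\Phi,v\rangle/\|\nabla v\|_\Omega$; $L^2(\Omega)\subset H^{-1}(\Omega)$ via $\langle w,v\rangle=(w,v)_\Omega$. Spaces: $X=L^2(0,T;H^1_0(\Omega))$ with $\|v\|_X^2=\int_0^T\|\nabla v\|_\Omega^2\,\mathrm{d}t$; $Y=L^2(0,T;H^1_0(\Omega))\cap H^1(0,T;H^{-1}(\Omega))$, which embeds continuously in $C([0,T];L^2(\Omega))$, with $\|\varphi\|_Y^2=\int_0^T(\|\partial_t\varphi\|_{H^{-1}(\Omega)}^2+\|\nabla\varphi\|_\Omega^2)\,\mathrm{d}t+\|\varphi(T)\|_\Omega^2$. Heat equation: $u\in Y$ is the unique function with $u(0)=u_0$ and $\langle\partial_tu(t),v\rangle+(\nabla u(t),\nabla v)_\Omega=\langle f(t),v\rangle$ for all $v\in H^1_0(\Omega)$ and a.e. $t\in(0,T)$. Implicit Euler: let $0=t_0<t_1<\dots<t_N=T$, $N\ge1$, $\tau_n=t_n-t_{n-1}$, $I_n=(t_{n-1},t_n)$. Given $f_n\in H^{-1}(\Omega)$ (some approximation of $f$ on the $n$-th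 step), for $n=1,\dots,N$ the function $u_n\in H^1_0(\Omega)$ is the unique solution of $\left(\frac{u_n-u_{n-1}}{\tau_n},v\right)_\Omega+(\nabla u_n,\nabla v)_\Omega=\langle f_n,v\rangle$ for all $v\in H^1_0(\Omega)$, starting from the initial datum $u_0$. The function $f_\tau$ is defined by $f_\tau(t)=f_n$ for $t\in I_n$. Reconstructions: $u_\tau$ is the left-continuous piecewise constant function with $u_\tau(0)=u_0$ and $u_\tau(t)=u_n$ for $t\in(t_{n-1},t_n]$. $U_\tau$ is the continuous piecewise affine function with $U_\tau(t)=\frac{t-t_{n-1}}{\tau_n}u_n+\frac{t_n-t}{\tau_n}u_{n-1}$ for $t\in[t_{n-1},t_n]$. (Thus $\eta_J^2=\sum_{n=1}^N\frac{\tau_n}{3}\|\nabla(u_n-u_{n-1})\|_\Omega^2$.) *)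

(* Defs.v *)
From HB Require Import structures.
From mathcomp Require Import all_boot all_order all_algebra.
From mathcomp Require Import all_classical all_reals all_analysis.

Set Implicit Arguments.
Unset Strict Implicit.
Unset Printing Implicit Defensive.
Import Order.TTheory GRing.Theory Num.Theory.
Import numFieldNormedType.Exports.
Local Open Scope classical_set_scope.
Local Open Scope ring_scope.

(* R^d is 'rV[R]_d, with its library topology.  It is given the product
   sigma-algebra, generated by the coordinate maps. *)
Section measurable_rV.
Variables (R : realType) (d : nat).

Let coord (i : 'I_d) (x : 'rV[R]_d) : measurableTypeR R := x ord0 i.

Let rV_set0 : g_sigma_preimage coord set0.
Proof. exact: sigma_algebra0. Qed.

Let rV_setC A : g_sigma_preimage coord A -> g_sigma_preimage coord (~` A).
Proof. exact: sigma_algebraC. Qed.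

Let rV_bigcup (F : (set _)^nat) : (forall i, g_sigma_preimage coord (F i)) ->
  g_sigma_preimage coord (\bigcup_i (F i)).
Proof. exact: sigma_algebra_bigcup. Qed.

HB.instance Definition _ := @isMeasurable.Build default_measure_display
  'rV[R]_d (g_sigma_preimage coord) rV_set0 rV_setC rV_bigcup.

Lemma measurable_coord (i : 'I_d) :
  measurable_fun [set: 'rV[R]_d] (fun x => x ord0 i : measurableTypeR R).
Proof.
move=> _ Y mY; rewrite setTI; apply: sub_sigma_algebra => /=.
rewrite -bigcup_seq/=; exists i => /=; first by rewrite mem_index_enum.
by exists Y => //; rewrite setTI.
Qed.

Lemma measurable_fun_coordP d1 (T1 : measurableType d1) (f : T1 -> 'rV[R]_d) :
  measurable_fun [set: T1] f <->
  forall i, measurable_fun [set: T1]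
    (fun y => f y ord0 i : measurableTypeR R).
Proof.
split=> [mf i|mf].
  by apply: (measurableT_comp (measurable_coord i)).
suff H : g_sigma_preimage (fun i => coord i \o f) `<=` measurable.
  rewrite g_sigma_preimage_comp in H.
  by move=> _ A mA; apply: H; exists A.
apply: smallest_sub; first exact: sigma_algebra_measurable.
rewrite -bigcup_seq; apply: bigcup_sub => i _.
by move=> A [B mB <-]; exact: mf.
Qed.

End measurable_rV.

Section lebesgue_rV.
Variable R : realType.

Definition cons_rV d (p : measurableTypeR R * 'rV[R]_d) : 'rV[R]_d.+1 :=
  \row_i (if unlift ord0 i is Some j then p.2 ord0 j else p.1).

Lemma measurable_cons_rV d : measurable_fun setT (@cons_rV d).
Proof.
apply/measurable_fun_coordP => i.
case: (unliftP ord0 i) => [j ->|->].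
- rewrite (_ : (fun _ => _) = (fun x : 'rV[R]_d => x ord0 j) \o snd).
    by apply: measurableT_comp => //; exact: measurable_coord.
  by apply/funext => p /=; rewrite mxE liftK.
- rewrite (_ : (fun _ => _) = fst); first exact: measurable_fst.
  by apply/funext => p /=; rewrite mxE unlift_none.
Qed.

Definition lebesgue_cons d (mu : {measure set 'rV[R]_d -> \bar R}) :
    {measure set 'rV[R]_d.+1 -> \bar R} :=
  measure_function_pushforward__canonical__measure_function_Measure
    (lebesgue_measure \x^ mu)%E (@measurable_cons_rV d).

Fixpoint lebesgue_rV d : {measure set 'rV[R]_d -> \bar R} :=
  if d is d'.+1 then lebesgue_cons (lebesgue_rV d') else \d_(0 : 'rV[R]_0).

(* The normalization: the volume of a measurable box. *)
Lemma lebesgue_rV_box d (A : 'I_d -> set (measurableTypeR R)) :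
  (forall i, measurable (A i)) ->
  lebesgue_rV d [set x | forall i, A i (x ord0 i)] =
  (\prod_(i < d) lebesgue_measure (A i))%E.
Proof.
elim: d A => [|d IH] A mA.
  by rewrite big_ord0 /= diracE mem_set// => -[].
pose B := [set x : 'rV[R]_d | forall i, A (lift ord0 i) (x ord0 i)].
have mB : measurable B.
  rewrite (_ : B = \bigcap_(i in [set: 'I_d])
      ((fun x : 'rV[R]_d => x ord0 i) @^-1` A (lift ord0 i))); last first.
    by apply/seteqP; split=> x /= h; [move=> i _; exact: h|move=> i; exact: h].
  apply: fin_bigcap_measurable => // i _.
  by rewrite -[X in measurable X]setTI; exact: measurable_coord.
transitivity ((lebesgue_measure \x^ lebesgue_rV d) (A ord0 `*` B))%E; last first.
  by rewrite product_measure2E// big_ord_recl (IH (fun i => A (lift ord0 i))).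
rewrite /= /pushforward; congr (product_measure2 _ _ _).
apply/seteqP; split=> [[a x] /= h|[a x] /= [h0 h] i].
  split; first by have := h ord0; rewrite mxE unlift_none.
  by move=> i; have := h (lift ord0 i); rewrite mxE liftK.
by rewrite mxE; case: unliftP => [j ->|->].
Qed.

End lebesgue_rV.

(* Near every boundary point, after an orthogonal change of coordinates Q,
   the domain is the strict epigraph, in direction k, of a Lipschitz function
   of the other d - 1 coordinates. *)
Definition lipschitz_boundary (R : realType) d (Om : set 'rV[R]_d) : Prop :=
  forall x0, (closure Om `\` interior Om) x0 ->
  exists (r : R) (Q : 'M[R]_d) (k : 'I_d) (gamma : 'rV[R]_d.-1 -> R),
    [/\ 0 < r, Q *m Q^T = 1%:M, [lipschitz gamma y | y in setT] &
        forall x, ball x0 r x ->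
          (Om x <-> gamma (col' k (x *m Q)) < (x *m Q) ord0 k)].

Definition partial (R : realType) d (i : 'I_d) (f : 'rV[R]_d -> R) :
  'rV[R]_d -> R := fun x => 'D_(delta_mx ord0 i) f x.

Definition smooth (R : realType) d (f : 'rV[R]_d -> R) : Prop :=
  forall s : seq 'I_d, let g := foldr (@partial R d) f s in
    continuous g /\ forall i x, derivable g x (delta_mx ord0 i).

Definition test_fun (R : realType) d (Om : set 'rV[R]_d) (f : 'rV[R]_d -> R) :
    Prop :=
  smooth f /\
  exists K, [/\ compact K, K `<=` Om & forall x, ~ K x -> f x = 0].

Definition time_test_fun (R : realType) (T : R) (psi : R -> R) : Prop :=
  (forall n t, derivable (derive1n n psi) t 1) /\
  exists a b, [/\ 0 < a, b < T & forall t, t \notin `[a, b] -> psi t = 0].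

(* Elements of L^2(Om) and H^1_0(Om) are represented by functions on R^d, of
   which only the values almost everywhere in Om matter. *)

Section domain_spaces.
Variables (R : realType) (d : nat) (Om : set 'rV[R]_d).
Local Notation leb := (lebesgue_rV R d).
Local Notation fct := ('rV[R]_d -> R).
Implicit Types v w : fct.

Definition L2 : set fct :=
  [set w : fct | measurable_fun Om w /\ (\int[leb]_(x in Om) ((w x) ^+ 2)%:E < +oo)%E].

Definition L2dot w v : R := \int[leb]_(x in Om) (w x * v x).

Definition L2norm w : R := Num.sqrt (L2dot w w).

Definition weak_gradient v (G : 'I_d -> fct) : Prop :=
  forall i phi, test_fun Om phi -> L2dot v (partial i phi) = - L2dot (G i) phi.

Definition H1_gradient v (G : 'I_d -> fct) : Prop :=
  [/\ L2 v, forall i, L2 (G i) & weak_gradient v G].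

(* v belongs to H^1_0(Om), the closure of the test functions in H^1(Om), and
   has weak gradient G *)
Definition H10_gradient v (G : 'I_d -> fct) : Prop :=
  H1_gradient v G /\
  exists phi : nat -> fct,
    [/\ forall n, test_fun Om (phi n),
        L2norm (phi n \- v) @[n --> \oo] --> (0 : R) &
        forall i, L2norm (partial i (phi n) \- G i) @[n --> \oo] --> (0 : R)].

Definition H10 : set fct := [set v : fct | exists G, H10_gradient v G].

(* The weak gradient of an element of H^1_0(Om), unique up to null sets. *)
Definition grad v : 'I_d -> fct := xget (fun _ _ => 0) (H10_gradient v).

Definition graddot w v : R := \sum_(i < d) L2dot (grad w i) (grad v i).

Definition gradnorm v : R := Num.sqrt (graddot v v).

(* H^{-1}(Om); an element is a functional of which only the values on
   H^1_0(Om) matter. *)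
Definition Hm1 : set (fct -> R) :=
  [set Phi : fct -> R | (forall (a : R) v w, H10 v -> H10 w ->
                Phi (fun x => a * v x + w x) = a * Phi v + Phi w) /\
             exists C, forall v, H10 v -> `|Phi v| <= C * gradnorm v].

Definition Hm1norm (Phi : fct -> R) : R :=
  sup [set Phi v / gradnorm v |
       v in [set v : fct | H10 v /\ ~ ae_eq leb Om v (cst 0)]].

Definition L2_to_Hm1 w : fct -> R := L2dot w.

End domain_spaces.

Section bochner.
Variables (R : realType) (E : zmodType) (S : set E) (N : E -> R) (T : R).
Local Notation mu := (@lebesgue_measure R).

(* S-valued functions of time with finitely many values, taken on measurable
   sets *)
Definition simple_fun (s : R -> E) : Prop :=
  exists (k : nat) (val : 'I_k -> E) (idx : R -> 'I_k),
    [/\ forall i, S (val i),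
        forall i, measurable (idx @^-1` [set i] : set (measurableTypeR R)) &
        forall t, s t = val (idx t)].

Definition strongly_measurable (phi : R -> E) : Prop :=
  exists s : nat -> R -> E, (forall n, simple_fun (s n)) /\
    {ae mu, forall t, t \in `]0, T[ -> N (s n t - phi t) @[n --> \oo] --> (0 : R)}.

(* L^2(0, T; S), for the norm N on S; only phi on (0, T) matters. *)
Definition bochnerL2 (phi : R -> E) : Prop :=
  [/\ {ae mu, forall t, t \in `]0, T[ -> S (phi t)},
      strongly_measurable phi &
      (\int[mu]_(t in `]0%R, T[) ((N (phi t)) ^+ 2)%:E < +oo)%E].

Definition bochnerL2_norm (phi : R -> E) : R :=
  Num.sqrt (\int[mu]_(t in `]0, T[) (N (phi t)) ^+ 2).

End bochner.

Section parabolic_spaces.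
Variables (R : realType) (d : nat) (Om : set 'rV[R]_d) (T : R).
Local Notation mu := (@lebesgue_measure R).
Local Notation fct := ('rV[R]_d -> R).
Implicit Types (phi : R -> fct) (g : R -> fct -> R).

Definition inX phi : Prop := bochnerL2 (H10 Om) (gradnorm Om) T phi.
Definition normX phi : R := bochnerL2_norm (gradnorm Om) T phi.

Definition inL2Hm1 g : Prop := bochnerL2 (Hm1 Om) (Hm1norm Om) T g.
Definition normL2Hm1 g : R := bochnerL2_norm (Hm1norm Om) T g.

(* g in L^2(0, T; H^{-1}(Om)) is the weak time derivative of phi.  The
   H^{-1}(Om)-valued integrals are tested against the elements of
   H^1_0(Om). *)
Definition weak_dt phi g : Prop :=
  inL2Hm1 g /\
  forall psi v, time_test_fun T psi -> H10 Om v ->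
    \int[mu]_(t in `]0, T[) (derive1 psi t * L2_to_Hm1 Om (phi t) v) =
    - \int[mu]_(t in `]0, T[) (psi t * g t v).

Definition dt phi : R -> fct -> R := xget (fun _ _ => 0) (weak_dt phi).

(* Y = L^2(0, T; H^1_0(Om)) /\ H^1(0, T; H^{-1}(Om)) *)
Definition inY phi : Prop :=
  [/\ inX phi, inL2Hm1 (fun t => L2_to_Hm1 Om (phi t)) &
      exists g, weak_dt phi g].

(* c is the representative of phi in C([0, T]; L^2(Om)) *)
Definition continuous_representative phi (c : R -> fct) : Prop :=
  [/\ forall s, s \in `[0, T] -> L2 Om (c s),
      forall s, s \in `[0, T] ->
        L2norm Om (c r \- c s) @[r --> within `[0, T] (nbhs s)] --> (0 : R) &
      {ae mu, forall s, s \in `]0, T[ -> ae_eq (lebesgue_rV R d) Om (c s) (phi s)}].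

(* w is the value phi(t) of the continuous representative of phi *)
Definition has_value phi (t : R) (w : fct) : Prop :=
  L2 Om w /\ exists2 c, continuous_representative phi c &
    ae_eq (lebesgue_rV R d) Om (c t) w.

Definition value_at phi (t : R) : fct := xget (cst 0) (has_value phi t).

Definition normY phi : R :=
  Num.sqrt (\int[mu]_(t in `]0, T[)
              (Hm1norm Om (dt phi t) ^+ 2 + gradnorm Om (phi t) ^+ 2)
            + L2norm Om (value_at phi T) ^+ 2).

Definition heat_solution (f : R -> fct -> R) (u0 : fct) (u : R -> fct) : Prop :=
  [/\ inY u, has_value u 0 u0 &
      forall v, H10 Om v ->
        {ae mu, forall t, t \in `]0, T[ ->
           dt u t v + graddot Om (u t) v = f t v}].

End parabolic_spaces.

(* The time nodes are tn 0, ..., tn N; values of tn beyond N are irrelevant,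
   as are un n for n > N, and fn n for n = 0 and n > N. *)

Definition time_grid (R : realType) (T : R) (N : nat) (tn : nat -> R) : Prop :=
  [/\ (1 <= N)%N, tn 0%N = 0, tn N = T &
      forall n, (n < N)%N -> tn n < tn n.+1].

Definition implicit_euler (R : realType) d (Om : set 'rV[R]_d) (N : nat)
    (tn : nat -> R) (u0 : 'rV[R]_d -> R) (fn : nat -> ('rV[R]_d -> R) -> R)
    (un : nat -> 'rV[R]_d -> R) : Prop :=
  un 0%N = u0 /\
  forall n, (1 <= n <= N)%N ->
    H10 Om (un n) /\
    forall v, H10 Om v ->
      L2dot Om (fun x => (un n x - un n.-1 x) / (tn n - tn n.-1)) v
      + graddot Om (un n) v = fn n v.

Section reconstructions.
Variables (R : realType) (N : nat) (tn : nat -> R).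

(* The n such that t belongs to (tn n.-1, tn n], and 0 at t = tn 0. *)
Definition step (t : R) : nat := find (fun n => t <= tn n) (iota 0 N.+1).

(* f_tau and u_tau are piecewise_constant fn and piecewise_constant un;
   the values of f_tau at the time nodes are irrelevant. *)
Definition piecewise_constant (A : Type) (an : nat -> A) (t : R) : A :=
  an (step t).

Definition piecewise_affine d (un : nat -> 'rV[R]_d -> R) (t : R) :
    'rV[R]_d -> R :=
  let n := maxn 1 (step t) in
  fun x => (t - tn n.-1) / (tn n - tn n.-1) * un n x
         + (tn n - t) / (tn n - tn n.-1) * un n.-1 x.

Variable T : R.
Hypothesis grid : time_grid T N tn.

Let tn_le m n : (m <= n <= N)%N -> tn m <= tn n.
Proof.
case: grid => _ _ _ ht /andP[mn nN].
elim: n mn nN => [|n IH]; first by rewrite leqn0 => /eqP ->.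
rewrite leq_eqVlt => /predU1P[->//|mn] nN.
by rewrite (le_trans (IH mn (ltnW nN)))// ltW// ht.
Qed.

Lemma stepE n t : (1 <= n <= N)%N -> tn n.-1 < t <= tn n -> step t = n.
Proof.
case: n => // n /= nN /andP[t1 t2].
rewrite /step (_ : N.+1 = n.+1 + (N - n))%N; last by rewrite addSn subnKC// ltnW.
rewrite iotaD find_cat; case: ifPn => [/hasP[m]|_].
  rewrite mem_iota add0n /= ltnS => mn; rewrite leNgt (le_lt_trans _ t1)//.
  by apply: tn_le; rewrite mn ltnW.
rewrite size_iota add0n; case: (N - n)%N (subn_gt0 n N) => [|k _] /=.
  by rewrite nN.
by rewrite t2 addn0.
Qed.

Lemma step0 : step 0 = 0%N.
Proof. by rewrite /step /=; case: grid => _ -> _ _; rewrite lexx. Qed.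

Lemma piecewise_constantE A (an : nat -> A) n t : (1 <= n <= N)%N ->
  tn n.-1 < t <= tn n -> piecewise_constant an t = an n.
Proof. by move=> nN tI; rewrite /piecewise_constant (stepE nN tI). Qed.

Lemma piecewise_constant0 A (an : nat -> A) : piecewise_constant an 0 = an 0%N.
Proof. by rewrite /piecewise_constant step0. Qed.

Lemma piecewise_affineE d (un : nat -> 'rV[R]_d -> R) n t x :
  (1 <= n <= N)%N -> tn n.-1 <= t <= tn n ->
  piecewise_affine un t x =
    (t - tn n.-1) / (tn n - tn n.-1) * un n x
    + (tn n - t) / (tn n - tn n.-1) * un n.-1 x.
Proof.
case: (grid) => N1 t0 _ ht nN /andP[t1 t2]; rewrite /piecewise_affine.
move: t1; rewrite le_eqVlt => /predU1P[tE|t1]; last first.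
  rewrite (stepE nN); last by rewrite t1.
  by case/andP: nN => /maxn_idPr ->.
case: n nN tE t2 => // -[|n] /= nN <- t2; first by rewrite t0 step0 /= t0.
rewrite (@stepE n.+1) ?(ltnW nN) ?ht ?lexx//; last exact: ltnW.
rewrite (maxn_idPr _)//= subrr !mul0r add0r addr0.
by rewrite !divff ?mul1r // subr_eq0 gt_eqF// ht// ltnW.
Qed.

End reconstructions.

(* Main.v *)
(* For a positive semidefinite form B with seminorm |v|_B and dual norm |.|',
   |Phi|'^2 is the supremum of 2 Phi(v) - B(v, v), and the substitution
   v := v + e yields |Phi + B e|'^2 = |Phi|'^2 + 2 Phi(e) + B(e, e).  With
   Phi = e'(t) and e = e(t), where e = u - U_tau vanishes at t = 0, integration
   in time turns the cross term into |e(T)|^2, so that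
     |e|_Y = |e' - Delta e|_{L^2(0, T; H^{-1})}.
   The scheme gives e' - Delta e = (f - f_tau) - Delta (u_tau - U_tau), and the
   second term has norm eta_J: both bounds are the triangle inequality.

   The energy identity |e(T)|^2 - |e(0)|^2 = 2 \int <e', e> is obtained from
   |e(s')|^2 - |e(s)|^2 = \int_s^{s'} <e'(r), e(s) + e(s')> dr summed over
   meshes with generic nodes, chosen one by one so that the nodal values are
   close, in mean square, to a continuous approximation of e. *)

Require Import Defs.
From mathcomp Require Import all_boot all_order all_algebra.
From mathcomp Require Import all_classical all_reals all_analysis.
From mathcomp Require Import measurable_realfun.
From mathcomp Require Import ring lra.
Import Order.TTheory GRing.Theory Num.Theory.
Import numFieldNormedType.Exports.
Set Implicit Arguments.
Unset Strict Implicit.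
Unset Printing Implicit Defensive.
Local Open Scope classical_set_scope.
Local Open Scope ring_scope.

(** * Seminorms, semidefinite forms and dual norms *)

(** Objects are functions up to null sets, and no quotient is formed: estimates are made for
    seminorms and semidefinite forms on a subspace [S] of raw functions, and for scalar functions
    that agree almost everywhere with measurable or integrable ones ([aemeas], [aeint]). The
    integrands of the norms are known only in this sense.

    Equations and weak derivatives are tested against one fixed [v] at a time, with a null set of
    times that depends on [v]. Two devices cope with this. Countably many norming vectors turn
    vanishing against each [v] into a vanishing dual norm at almost every time. In the energy
    identity the test vector is frozen to e(s) + e(s') on each mesh interval, so that only
    increments against fixed vectors enter, and they telescope by (e(s') - e(s), e(s') + e(s)) =
    |e(s')|^2 - |e(s)|^2. Freezing costs the distances from e(s) and e(s') to e(r); these involve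
    nodal values, which a bound in mean square does not control at arbitrary nodes, hence the choice
    of nodes. Since e is meaningful only at almost every time, the two end points are reached
    through the continuous representative. *)

Section seminorms.
Variables (R : realType) (E : lmodType R).
Implicit Types (S : set E) (N : E -> R) (B : E -> E -> R) (Phi : E -> R).

Record subspace S : Prop := Subspace {
  sp0 : S 0;
  spL : forall a v w, S v -> S w -> S (a *: v + w) }.

Record seminorm_on S N : Prop := SeminormOn {
  sn_sub : subspace S;
  sn_ge0 : forall v, S v -> 0 <= N v;
  sn_Z : forall a v, S v -> N (a *: v) = `|a| * N v;
  sn_D : forall v w, S v -> S w -> N (v + w) <= N v + N w }.

Record psd_form S B : Prop := PsdForm {
  psd_sub : subspace S;
  psd_sym : forall v w, S v -> S w -> B v w = B w v;
  psd_lin : forall a v v' w, S v -> S v' -> S w ->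
    B (a *: v + v') w = a * B v w + B v' w;
  psd_ge0 : forall v, S v -> 0 <= B v v }.

Definition form_norm B v : R := Num.sqrt (B v v).

(** As in [Hm1], only the values on [S] are constrained: functionals that agree on [S] and differ
    elsewhere are distinct elements at distance zero, so the dual norm too is only a seminorm. *)
Definition dual S N : set (E -> R) := [set Phi |
  (forall a v w, S v -> S w -> Phi (a *: v + w) = a * Phi v + Phi w) /\
  exists C, forall v, S v -> `|Phi v| <= C * N v].

(** An axiomatic interface, so that the supremum of quotients [Hm1norm], with its null functions and
    divisions by zero, is examined once, in [Hm1norm_dual]. *)
Record dual_norm S N (Nd : (E -> R) -> R) : Prop := DualNorm {
  dn_ge0 : forall Phi, dual S N Phi -> 0 <= Nd Phi;
  dn_ub : forall Phi v, dual S N Phi -> S v -> `|Phi v| <= Nd Phi * N v;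
  dn_least : forall Phi C, dual S N Phi -> 0 <= C ->
    (forall v, S v -> Phi v <= C * N v) -> Nd Phi <= C }.

End seminorms.

Section subspace_theory.
Variables (R : realType) (E : lmodType R).
Implicit Types (S : set E) (N : E -> R) (B : E -> E -> R) (Phi : E -> R).

Lemma spZ S a v : subspace S -> S v -> S (a *: v).
Proof. by move=> sS Sv; rewrite -[_ *: _]addr0; apply: spL => //; exact: sp0. Qed.

Lemma spD S v w : subspace S -> S v -> S w -> S (v + w).
Proof. by move=> sS Sv Sw; rewrite -[v]scale1r; exact: spL. Qed.

Lemma spN S v : subspace S -> S v -> S (- v).
Proof. by move=> sS Sv; rewrite -scaleN1r; exact: spZ. Qed.

Lemma spB S v w : subspace S -> S v -> S w -> S (v - w).
Proof. by move=> sS Sv Sw; apply: spD => //; exact: spN. Qed.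

Lemma sp_sum S (I : Type) (r : seq I) (P : pred I) (F : I -> E) :
  subspace S -> (forall i, P i -> S (F i)) -> S (\sum_(i <- r | P i) F i).
Proof.
move=> sS SF; apply: big_ind => //; first exact: sp0.
by move=> v w; exact: spD.
Qed.

End subspace_theory.

Section seminorm_theory.
Variables (R : realType) (E : lmodType R).
Variables (S : set E) (N : E -> R).
Hypothesis sN : seminorm_on S N.
Let sS := sn_sub sN.

Lemma sn0 : N 0 = 0.
Proof. by rewrite -(scale0r 0) (sn_Z sN) ?normr0 ?mul0r//; exact: sp0. Qed.

Lemma snN v : S v -> N (- v) = N v.
Proof. by move=> Sv; rewrite -scaleN1r (sn_Z sN)// normrN1 mul1r. Qed.

Lemma snC v w : S v -> S w -> N (v - w) = N (w - v).
Proof. by move=> Sv Sw; rewrite -[in LHS]opprB snN//; exact: spB. Qed.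

Lemma snB v w : S v -> S w -> N (v - w) <= N v + N w.
Proof. by move=> Sv Sw; rewrite -(snN Sw); apply: (sn_D sN) => //; exact: spN. Qed.

Lemma sn_tri u v w : S u -> S v -> S w -> N (u - w) <= N (u - v) + N (v - w).
Proof.
move=> Su Sv Sw; have -> : u - w = (u - v) + (v - w) by rewrite addrA subrK.
by apply: (sn_D sN); exact: spB.
Qed.

Lemma sn_lip v w : S v -> S w -> `|N v - N w| <= N (v - w).
Proof.
move=> Sv Sw; rewrite ler_norml; apply/andP; split.
  have := sn_D sN (spB sS Sw Sv) Sv; rewrite subrK snC// => h; lra.
have := sn_D sN (spB sS Sv Sw) Sw; rewrite subrK => h; lra.
Qed.

Lemma sn_sum (I : Type) (r : seq I) (F : I -> E) :
  (forall i, S (F i)) -> N (\sum_(i <- r) F i) <= \sum_(i <- r) N (F i).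
Proof.
move=> SF; elim: r => [|i r IH]; first by rewrite !big_nil sn0.
rewrite !big_cons (le_trans (sn_D sN (SF i) _)) ?lerD2l//.
exact: sp_sum.
Qed.

Lemma dual_subspace : subspace (dual S N).
Proof.
split.
  split=> [a v w _ _|]; first by rewrite mulr0 addr0.
  by exists 0 => v _; rewrite mul0r normr0.
move=> a Phi Psi [l1 [C1 b1]] [l2 [C2 b2]]; split.
  move=> b v w Sv Sw.
  change (a * Phi (b *: v + w) + Psi (b *: v + w) =
    b * (a * Phi v + Psi v) + (a * Phi w + Psi w)).
  by rewrite l1// l2//; ring.
exists (`|a| * C1 + C2) => v Sv.
change (`|a * Phi v + Psi v| <= (`|a| * C1 + C2) * N v).
rewrite (le_trans (ler_normD _ _))// mulrDl lerD ?b2// normrM -mulrA.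
by rewrite ler_wpM2l ?b1.
Qed.

Lemma dual0 Phi : dual S N Phi -> Phi 0 = 0.
Proof.
by case=> l _; have := l (-1) 0 0 (sp0 sS) (sp0 sS); rewrite scaler0 addr0 mulN1r addNr.
Qed.

Lemma dualZ Phi a v : dual S N Phi -> S v -> Phi (a *: v) = a * Phi v.
Proof.
move=> dP Sv; rewrite -[X in Phi X]addr0 (dP.1)//; last exact: sp0.
by rewrite dual0// addr0.
Qed.

Lemma dualD Phi v w : dual S N Phi -> S v -> S w -> Phi (v + w) = Phi v + Phi w.
Proof. by move=> dP Sv Sw; rewrite -[v in LHS]scale1r (dP.1)// mul1r. Qed.

Lemma dualN Phi v : dual S N Phi -> S v -> Phi (- v) = - Phi v.
Proof. by move=> dP Sv; rewrite -scaleN1r dualZ// mulN1r. Qed.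

Lemma dualB Phi v w : dual S N Phi -> S v -> S w -> Phi (v - w) = Phi v - Phi w.
Proof. by move=> dP Sv Sw; rewrite dualD// ?dualN//; exact: spN. Qed.

Variable Nd : (E -> R) -> R.
Hypothesis dNd : dual_norm S N Nd.

Lemma dual_seminorm : seminorm_on (dual S N) Nd.
Proof.
have ZP a Phi : dual S N Phi -> Nd (a *: Phi) <= `|a| * Nd Phi.
  move=> dP; apply: (dn_least dNd).
  - exact: (spZ _ dual_subspace dP).
  - by rewrite mulr_ge0// (dn_ge0 dNd).
  - move=> v Sv; change (a * Phi v <= `|a| * Nd Phi * N v).
    rewrite (le_trans (ler_norm _))// normrM -mulrA ler_wpM2l//.
    exact: (dn_ub dNd).
split.
- exact: dual_subspace.
- exact: dn_ge0.
- move=> a Phi dP; apply/eqP; rewrite eq_le ZP//=.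
  have [->|a0] := eqVneq a 0.
    rewrite normr0 mul0r (dn_ge0 dNd)//; exact: (spZ _ dual_subspace dP).
  (* The inequality already proved, applied to [a^-1] and [a *: Phi], is the reverse inequality. *)
  have := ZP a^-1 _ (spZ a dual_subspace dP).
  rewrite scalerA mulVf// scale1r normfV => h.
  by rewrite -ler_pdivlMl ?normr_gt0.
- move=> Phi Psi dP dQ; apply: (dn_least dNd).
  + exact: (spD dual_subspace dP dQ).
  + by rewrite addr_ge0// (dn_ge0 dNd).
  + move=> v Sv; change (Phi v + Psi v <= (Nd Phi + Nd Psi) * N v).
    by rewrite mulrDl lerD// (le_trans (ler_norm _))// (dn_ub dNd).
Qed.

(** Otherwise [Phi] stays below [Nd Phi - eps] on the unit ball. The value at 0 shows that this
    bound is positive, and scaling makes it admissible in [dn_least], which contradicts the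
    minimality of [Nd Phi]. *)
Lemma dual_norm_approx Phi eps : dual S N Phi -> 0 < eps ->
  exists v, [/\ S v, N v <= 1 & Nd Phi <= Phi v + eps].
Proof.
move=> dP e0; apply: contrapT => /forallNP H.
have {}H v : S v -> N v <= 1 -> Phi v < Nd Phi - eps.
  move=> Sv Nv; rewrite ltNge; apply/negP => h; apply: (H v); split => //; lra.
have C0 : 0 < Nd Phi - eps.
  have N01 : N 0 <= 1 by rewrite sn0.
  by have := H _ (sp0 sS) N01; rewrite (dual0 dP).
suff : Nd Phi <= Nd Phi - eps by lra.
apply: (dn_least dNd) => //; first exact: ltW.
move=> v Sv; have := sn_ge0 sN Sv; rewrite le_eqVlt => /predU1P[N0|N0].
  have := dn_ub dNd dP Sv; rewrite -N0 !mulr0 normr_le0 => /eqP ->//.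
have := H ((N v)^-1 *: v) (spZ _ sS Sv).
rewrite (sn_Z sN)// normfV (gtr0_norm N0) mulVf ?gt_eqF// lexx => /(_ isT).
by rewrite dualZ// => /ltW; rewrite ler_pdivrMl// mulrC.
Qed.

End seminorm_theory.

Section psd_theory.
Variables (R : realType) (E : lmodType R).
Variables (S : set E) (B : E -> E -> R).
Hypothesis pB : psd_form S B.
Let sS := psd_sub pB.
Local Notation N := (form_norm B).

Lemma psdl0 w : S w -> B 0 w = 0.
Proof.
move=> Sw; have := psd_lin pB (-1) (sp0 sS) (sp0 sS) Sw.
by rewrite scaler0 addr0 mulN1r addNr.
Qed.

Lemma psdlZ a v w : S v -> S w -> B (a *: v) w = a * B v w.
Proof.
move=> Sv Sw; rewrite -[_ *: _]addr0 (psd_lin pB)// ?psdl0// ?addr0//.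
exact: sp0.
Qed.

Lemma psdlD v v' w : S v -> S v' -> S w -> B (v + v') w = B v w + B v' w.
Proof. by move=> Sv Sv' Sw; rewrite -{1}[v]scale1r (psd_lin pB)// mul1r. Qed.

Lemma psdlB v v' w : S v -> S v' -> S w -> B (v - v') w = B v w - B v' w.
Proof.
move=> Sv Sv' Sw; rewrite psdlD//; last exact: spN.
by rewrite -scaleN1r psdlZ// mulN1r.
Qed.

Lemma psdrZ a v w : S v -> S w -> B v (a *: w) = a * B v w.
Proof.
move=> Sv Sw; rewrite (psd_sym pB)// ?psdlZ// 1?(psd_sym pB)//; exact: spZ.
Qed.

Lemma psdrD v w w' : S v -> S w -> S w' -> B v (w + w') = B v w + B v w'.
Proof.
move=> Sv Sw Sw'; rewrite (psd_sym pB)//; last exact: spD.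
by rewrite psdlD// (psd_sym pB Sw)// (psd_sym pB Sw').
Qed.

Lemma psdrB v w w' : S v -> S w -> S w' -> B v (w - w') = B v w - B v w'.
Proof.
move=> Sv Sw Sw'; rewrite (psd_sym pB)//; last exact: spB.
by rewrite psdlB// (psd_sym pB Sw)// (psd_sym pB Sw').
Qed.

Lemma psdDD v w : S v -> S w -> B (v + w) (v + w) = B v v + 2 * B v w + B w w.
Proof.
move=> Sv Sw; rewrite psdlD// ?psdrD// ?(psd_sym pB Sw Sv); last exact: spD.
ring.
Qed.

Lemma psd_cs2 v w : S v -> S w -> B v w ^+ 2 <= B v v * B w w.
Proof.
move=> Sv Sw; have H t : 0 <= t ^+ 2 * B v v + 2 * t * B v w + B w w.
  have := psd_ge0 pB (spL sS t Sv Sw); rewrite psdDD// ?psdlZ// ?psdrZ//;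
    rewrite ?psdlZ//; try exact: spZ.
  by move=> h; rewrite (_ : _ + _ = t * (t * B v v) + 2 * (t * B v w) + B w w)//; ring.
have := psd_ge0 pB Sv; rewrite le_eqVlt => /predU1P[b0|b0].
  rewrite -b0 mul0r; have [->|/eqP c0] := eqVneq (B v w) 0; first by rewrite expr0n.
  (* When [B v v = 0] the quadratic in t is affine, and this t gives it the value -1. Otherwise,
     below, t is its minimizer. *)
  have := H (- (B w w + 1) / (2 * B v w)); rewrite -b0 mulr0 add0r.
  have -> : 2 * (- (B w w + 1) / (2 * B v w)) * B v w = - (B w w + 1) by field; apply/eqP.
  lra.
have := H (- B v w / B v v).
have -> : (- B v w / B v v) ^+ 2 * B v v + 2 * (- B v w / B v v) * B v w + B w w
  = B w w - B v w ^+ 2 / B v v by field; rewrite gt_eqF.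
by rewrite subr_ge0 ler_pdivrMr// mulrC.
Qed.

Lemma form_norm_sqr v : S v -> N v ^+ 2 = B v v.
Proof. by move=> Sv; rewrite sqr_sqrtr// (psd_ge0 pB). Qed.

Lemma psd_cs v w : S v -> S w -> `|B v w| <= N v * N w.
Proof.
move=> Sv Sw; rewrite -[leLHS]sqrtr_sqr; rewrite -sqrtrM ?(psd_ge0 pB)//.
by rewrite ler_wsqrtr// psd_cs2.
Qed.

Lemma psd_seminorm : seminorm_on S N.
Proof.
split; [exact: (psd_sub pB)|by move=> v _; exact: sqrtr_ge0| |].
  move=> a v Sv; rewrite /form_norm psdlZ// ?psdrZ//; last exact: spZ.
  by rewrite mulrA -expr2 sqrtrM ?sqr_ge0// sqrtr_sqr.
move=> v w Sv Sw; have nv := sqrtr_ge0 (B v v); have nw := sqrtr_ge0 (B w w).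
rewrite -(@ler_pXn2r _ 2) ?nnegrE ?addr_ge0 ?sqrtr_ge0//.
rewrite form_norm_sqr ?psdDD//; last exact: spD.
rewrite sqrrD !form_norm_sqr//.
have := le_trans (ler_norm _) (psd_cs Sv Sw).
by rewrite mulr2n => h; lra.
Qed.

Lemma psd_null v w : S v -> S w -> N v = 0 -> B v w = 0.
Proof.
by move=> Sv Sw N0; apply/eqP; rewrite -normr_le0 (le_trans (psd_cs Sv Sw))// N0 mul0r.
Qed.

Lemma psd_dual w : S w -> dual S N (B w).
Proof.
move=> Sw; split=> [a v v' Sv Sv'|].
  by rewrite psdrD ?psdrZ//; exact: spZ.
by exists (N w) => v Sv; exact: psd_cs.
Qed.

Variable Nd : (E -> R) -> R.
Hypothesis dNd : dual_norm S N Nd.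

Lemma dual_norm_psd w : S w -> Nd (B w) = N w.
Proof.
move=> Sw; apply/eqP; rewrite eq_le; apply/andP; split.
  apply: (dn_least dNd); [exact: psd_dual|exact: sqrtr_ge0|].
  by move=> v Sv; rewrite (le_trans (ler_norm _))// psd_cs.
have /predU1P[<-|N0] : (0 == N w) || (0 < N w) by rewrite -le_eqVlt sqrtr_ge0.
  by rewrite (dn_ge0 dNd)//; exact: psd_dual.
have := le_trans (ler_norm _) (dn_ub dNd (psd_dual Sw) Sw).
by rewrite -form_norm_sqr// expr2 ler_pM2r.
Qed.

Lemma quad_le_dual_norm Phi v : dual S N Phi -> S v ->
  2 * Phi v - B v v <= Nd Phi ^+ 2.
Proof.
move=> dP Sv; have := le_trans (ler_norm _) (dn_ub dNd dP Sv).
rewrite -form_norm_sqr// => h.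
have := sqr_ge0 (Nd Phi - N v); rewrite sqrrB mulr2n => h'; lra.
Qed.

Lemma dual_norm_le_quad Phi c : dual S N Phi ->
  (forall v, S v -> 2 * Phi v - B v v <= c) -> Nd Phi ^+ 2 <= c.
Proof.
move=> dP H; have c0 : 0 <= c.
  have := H _ (sp0 sS); rewrite psdl0 ?(dual0 psd_seminorm dP) ?mulr0 ?subr0//.
  exact: sp0.
rewrite -(sqr_sqrtr c0) ler_pXn2r ?nnegrE ?sqrtr_ge0 ?(dn_ge0 dNd)//.
apply: (dn_least dNd) => // v Sv.
have /predU1P[N0|N0] : (0 == N v) || (0 < N v) by rewrite -le_eqVlt sqrtr_ge0.
  by have := dn_ub dNd dP Sv; rewrite -N0 !mulr0 normr_le0 => /eqP ->.
have B0 : 0 < B v v by rewrite -form_norm_sqr// exprn_gt0.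
(* On the line through [v], the quadratic [2 * Phi - B] is largest at this multiple, where it equals
   [Phi v ^+ 2 / B v v]. *)
have := H (Phi v / B v v *: v) (spZ _ sS Sv).
rewrite (dualZ psd_seminorm)// psdlZ ?psdrZ//; last exact: spZ.
have -> : 2 * (Phi v / B v v * Phi v) - Phi v / B v v * (Phi v / B v v * B v v) =
  Phi v ^+ 2 / B v v by field; rewrite gt_eqF.
rewrite ler_pdivrMr// => h; rewrite /form_norm -sqrtrM//.
by rewrite (le_trans (ler_norm _))// -sqrtr_sqr ler_wsqrtr.
Qed.

(* [Nd Phi ^+ 2] is the supremum of [2 * Phi v - B v v], so the identity is the
   substitution [v := v + e]; no Riesz representative of [Phi] is needed. *)
Lemma dual_norm_shift Phi e : dual S N Phi -> S e ->
  Nd (Phi + B e) ^+ 2 = Nd Phi ^+ 2 + 2 * Phi e + B e e.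
Proof.
move=> dP Se; have dPe : dual S N (Phi + B e).
  exact: (spD (dual_subspace _ _) dP (psd_dual Se)).
apply/eqP; rewrite eq_le; apply/andP; split.
  apply: dual_norm_le_quad => // v Sv.
  have := quad_le_dual_norm dP (spB sS Sv Se).
  rewrite (dualB psd_seminorm)// psdlB// ?psdrB// ?(psd_sym pB Sv Se); last exact: spB.
  change ((Phi + B e) v) with (Phi v + B e v); lra.
suff : Nd Phi ^+ 2 <= Nd (Phi + B e) ^+ 2 - 2 * Phi e - B e e by lra.
apply: dual_norm_le_quad => // v Sv.
have := quad_le_dual_norm dPe (spD sS Sv Se).
change ((Phi + B e) (v + e)) with (Phi (v + e) + B e (v + e)).
rewrite (dualD dP)// psdDD// psdrD// (psd_sym pB Sv Se); lra.
Qed.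

End psd_theory.

(** * Integrability up to null sets *)

Section ae_integral.
Local Open Scope ereal_scope.
Context d (T : measurableType d) (R : realType).
Variable mu : {measure set T -> \bar R}.
Implicit Types (D : set T) (f g : T -> \bar R).
Import HBNNSimple.

(* Modifying a nonnegative simple minorant on a null set does not change its
   integral. *)
Lemma ae_ge0_le_integral_nomeas D f g :
  (forall x, D x -> 0 <= f x) -> (forall x, D x -> 0 <= g x) ->
  {ae mu, forall x, D x -> f x <= g x} ->
  \int[mu]_(x in D) f x <= \int[mu]_(x in D) g x.
Proof.
move=> f0 g0 [N [mN N0 fgN]].
rewrite ge0_integralE// [leRHS]ge0_integralE//=.
apply/ge_ereal_sup => /= _ [h hf <-].
pose h' : {nnsfun T >-> R} := proj_nnsfun h (measurableC mN).
have h'E x : h' x = (h x * \1_(~` N) x)%R by [].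
have hh' : sintegral mu h = sintegral mu h'.
  rewrite -!integralT_nnsfun; apply: ae_eq_integral => //.
  - by apply/measurable_EFinP.
  - by apply/measurable_EFinP.
  - exists N; split => // x /= /not_implyP[_] hx.
    apply: contrapT => nNx; apply: hx.
    change ((h x)%:E = (h' x)%:E); by rewrite h'E indicE mem_set ?mulr1.
rewrite hh'; apply: ereal_sup_ubound; exists h' => // x.
rewrite h'E indicE; have [Nx|nNx] := pselect (N x).
  rewrite memNset ?mulr0//.
  by rewrite patchE; case: ifPn => // /set_mem /g0.
rewrite mem_set// mulr1 (le_trans (hf x))// !patchE; case: ifPn => // /set_mem Dx.
by apply: contrapT => nle; apply: nNx; apply: fgN => /= /(_ Dx).
Qed.

(** The integrals in the statement have integrands such as [Hm1norm Om (dt Om T phi t)], for which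
    only agreement almost everywhere with a measurable function can be established; this lemma lets
    them be replaced all the same. *)
Lemma ae_eq_integral_nomeas D f g :
  ae_eq mu D f g -> \int[mu]_(x in D) f x = \int[mu]_(x in D) g x.
Proof.
have ge0 f' g' : (forall x, D x -> 0 <= f' x) -> (forall x, D x -> 0 <= g' x) ->
    ae_eq mu D f' g' -> \int[mu]_(x in D) f' x = \int[mu]_(x in D) g' x.
  move=> f0 g0 fg; apply/eqP; rewrite eq_le; apply/andP; split;
  apply: ae_ge0_le_integral_nomeas => //; apply: filterS fg => x h Dx;
  by rewrite h.
move=> /ae_eq_funeposneg[p n]; rewrite integralE [RHS]integralE.
by congr (_ - _); apply: ge0.
Qed.

End ae_integral.

Section ae_measurable.
Context d (T : measurableType d) (R : realType).
Variables (mu : {measure set T -> \bar R}) (D : set T).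
Implicit Types f g h k : T -> R.

(** The sigma-algebras here are not complete, so equality almost everywhere with a measurable
    function does not give measurability and has to be carried as a separate notion. *)
Definition aemeas f := exists2 g, measurable_fun D g & ae_eq mu D f g.

Definition aeint f :=
  exists2 g, mu.-integrable D (EFin \o g) & ae_eq mu D f g.

Hypothesis mD : measurable D.

Lemma ae_eq_Rintegral f g : ae_eq mu D f g ->
  \int[mu]_(x in D) f x = \int[mu]_(x in D) g x.
Proof.
move=> fg; congr fine; apply: ae_eq_integral_nomeas.
by apply: filterS fg => x h /h ->.
Qed.

Lemma measurable_aemeas f : measurable_fun D f -> aemeas f.
Proof. by exists f => //; exact: ae_eq_refl. Qed.

Lemma aeint_aemeas f : aeint f -> aemeas f.
Proof.
by case=> g ig fg; exists g => //; apply/measurable_EFinP; exact: measurable_int ig.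
Qed.

Lemma integrable_aeint f : mu.-integrable D (EFin \o f) -> aeint f.
Proof. by exists f => //; exact: ae_eq_refl. Qed.

Lemma aeint_eq f g : ae_eq mu D f g -> aeint g -> aeint f.
Proof. by move=> fg [h mh gh]; exists h => //; exact: ae_eq_trans gh. Qed.

Lemma aemeasD f g : aemeas f -> aemeas g -> aemeas (fun x => f x + g x).
Proof.
move=> [f' mf ff] [g' mg gg]; exists (fun x => f' x + g' x).
  exact: measurable_funD.
by apply: filterS2 ff gg => x h1 h2 Dx; rewrite h1// h2.
Qed.

Lemma aemeasM f g : aemeas f -> aemeas g -> aemeas (fun x => f x * g x).
Proof.
move=> [f' mf ff] [g' mg gg]; exists (fun x => f' x * g' x).
  exact: measurable_funM.
by apply: filterS2 ff gg => x h1 h2 Dx; rewrite h1// h2.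
Qed.

Lemma aemeas_cst c : aemeas (fun=> c).
Proof. by exists (cst c) => //; exact: ae_eq_refl. Qed.

Lemma aemeasX f n : aemeas f -> aemeas (fun x => f x ^+ n).
Proof.
move=> [f' mf ff]; exists (fun x => f' x ^+ n); first exact: measurable_funX.
by apply: filterS ff => x h Dx; rewrite h.
Qed.

Lemma aemeas_cvg (F : nat -> T -> R) f : (forall n, aemeas (F n)) ->
  {ae mu, forall x, D x -> F n x @[n --> \oo] --> f x} -> aemeas f.
Proof.
move=> mF cF; have /choice[G HG] : forall n, exists g,
    measurable_fun D g /\ ae_eq mu D (F n) g.
  by move=> n; have [g ? ?] := mF n; exists g.
have : {ae mu, forall x, D x -> G n x @[n --> \oo] --> f x}.
  have /ae_foralln H : forall n, {ae mu, forall x, D x -> F n x = G n x}.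
    by move=> n; exact: (HG n).2.
  apply: filterS2 cF H => x c h Dx; have := c Dx.
  by under eq_fun do rewrite h//.
move=> [N [mN N0 sN]].
(* Multiplying by the indicator of the complement of [N] turns convergence almost everywhere into
   convergence everywhere, at the price of changing [f] on a null set. *)
exists (fun x => f x * \1_(~` N) x); last first.
  exists N; split => // x /= /not_implyP[Dx] hx; apply: contrapT => nNx.
  by apply: hx; rewrite indicE mem_set ?mulr1.
have mN' : measurable_fun D (\1_(~` N) : T -> R).
  apply: measurable_funTS; apply: measurable_indic; exact: measurableC.
apply: (measurable_fun_cvg (h := fun n x => G n x * \1_(~` N) x)).
  by move=> n; apply: measurable_funM => //; exact: (HG n).1.
move=> x Dx; rewrite indicE; have [Nx|nNx] := pselect (N x).
  rewrite memNset//.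
  under eq_fun do rewrite mulr0.
  by rewrite mulr0; exact: cvg_cst.
rewrite mem_set// mulr1; under eq_fun do rewrite mulr1.
by apply: contrapT => nc; apply: nNx; apply: sN => /= /(_ Dx).
Qed.

Lemma aeintD f g : aeint f -> aeint g -> aeint (fun x => f x + g x).
Proof.
move=> [f' mf ff] [g' mg gg]; exists (fun x => f' x + g' x).
  exact: (integrableD mD mf mg).
by apply: filterS2 ff gg => x h1 h2 Dx; rewrite h1// h2.
Qed.

Lemma aeintZ c f : aeint f -> aeint (fun x => c * f x).
Proof.
move=> [f' mf ff]; exists (fun x => c * f' x); first exact: (integrableZl mD c mf).
by apply: filterS ff => x h Dx; rewrite h.
Qed.

Lemma aeintN f : aeint f -> aeint (fun x => - f x).
Proof.
move=> /(aeintZ (-1)); apply: aeint_eq; apply: aeW => x _; by rewrite mulN1r.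
Qed.

Lemma aeintB f g : aeint f -> aeint g -> aeint (fun x => f x - g x).
Proof. by move=> mf mg; apply: aeintD => //; exact: aeintN. Qed.

Lemma aeint0 : aeint (fun=> 0).
Proof. by exists (cst 0); [exact: integrable0|exact: ae_eq_refl]. Qed.

Lemma aeint_sum (I : Type) (r : seq I) (F : I -> T -> R) :
  (forall i, aeint (F i)) -> aeint (fun x => \sum_(i <- r) F i x).
Proof.
move=> mF; elim: r => [|i r IH].
  by apply: aeint_eq aeint0; apply: aeW => x _; rewrite big_nil.
apply: aeint_eq (aeintD (mF i) IH).
by apply: aeW => x _; rewrite big_cons.
Qed.

Lemma aeint_le f k : aemeas f -> aeint k ->
  {ae mu, forall x, D x -> `|f x| <= k x} -> aeint f.
Proof.
move=> [g mg fg] [h ih kh] le.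
(* The measurable versions [g] and [h] satisfy the bound only almost everywhere. Setting [g] to zero
   on [N], where it fails, gives a version dominated at every point. *)
pose N := D `&` [set x | h x < `|g x|].
have mN : measurable N.
  have -> : N = D `&` (fun x => h x < `|g x|) @^-1` [set true].
    by apply/seteqP; split=> x [Dx /= hx]; split.
  apply: (measurable_fun_ltr _ _ mD) => //=.
    by apply/measurable_EFinP; exact: measurable_int ih.
  exact: measurableT_comp.
exists (fun x => g x * \1_(~` N) x); last first.
  apply: filterS3 fg kh le => x h1 h2 h3 Dx.
  rewrite indicE mem_set ?mulr1 ?h1//= => -[_]/=.
  by rewrite ltNge -h1// -h2// h3.
apply: le_integrable ih => //.
  apply/measurable_EFinP; apply: measurable_funM => //.
  by apply: measurable_funTS; apply: measurable_indic; exact: measurableC.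
move=> x Dx /=; rewrite lee_fin indicE.
have [Nx|nNx] := pselect (N x).
  by rewrite memNset ?mulr0 ?normr0.
rewrite mem_set// mulr1 (le_trans _ (ler_norm _))// leNgt.
by apply/negP => lt; apply: nNx.
Qed.

Lemma aeintP f : aemeas f -> {ae mu, forall x, D x -> 0 <= f x} ->
  (\int[mu]_(x in D) (f x)%:E < +oo)%E -> aeint f.
Proof.
move=> [g mg fg] f0 lty; exists g => //.
apply/integrableP; split; first exact/measurable_EFinP.
rewrite (_ : (\int[mu]_(x in D) `|(EFin \o g) x|)%E =
  (\int[mu]_(x in D) (f x)%:E)%E)//.
apply: ae_eq_integral_nomeas; apply: filterS2 fg f0 => x h1 h2 Dx /=.
by rewrite -h1// ger0_norm// h2.
Qed.

Lemma aeint_lty f : aeint f -> (\int[mu]_(x in D) (f x)%:E < +oo)%E.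
Proof.
move=> [g ig fg]; rewrite (@ae_eq_integral_nomeas _ _ _ _ _ _ (EFin \o g)).
  exact: integrable_lty.
by apply: filterS fg => x h /h ->.
Qed.

Lemma aeRintD f g : aeint f -> aeint g ->
  \int[mu]_(x in D) (f x + g x) = \int[mu]_(x in D) f x + \int[mu]_(x in D) g x.
Proof.
move=> [f' mf ff] [g' mg gg]; rewrite (ae_eq_Rintegral ff) (ae_eq_Rintegral gg).
rewrite -RintegralD//; apply: ae_eq_Rintegral.
by apply: filterS2 ff gg => x h1 h2 Dx; rewrite h1// h2.
Qed.

Lemma aeRintZ c f : aeint f ->
  \int[mu]_(x in D) (c * f x) = c * \int[mu]_(x in D) f x.
Proof.
move=> [f' mf ff]; rewrite (ae_eq_Rintegral ff) -RintegralZl//.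
apply: ae_eq_Rintegral.
by apply: filterS ff => x h Dx; rewrite h.
Qed.

Lemma aeRintN f : aeint f ->
  \int[mu]_(x in D) (- f x) = - \int[mu]_(x in D) f x.
Proof.
move=> mf; rewrite -mulN1r -aeRintZ//.
by apply: ae_eq_Rintegral; apply: aeW => x _; rewrite mulN1r.
Qed.

Lemma aeRintB f g : aeint f -> aeint g ->
  \int[mu]_(x in D) (f x - g x) = \int[mu]_(x in D) f x - \int[mu]_(x in D) g x.
Proof. by move=> mf mg; rewrite aeRintD ?aeRintN//; exact: aeintN. Qed.

Lemma aeRint_ge0 f : {ae mu, forall x, D x -> 0 <= f x} ->
  0 <= \int[mu]_(x in D) f x.
Proof.
move=> f0; rewrite (@ae_eq_Rintegral _ (fun x => `|f x|)).
  by apply: Rintegral_ge0 => x _; exact: normr_ge0.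
by apply: filterS f0 => x h Dx; rewrite ger0_norm// h.
Qed.

Lemma aeRint_le f g : aeint f -> aeint g ->
  {ae mu, forall x, D x -> f x <= g x} ->
  \int[mu]_(x in D) f x <= \int[mu]_(x in D) g x.
Proof.
move=> mf mg fg; rewrite -subr_ge0 -aeRintB//; apply: aeRint_ge0.
by apply: filterS fg => x h Dx; rewrite subr_ge0 h.
Qed.

Lemma aeRint_norm_le f k : aemeas f -> aeint k ->
  {ae mu, forall x, D x -> `|f x| <= k x} ->
  `|\int[mu]_(x in D) f x| <= \int[mu]_(x in D) k x.
Proof.
move=> mf ik le; have fi := aeint_le mf ik le.
rewrite ler_norml; apply/andP; split.
  rewrite -aeRintN//; apply: aeRint_le => //; first exact: aeintN.
  by apply: filterS le => x h /h; rewrite ler_norml => /andP[].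
apply: aeRint_le => //.
by apply: filterS le => x h /h; rewrite ler_norml => /andP[].
Qed.

Lemma aeRint_sum (I : Type) (r : seq I) (F : I -> T -> R) :
  (forall i, aeint (F i)) ->
  \int[mu]_(x in D) (\sum_(i <- r) F i x) = \sum_(i <- r) \int[mu]_(x in D) F i x.
Proof.
move=> mF; elim: r => [|i r IH].
  rewrite big_nil (@ae_eq_Rintegral _ (cst 0)) ?Rintegral_cst ?mul0r//.
  by apply: aeW => x _; rewrite big_nil.
rewrite big_cons -IH -aeRintD//; last exact: aeint_sum.
by apply: ae_eq_Rintegral; apply: aeW => x _; rewrite big_cons.
Qed.

Definition sqint : set (T -> R) :=
  [set f | aemeas f /\ aeint (fun x => f x ^+ 2)].

(** Used twice: over the domain it is [L2dot], and over the time interval its triangle inequality is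
    the Minkowski inequality for [bochnerL2_norm]. *)
Definition L2form (f g : T -> R) : R := \int[mu]_(x in D) (f x * g x).

Lemma sqint_mul f g : sqint f -> sqint g -> aeint (fun x => f x * g x).
Proof.
move=> [mf f2] [mg g2]; apply: aeint_le (aeintD f2 g2) _; first exact: aemeasM.
apply: aeW => x _; rewrite ler_norml; apply/andP; split.
  have := sqr_ge0 (f x + g x); have := sqr_ge0 (f x); have := sqr_ge0 (g x).
  by rewrite sqrrD; lra.
have := sqr_ge0 (f x - g x); have := sqr_ge0 (f x); have := sqr_ge0 (g x).
by rewrite sqrrB; lra.
Qed.

Lemma sqint_subspace : subspace sqint.
Proof.
split.
  split; first exact: aemeas_cst.
  by apply: aeint_eq aeint0; apply: aeW => x _; rewrite expr0n.
move=> a f g sf sg; split.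
  by apply: aemeasD sg.1; apply: aemeasM sf.1; exact: aemeas_cst.
apply: aeint_eq (aeintD (aeintD (aeintZ (a ^+ 2) sf.2) (aeintZ (2 * a) (sqint_mul sf sg))) sg.2).
apply: aeW => x _; change ((a * f x + g x) ^+ 2 =
  a ^+ 2 * f x ^+ 2 + 2 * a * (f x * g x) + g x ^+ 2); ring.
Qed.

Lemma L2form_psd : psd_form sqint L2form.
Proof.
split; first exact: sqint_subspace.
- by move=> f g _ _; apply: ae_eq_Rintegral; apply: aeW => x _; rewrite mulrC.
- move=> a f f' g sf sf' sg; rewrite /L2form.
  have i1 := sqint_mul sf sg; have i2 := sqint_mul sf' sg.
  rewrite -(aeRintZ _ i1) -(aeRintD (aeintZ _ i1) i2).
  apply: ae_eq_Rintegral; apply: aeW => x _.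
  change ((a * f x + f' x) * g x = a * (f x * g x) + f' x * g x); ring.
- by move=> f sf; apply: Rintegral_ge0 => x _; rewrite -expr2 sqr_ge0.
Qed.

End ae_measurable.

(** * Strong measurability *)

Lemma cvg0_le (R : realType) (u v : nat -> R) :
  (forall n, `|u n| <= v n) -> v n @[n --> \oo] --> (0 : R) ->
  u n @[n --> \oo] --> (0 : R).
Proof.
move=> uv v0; apply: (@squeeze_cvgr _ _ _ _ (fun n => - v n) v) => //.
  by apply: nearW => n; rewrite -ler_norml.
by rewrite -oppr0; exact: cvgN.
Qed.

Section ae_combinators.
Context d (T : measurableType d) (R : realType).
Variables (mu : {measure set T -> \bar R}) (A : T -> Prop).
Implicit Types P Q : T -> Prop.
Local Notation ae P := {ae mu, forall x, A x -> P x}.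

Lemma ae_in0 P : (forall x, A x -> P x) -> ae P.
Proof. by move=> h; apply: aeW => x; exact: h. Qed.

Lemma ae_in1 P Q : ae P -> (forall x, A x -> P x -> Q x) -> ae Q.
Proof. by move=> p h; apply: filterS p => x p Ax; apply: h => //; exact: p. Qed.

Lemma ae_in2 P1 P2 Q : ae P1 -> ae P2 -> (forall x, A x -> P1 x -> P2 x -> Q x) ->
  ae Q.
Proof.
by move=> p1 p2 h; apply: filterS2 p1 p2 => x p1 p2 Ax; apply: h; auto.
Qed.

Lemma ae_in3 P1 P2 P3 Q : ae P1 -> ae P2 -> ae P3 ->
  (forall x, A x -> P1 x -> P2 x -> P3 x -> Q x) -> ae Q.
Proof.
by move=> p1 p2 p3 h; apply: (ae_in2 p1 (ae_in2 p2 p3 (fun x _ a b => conj a b))) =>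
  x Ax h1 [h2 h3]; exact: h.
Qed.

Lemma ae_in4 P1 P2 P3 P4 Q : ae P1 -> ae P2 -> ae P3 -> ae P4 ->
  (forall x, A x -> P1 x -> P2 x -> P3 x -> P4 x -> Q x) -> ae Q.
Proof.
by move=> p1 p2 p3 p4 h; apply: (ae_in3 p1 p2 (ae_in2 p3 p4 (fun x _ a b => conj a b)))
  => x Ax h1 h2 [h3 h4]; exact: h.
Qed.

Lemma ae_in_all (P : nat -> T -> Prop) : (forall n, ae (P n)) ->
  {ae mu, forall x, A x -> forall n, P n x}.
Proof.
by move=> h; apply: filterS (ae_foralln h) => x p Ax n; exact: p.
Qed.

End ae_combinators.

Section simple_functions.
Variable R : realType.
Local Notation mu := (@lebesgue_measure R).

(** An arbitrary finite index type lets two simple functions be combined over the product of their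
    index sets. *)
Lemma simple_fun_fin (E : zmodType) (S : set E) (J : finType) (val : J -> E)
    (idx : R -> J) : (forall j, S (val j)) ->
  (forall j, measurable (idx @^-1` [set j] : set (measurableTypeR R))) ->
  simple_fun S (fun t => val (idx t)).
Proof.
move=> Sv mi; exists #|J|, (fun i => val (enum_val i)), (fun t => enum_rank (idx t)).
split=> [i|i|t]; [exact: Sv| |by rewrite enum_rankK].
rewrite (_ : _ @^-1` _ = idx @^-1` [set enum_val i])//.
apply/seteqP; split=> t /= h; first by rewrite -h enum_rankK.
by rewrite h enum_valK.
Qed.

Lemma simple_fun_comp (E E' : zmodType) (S : set E) (S' : set E') (op : E -> E')
  (s : R -> E) : (forall v, S v -> S' (op v)) -> simple_fun S s ->
  simple_fun S' (fun t => op (s t)).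
Proof.
move=> oS [k [val [idx [Sv mi sE]]]]; exists k, (op \o val), idx; split => //.
  by move=> i; apply: oS.
by move=> t; rewrite sE.
Qed.

Lemma simple_fun_comp2 (E E' F : zmodType) (S : set E) (S' : set E') (U : set F)
  (op : E -> E' -> F) (s : R -> E) (s' : R -> E') :
  (forall v w, S v -> S' w -> U (op v w)) -> simple_fun S s -> simple_fun S' s' ->
  simple_fun U (fun t => op (s t) (s' t)).
Proof.
move=> oU [k [val [idx [Sv mi sE]]]] [k' [val' [idx' [Sv' mi' sE']]]].
have -> : (fun t => op (s t) (s' t)) =
    (fun t => (fun j => op (val j.1) (val' j.2)) (idx t, idx' t)).
  by apply/funext => t; rewrite sE sE'.
apply: (@simple_fun_fin _ _ ('I_k * 'I_k')%type
  (fun j => op (val j.1) (val' j.2)) (fun t => (idx t, idx' t))) => [j|[i j]].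
  exact: oU.
rewrite (_ : _ @^-1` _ = idx @^-1` [set i] `&` idx' @^-1` [set j]).
  exact: measurableI.
by apply/seteqP; split=> [t [<- <-]|t [/= <- <-]].
Qed.

Lemma simple_fun_cst (E : zmodType) (S : set E) (v : E) :
  S v -> simple_fun S (fun _ : R => v).
Proof.
move=> Sv; exists 1%N, (fun=> v), (fun=> ord0); split=> // i.
by rewrite (_ : _ @^-1` _ = setT)//; apply/seteqP; split=> // t _; rewrite /= (ord1 i).
Qed.

Lemma simple_fun_real (E : zmodType) (S : set E) (s : R -> E) (g : E -> R) :
  simple_fun S s -> measurable_fun setT (fun t : measurableTypeR R => g (s t)).
Proof.
move=> [k [val [idx [Sv mi sE]]]].
rewrite (_ : (fun t => _) =
  (fun t => \sum_(i < k) g (val i) * \1_(idx @^-1` [set i]) t)).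
  apply: measurable_sum => i; apply: measurable_funM => //.
apply/funext => t; rewrite (bigD1 (idx t))//= big1 ?addr0.
  by rewrite indicE mem_set// mulr1 sE.
move=> i /eqP ni; rewrite indicE memNset ?mulr0//= => h.
by apply: ni.
Qed.

End simple_functions.

Section strong_measurability.
Variables (R : realType) (T : R).
Local Notation mu := (@lebesgue_measure R).
Local Notation I := (`]0, T[%classic : set (measurableTypeR R)).

Lemma mI : measurable I.
Proof. exact: measurable_itv. Qed.

Section one_space.
Variables (E : lmodType R) (S : set E) (N : E -> R).
Hypothesis sN : seminorm_on S N.
Let sS := sn_sub sN.
Local Notation smeas := (strongly_measurable S N T).
Local Notation inS phi := {ae mu, forall t, t \in `]0, T[ -> S (phi t)}.
Implicit Types phi psi : R -> E.

Lemma simple_fun_S (s : R -> E) t : simple_fun S s -> S (s t).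
Proof. by move=> [k [val [idx [Sv _ ->]]]]. Qed.

Lemma smeas_eq phi psi : {ae mu, forall t, t \in `]0, T[ -> phi t = psi t} ->
  smeas psi -> smeas phi.
Proof.
move=> e [s [ss c]]; exists s; split => //.
by apply: (ae_in2 e c) => t tI -> .
Qed.

Lemma smeasD phi psi : inS phi -> inS psi -> smeas phi -> smeas psi ->
  smeas (fun t => phi t + psi t).
Proof.
move=> Sp Sq [s [ss sc]] [r [rs rc]]; exists (fun n t => s n t + r n t); split.
  by move=> n; apply: (simple_fun_comp2 (S := S) (S' := S)) => // v w; exact: spD.
apply: (ae_in4 Sp Sq sc rc) => t tI h1 h2 h3 h4.
apply: (cvg0_le (v := fun n => N (s n t - phi t) + N (r n t - psi t))).
  move=> n; have Ss := simple_fun_S t (ss n); have Sr := simple_fun_S t (rs n).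
  rewrite ger0_norm; last first.
    by apply: (sn_ge0 sN); apply: spB => //; exact: spD.
  rewrite opprD addrACA; by apply: (sn_D sN); exact: spB.
by rewrite -[0]addr0; apply: cvgD.
Qed.

Lemma smeas_cst v : S v -> smeas (fun=> v).
Proof.
move=> Sv; exists (fun _ _ => v); split=> [n|]; first exact: simple_fun_cst.
by apply: aeW => t _; rewrite subrr (sn0 sN); exact: cvg_cst.
Qed.

Lemma smeas_scale (al : R -> R) v : S v ->
  measurable_fun setT (al : measurableTypeR R -> measurableTypeR R) ->
  (forall t, 0 <= al t <= 1) -> smeas (fun t => al t *: v).
Proof.
move=> Sv mal al01.
(* [al] is rounded down to a multiple of 1/(n+1). As [al t <= 1], the numerator is at most n+1,
   which leaves n+2 values. *)
pose tr n t := Num.truncn (al t * n.+1%:R).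
have trP n t : (tr n t)%:R <= al t * n.+1%:R < (tr n t).+1%:R.
  by apply: truncn_itv; rewrite mulr_ge0//; case/andP: (al01 t).
have tr_lt n t : (tr n t < n.+2)%N.
  rewrite -(ltr_nat R); case/andP: (trP n t) => h _; apply: (le_lt_trans h).
  rewrite (@le_lt_trans _ _ (n.+1%:R))// ?ltr_nat//.
  by rewrite ler_piMl//; case/andP: (al01 t).
pose s n t := ((tr n t)%:R / n.+1%:R) *: v.
exists s; split.
  move=> n; apply: (@simple_fun_fin _ _ _ 'I_n.+2
    (fun i => (i%:R / n.+1%:R) *: v) (fun t => Ordinal (tr_lt n t))).
    by move=> i; exact: spZ.
  move=> i; rewrite (_ : _ @^-1` _ =
    setT `&` (fun t => al t * n.+1%:R) @^-1` `[i%:R, i.+1%:R[%classic); last first.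
    apply/seteqP; split=> t /=.
      by move=> <-; split => //; rewrite /= in_itv /= trP.
    move=> [_]; rewrite in_itv/= => h; apply/val_inj => /=.
    by apply/eqP; rewrite /tr truncn_eq//; case/andP: h => h _; exact: le_trans h.
  have mf : measurable_fun setT (fun t : measurableTypeR R => al t * n.+1%:R).
    exact: measurable_funM.
  by apply: mf => //; exact: measurable_itv.
apply: aeW => t _.
apply: (cvg0_le (v := fun n => (n.+1%:R)^-1 * N v)).
  move=> n; rewrite -scalerBl (sn_Z sN)// normrM normr_id (ger0_norm (sn_ge0 sN Sv)).
  rewrite ler_wpM2r ?(sn_ge0 sN)//.
  have n0 : (0 : R) < n.+1%:R by rewrite ltr0n.
  have -> : (tr n t)%:R / n.+1%:R - al t = ((tr n t)%:R - al t * n.+1%:R) / n.+1%:R.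
    by field; rewrite gt_eqF//.
  rewrite normrM [X in _ * X]ger0_norm ?invr_ge0//; apply: ler_piMl.
    by rewrite invr_ge0.
  case/andP: (trP n t); rewrite -natr1 => h1 h2.
  by rewrite ler_norml; apply/andP; split; lra.
rewrite -[0 in X in _ --> X](mul0r (N v)); apply: cvgMl.
exact: cvg_harmonic.
Qed.

Lemma aemeas_norm phi : inS phi -> smeas phi -> aemeas mu I (fun t => N (phi t)).
Proof.
move=> Sp [s [ss sc]]; apply: (@aemeas_cvg _ _ _ mu I (fun n t => N (s n t))).
  by move=> n; apply: measurable_aemeas; apply: measurable_funTS;
    exact: simple_fun_real (ss n).
apply: (ae_in2 Sp sc) => t tI h1 h2; apply/cvgrPdist_le => e e0.
have /cvgrPdist_le /(_ _ e0) := h2; apply: filterS => n.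
rewrite sub0r normrN => h; rewrite distrC.
have Sn := simple_fun_S t (ss n).
apply: le_trans (sn_lip sN Sn h1) _.
exact: le_trans (ler_norm _) h.
Qed.

End one_space.

Lemma smeas_comp (E E' : lmodType R) (S : set E) (N : E -> R) (S' : set E')
    (N' : E' -> R) (op : E -> E') (C : R) (phi : R -> E) :
  seminorm_on S N -> seminorm_on S' N' ->
  (forall v, S v -> S' (op v)) ->
  (forall v w, S v -> S w -> N' (op v - op w) <= C * N (v - w)) ->
  {ae mu, forall t, t \in `]0, T[ -> S (phi t)} ->
  strongly_measurable S N T phi ->
  strongly_measurable S' N' T (fun t => op (phi t)).
Proof.
move=> sN sN' oS oC Sp [s [ss sc]]; exists (fun n t => op (s n t)); split.
  by move=> n; apply: (simple_fun_comp (S := S)).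
apply: (ae_in2 Sp sc) => t tI h1 h2.
apply: (cvg0_le (v := fun n => C * N (s n t - phi t))).
  move=> n; have Ss := simple_fun_S t (ss n).
  rewrite ger0_norm ?oC//.
  apply: (sn_ge0 sN'); apply: spB (sn_sub sN') _ _; exact: oS.
rewrite -[0 in X in _ --> X](mulr0 C); exact: cvgMr.
Qed.

Section duality.
Variables (E : lmodType R) (S : set E) (N : E -> R) (Nd : (E -> R) -> R).
Hypothesis sN : seminorm_on S N.
Hypothesis dN : dual_norm S N Nd.
Let sS := sn_sub sN.
Local Notation D := (dual S N).
Let sD : seminorm_on D Nd := dual_seminorm dN.

(** The pairing is jointly continuous for the two seminorms, so the pairings of simple approximants,
    which are simple real functions, converge to it almost everywhere. *)
Lemma aemeas_pairing (h : R -> E -> R) (e : R -> E) :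
  {ae mu, forall t, t \in `]0, T[ -> D (h t)} ->
  {ae mu, forall t, t \in `]0, T[ -> S (e t)} ->
  strongly_measurable D Nd T h -> strongly_measurable S N T e ->
  aemeas mu I (fun t => h t (e t)).
Proof.
move=> Dh Se [r [rs rc]] [s [ss sc]].
apply: (@aemeas_cvg _ _ _ mu I (fun n t => r n t (s n t))).
  move=> n; apply: measurable_aemeas; apply: measurable_funTS.
  have : simple_fun setT (fun t : R => r n t (s n t)).
    apply: (simple_fun_comp2 (S := D) (S' := S) (op := fun Phi v => Phi v)) => //.
  by move=> /(@simple_fun_real _ _ _ _ id).
apply: (ae_in4 Dh Se rc sc) => t tI h1 h2 h3 h4.
have : (r n t (s n t) - h t (e t)) @[n --> \oo] --> (0 : R).
  apply: (cvg0_le (v := fun n => Nd (r n t - h t) * N (s n t - e t) +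
     (Nd (r n t - h t) * N (e t) + Nd (h t) * N (s n t - e t)))).
    move=> n; have Dr := simple_fun_S t (rs n); have Ss := simple_fun_S t (ss n).
    have Drh := spB (sn_sub sD) Dr h1.
    have -> : r n t (s n t) - h t (e t) = (r n t - h t) (s n t - e t) +
       ((r n t - h t) (e t) + h t (s n t - e t)).
      rewrite (dualB sN Drh)// (dualB sN h1)//.
      change ((r n t - h t) (s n t)) with (r n t (s n t) - h t (s n t)).
      change ((r n t - h t) (e t)) with (r n t (e t) - h t (e t)); ring.
    rewrite (le_trans (ler_normD _ _))// lerD//; first by apply: (dn_ub dN) => //; exact: spB.
    rewrite (le_trans (ler_normD _ _))// lerD//; apply: (dn_ub dN) => //; exact: spB.
  rewrite [X in _ --> X](_ : 0 = 0 * 0 + (0 * N (e t) + Nd (h t) * 0)); last by ring.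
  apply: cvgD; first exact: cvgM.
  by apply: cvgD; [exact: cvgMl|exact: cvgMr].
exact: cvg_zero.
Qed.

(* Strong measurability provides a countable family of vectors norming almost
   every value of [Z]. *)
Lemma weakly_null (Z : R -> E -> R) :
  {ae mu, forall t, t \in `]0, T[ -> D (Z t)} ->
  strongly_measurable D Nd T Z ->
  (forall v, S v -> {ae mu, forall t, t \in `]0, T[ -> Z t v = 0}) ->
  {ae mu, forall t, t \in `]0, T[ -> Nd (Z t) = 0}.
Proof.
move=> DZ [s [ss sc]] Z0.
have /choice[X HX] : forall n, exists k : nat, exists val : 'I_k -> E -> R,
    (forall i, D (val i)) /\ forall t, exists i, s n t = val i.
  move=> n; have [k [val [idx [Dv _ sE]]]] := ss n.
  by exists k, val; split => // t; exists (idx t).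
pose val n := projT1 (cid (HX n)).
have Hval n : (forall i, D (val n i)) /\ forall t, exists i, s n t = val n i.
  exact: projT2 (cid (HX n)).
(* One vector for each value of each approximant and each precision 1/(m+1): a countable family, so
   the null sets attached to its members have a null union. *)
have /choice[v Hv] : forall p : {n : nat & 'I_(X n)} * nat, exists v,
    [/\ S v, N v <= 1 & Nd (val (tag p.1) (tagged p.1)) <=
      val (tag p.1) (tagged p.1) v + p.2.+1%:R^-1].
  move=> [[n i] m] /=; apply: (dual_norm_approx sN dN) => //.
    by have [h _] := Hval n; exact: h.
have {}Z0 : {ae mu, forall t, t \in `]0, T[ -> forall p, Z t (v p) = 0}.
  have H : forall q : nat, {ae mu, forall t, t \in `]0, T[ ->
      forall p, unpickle q = Some p -> Z t (v p) = 0}.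
    move=> q; case: (unpickle q) => [p|]; last exact: ae_in0.
    by have [Svp _ _] := Hv p; apply: (ae_in1 (Z0 _ Svp)) => t tI h p' [<-].
  apply: (ae_in1 (ae_in_all H)) => t tI h p.
  by apply: (h (pickle p)); rewrite pickleK.
apply: (ae_in3 DZ sc Z0) => t tI h1 h2 h3.
(* Let [w] almost attain the norm of [s n t]. Since [Z t w = 0], the number [s n t w] equals
   [(s n t - Z t) w]; hence [s n t], and with it [Z t], is controlled by the approximation error
   alone. *)
have main n : Nd (Z t) <= 2 * Nd (s n t - Z t).
  have [Dval /(_ t)[i sE]] := Hval n.
  have Ds : D (s n t) by rewrite sE.
  have DsZ := spB (sn_sub sD) Ds h1.
  apply/ler_addgt0Pr => eps eps0.
  have [m mP] := @ltr_add_invr R 0 eps eps0.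
  have [Sv Nv le] := Hv (Tagged (fun n => 'I_(X n)) i, m).
  have := h3 (Tagged (fun n => 'I_(X n)) i, m).
  move: Sv Nv le; rewrite /= -sE; set w := v _ => Sv Nv le Zw.
  have : Nd (Z t) <= Nd (s n t) + Nd (s n t - Z t).
    by rewrite {1}(_ : Z t = s n t - (s n t - Z t)) ?(snB sD)//; rewrite opprB addrC subrK.
  have : s n t w <= Nd (s n t - Z t).
    have -> : s n t w = (s n t - Z t) w.
      by change (s n t w = s n t w - Z t w); rewrite Zw subr0.
    rewrite (le_trans (ler_norm _))// (le_trans (dn_ub dN DsZ Sv))//.
    by rewrite ler_piMr// (dn_ge0 dN).
  rewrite add0r in mP => swle Zle.
  rewrite (le_trans Zle)// [2 * _]mulrDl mul1r [leRHS]addrAC lerD2r.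
  by rewrite (le_trans le)// lerD// ltW.
apply/eqP; rewrite eq_le (dn_ge0 dN)// andbT.
have c2 : (2 * Nd (s n t - Z t)) @[n --> \oo] --> (0 : R).
  by rewrite -[0 in X in _ --> X](mulr0 2); apply: cvgMr.
rewrite -(cvg_lim _ c2)//; apply: limr_ge; last exact: nearW.
by apply/cvg_ex; exists 0.
Qed.

End duality.
End strong_measurability.

(** * Bochner spaces *)

Lemma aeRint_dct d (X : measurableType d) (R : realType)
    (mu : {measure set X -> \bar R}) (D : set X) (F : nat -> X -> R) (f k : X -> R) :
  measurable D -> (forall n, aemeas mu D (F n)) -> aeint mu D k ->
  (forall n, {ae mu, forall x, D x -> `|F n x| <= k x}) ->
  {ae mu, forall x, D x -> F n x @[n --> \oo] --> f x} ->
  \int[mu]_(x in D) F n x @[n --> \oo] --> \int[mu]_(x in D) f x.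
Proof.
move=> mD mF [k' ik kk'] Fk Ff.
have [f' mf ff'] := aemeas_cvg mF Ff.
have /choice[G HG] : forall n, exists g,
    measurable_fun D g /\ ae_eq mu D (F n) g.
  by move=> n; have [g ? ?] := mF n; exists g.
have FG : {ae mu, forall x, D x -> forall n, F n x = G n x}.
  by apply: ae_in_all => n; exact: (HG n).2.
have [] := @dominated_convergence _ _ _ mu D mD (fun n => EFin \o G n) (EFin \o f')
  (EFin \o k').
- by move=> n; apply/measurable_EFinP; exact: (HG n).1.
- exact/measurable_EFinP.
- apply: (ae_in3 Ff ff' FG) => x Dx h1 h2 h3 /=.
  apply: cvg_EFin; first exact: nearW.
  by rewrite -h2; under eq_fun do rewrite /= -h3.
- exact: ik.
- apply: filterS (ae_in3 kk' (ae_in_all Fk) FG (fun x _ a b c => conj a (conj b c))).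
  move=> x h n Dx; have [h1 [h2 h3]] := h Dx.
  by rewrite /= lee_fin -h1 -h3.
move=> if' _ c.
rewrite (ae_eq_Rintegral ff').
rewrite (_ : (fun n => _) = fine \o (fun n => (\int[mu]_(x in D) (G n x)%:E)%E)); last first.
  apply/funext => n; exact: (ae_eq_Rintegral (HG n).2).
apply: fine_cvg; rewrite /Rintegral fineK//.
exact: integrable_fin_num.
Qed.

(** * Truncation to the unit interval *)

Section clip.
Variable R : realType.
Implicit Types x y : R.

(** The truncation min(max(x, 0), 1), written with absolute values so that its continuity is
    immediate. *)
Definition clip01 x := (`|x| - `|x - 1| + 1) / 2.

Lemma clip01_id x : 0 <= x <= 1 -> clip01 x = x.
Proof.
by move=> /andP[x0 x1]; rewrite /clip01 ger0_norm// ler0_norm ?subr_le0//; field.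
Qed.

Lemma clip01_0 x : x <= 0 -> clip01 x = 0.
Proof.
move=> x0; rewrite /clip01 ler0_norm// ler0_norm ?subr_le0//; last by lra.
by field.
Qed.

Lemma clip01_1 x : 1 <= x -> clip01 x = 1.
Proof.
move=> x1; rewrite /clip01 ger0_norm ?(le_trans _ x1)// ger0_norm ?subr_ge0//.
by field.
Qed.

Lemma clip01_bound x : 0 <= clip01 x <= 1.
Proof.
have [x0|/ltW x0] := leP x 0; first by rewrite clip01_0// lexx ler01.
have [x1|/ltW x1] := leP x 1; first by rewrite clip01_id ?x0.
by rewrite clip01_1// ler01 lexx.
Qed.

Lemma clip01_lip x y : `|clip01 x - clip01 y| <= `|x - y|.
Proof.
wlog xy : x y / x <= y.
  move=> H; have [/H//|/ltW/H] := leP x y.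
  by rewrite distrC [in leRHS]distrC.
rewrite distrC [leRHS]distrC (ger0_norm (_ : 0 <= y - x)) ?subr_ge0// ler_norml.
have [x0|/ltW x0] := leP x 0; have [y0|/ltW y0] := leP y 0;
have [x1|/ltW x1] := leP x 1; have [y1|/ltW y1] := leP y 1;
rewrite ?(clip01_0 x0) ?(clip01_0 y0) ?(clip01_1 x1) ?(clip01_1 y1)
  ?(@clip01_id x) ?(@clip01_id y) ?x0 ?y0//; apply/andP; split; lra.
Qed.

Lemma clip01_continuous : continuous clip01.
Proof.
move=> x; apply: cvgMl; apply: cvgD; last exact: cvg_cst.
by apply: cvgB; [exact: norm_continuous|
  apply: cvg_norm; apply: cvgB; [exact: cvg_id|exact: cvg_cst]].
Qed.

End clip.

(** * Square integrable vector-valued functions and their approximation *)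

Section bochner_L2.
Variables (R : realType) (T : R).
Local Notation mu := (@lebesgue_measure R).
Local Notation I := (`]0, T[%classic : set (measurableTypeR R)).
Local Notation mI := (mI T).

Lemma itv_lty : (mu I < +oo)%E.
Proof. by rewrite lebesgue_measure_itv/=; case: ifP => _; rewrite ltry. Qed.

Lemma aeint_cst c : aeint mu I (fun=> c).
Proof.
exists (fun=> c); last exact: ae_eq_refl.
apply: measurable_bounded_integrable; [exact: mI|exact: itv_lty|exact: measurable_cst|].
by exists `|c|; split => // x xc t _ /=; exact: ltW.
Qed.

(** Integrable functions have continuous L^1 approximations. Clipping one of them to [0, 1] does not
    increase the error, because [clip01] is 1-Lipschitz and fixes the values 0 and 1 of the
    indicator. *)
Lemma indic_continuous_approx (A : set (measurableTypeR R)) eps :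
  measurable A -> 0 < eps ->
  exists al : R -> R, [/\ continuous al, forall t, 0 <= al t <= 1 &
    \int[mu]_(t in I) `|\1_A t - al t| <= eps].
Proof.
move=> mA eps0.
have i1 : mu.-integrable I (EFin \o (\1_A : R -> R)).
  apply: measurable_bounded_integrable; [exact: mI|exact: itv_lty| |].
    exact: measurable_indic.
  exists 1; split => // x x1 t _ /=; rewrite indicE (le_trans _ (ltW x1))//.
  by case: (_ \in _); rewrite ?normr0 ?normr1.
have [g [cg ig gA]] := approximation_continuous_integrable mI itv_lty i1.
have /fine_cvgP[[n1 _ fg] /cvgrPdist_le/(_ _ eps0)[n2 _ cn]] := gA.
pose n := maxn n1 n2.
exists (@clip01 R \o g n); split.
- by move=> t; apply: continuous_comp; [exact: cg|exact: clip01_continuous].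
- by move=> t; exact: clip01_bound.
have cI t : clip01 (\1_A t) = \1_A t :> R.
  by rewrite clip01_id// indicE; case: (_ \in _); rewrite /= ?ler01 ?lexx.
have := cn n (leq_maxr _ _); rewrite /= sub0r normrN => h.
apply: le_trans (le_trans (ler_norm _) h).
have id : aeint mu I (fun t => `|\1_A t - g n t|).
  have := integrable_norm (integrableB mI i1 (ig n)).
  exact: integrable_aeint.
apply: (aeRint_le mI _ id).
  apply: (aeint_le mI _ id).
    apply: measurable_aemeas; apply: measurable_funTS; apply: measurableT_comp => //.
    apply: measurable_funB; first exact: measurable_indic.
    apply: continuous_measurable_fun => t.
    by apply: continuous_comp; [exact: cg|exact: clip01_continuous].
  by apply: ae_in0 => t _; rewrite normr_id -{1}cI clip01_lip.
by apply: ae_in0 => t _; rewrite -{1}cI clip01_lip.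
Qed.

Section one_space.
Variables (E : lmodType R) (S : set E) (N : E -> R).
Hypothesis sN : seminorm_on S N.
Let sS := sn_sub sN.
Local Notation bL2 := (bochnerL2 S N T).
Implicit Types phi psi : R -> E.

Lemma bL2_sqint phi : bL2 phi -> sqint mu I (fun t => N (phi t)).
Proof.
move=> [Sp mp fin]; have mN := aemeas_norm sN Sp mp; split => //.
apply: aeintP => //; first exact: aemeasX.
by apply: aeW => t _; exact: sqr_ge0.
Qed.

Lemma bL2_intro phi (k : R -> R) :
  {ae mu, forall t, t \in `]0, T[ -> S (phi t)} ->
  strongly_measurable S N T phi -> aeint mu I (fun t => k t ^+ 2) ->
  {ae mu, forall t, t \in `]0, T[ -> N (phi t) <= k t} -> bL2 phi.
Proof.
move=> Sp mp ik le; split => //.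
apply: (aeint_lty mI); apply: (aeint_le mI _ ik).
  by apply: aemeasX; exact: aemeas_norm mp.
apply: (ae_in2 Sp le) => t tI St h; have N0 := sn_ge0 sN St.
by rewrite ger0_norm ?sqr_ge0// ler_pXn2r// nnegrE ?(le_trans N0).
Qed.

Lemma bL2_eq phi psi : {ae mu, forall t, t \in `]0, T[ -> phi t = psi t} ->
  bL2 psi -> bL2 phi.
Proof.
move=> e hp; have [Sp mp fin] := hp; apply: (bL2_intro (k := fun t => N (psi t))).
- by apply: (ae_in2 e Sp) => t tI ->.
- exact: smeas_eq mp.
- exact: (bL2_sqint hp).2.
- by apply: (ae_in1 e) => t tI ->.
Qed.

Lemma bL2D phi psi : bL2 phi -> bL2 psi -> bL2 (fun t => phi t + psi t).
Proof.
move=> hp hq; have [Sp mp _] := hp; have [Sq mq _] := hq.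
apply: (bL2_intro (k := (fun t => N (phi t)) \+ (fun t => N (psi t)))).
- by apply: (ae_in2 Sp Sq) => t tI; exact: spD.
- exact: smeasD.
- exact: (spD (sqint_subspace mu mI) (bL2_sqint hp) (bL2_sqint hq)).2.
- by apply: (ae_in2 Sp Sq) => t tI; exact: (sn_D sN).
Qed.

Lemma bL2_cst v : S v -> bL2 (fun=> v).
Proof.
move=> Sv; apply: (bL2_intro (k := fun=> N v)).
- exact: ae_in0.
- exact: smeas_cst.
- exact: aeint_cst.
- exact: ae_in0.
Qed.

Lemma bL2_scale (al : R -> R) v : S v ->
  measurable_fun setT (al : measurableTypeR R -> measurableTypeR R) ->
  (forall t, 0 <= al t <= 1) -> bL2 (fun t => al t *: v).
Proof.
move=> Sv mal al01; apply: (bL2_intro (k := fun=> N v)).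
- by apply: ae_in0 => t _; exact: spZ.
- exact: smeas_scale.
- exact: aeint_cst.
- apply: ae_in0 => t _; have /andP[h1 h2] := al01 t.
  by rewrite (sn_Z sN)// ger0_norm// ler_piMl// (sn_ge0 sN).
Qed.

End one_space.

Lemma bL2_comp (E E' : lmodType R) (S : set E) (N : E -> R) (S' : set E')
    (N' : E' -> R) (op : E -> E') (C : R) (phi : R -> E) :
  seminorm_on S N -> seminorm_on S' N' ->
  (forall v, S v -> S' (op v)) -> (forall v, S v -> N' (op v) <= C * N v) ->
  (forall v w, S v -> S w -> N' (op v - op w) <= C * N (v - w)) ->
  bochnerL2 S N T phi -> bochnerL2 S' N' T (fun t => op (phi t)).
Proof.
move=> sN sN' oS o1 oC hp; have [Sp mp _] := hp.
apply: (bL2_intro sN' (k := fun t => C * N (phi t))).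
- by apply: (ae_in1 Sp) => t _; exact: oS.
- exact: smeas_comp oC Sp mp.
- apply: aeint_eq (aeintZ mI (C ^+ 2) (bL2_sqint sN hp).2).
  by apply: ae_in0 => t _; rewrite exprMn.
- by apply: (ae_in1 Sp) => t _; exact: o1.
Qed.

Section one_space.
Variables (E : lmodType R) (S : set E) (N : E -> R).
Hypothesis sN : seminorm_on S N.
Let sS := sn_sub sN.
Local Notation bL2 := (bochnerL2 S N T).
Implicit Types phi psi chi : R -> E.

Lemma bL2Z a phi : bL2 phi -> bL2 (fun t => a *: phi t).
Proof.
apply: (bL2_comp (C := `|a|) sN sN) => [v Sv|v Sv|v w Sv Sw].
- exact: spZ.
- by rewrite (sn_Z sN).
- by rewrite -scalerBr (sn_Z sN)//; exact: spB.
Qed.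

Lemma bL2N phi : bL2 phi -> bL2 (fun t => - phi t).
Proof.
move=> /(bL2Z (-1)); apply: bL2_eq => //.
by apply: ae_in0 => t _; rewrite scaleN1r.
Qed.

Lemma bL2B phi psi : bL2 phi -> bL2 psi -> bL2 (fun t => phi t - psi t).
Proof. by move=> hp hq; apply: bL2D => //; exact: bL2N. Qed.

Lemma bL2_sum (J : Type) (r : seq J) (F : J -> R -> E) :
  (forall j, bL2 (F j)) -> bL2 (fun t => \sum_(j <- r) F j t).
Proof.
move=> hF; elim: r => [|j r IH].
  apply: (bL2_eq sN (psi := fun=> 0)); last by apply: bL2_cst => //; exact: sp0.
  by apply: ae_in0 => t _; rewrite big_nil.
apply: (bL2_eq sN _ (bL2D sN (hF j) IH)).
by apply: ae_in0 => t _; rewrite big_cons.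
Qed.

Lemma bL2_normE phi : bochnerL2_norm N T phi =
  form_norm (L2form mu I) (fun t => N (phi t)).
Proof. by []. Qed.

Lemma bL2_minkowski phi psi chi : bL2 phi -> bL2 psi -> bL2 chi ->
  {ae mu, forall t, t \in `]0, T[ -> N (chi t) <= N (phi t) + N (psi t)} ->
  bochnerL2_norm N T chi <= bochnerL2_norm N T phi + bochnerL2_norm N T psi.
Proof.
move=> hp hq hc le; rewrite !bL2_normE.
have pB := L2form_psd mu mI.
apply: le_trans (sn_D (psd_seminorm pB) (bL2_sqint sN hp) (bL2_sqint sN hq)).
rewrite ler_wsqrtr//; have sc := bL2_sqint sN hc.
have sD := spD (psd_sub pB) (bL2_sqint sN hp) (bL2_sqint sN hq).
apply: (aeRint_le mI (sqint_mul mI sc sc) (sqint_mul mI sD sD)).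
have [Sc _ _] := hc.
apply: (ae_in2 Sc le) => t tI St h; rewrite -!expr2.
by rewrite ler_pXn2r// nnegrE ?(sn_ge0 sN)// (le_trans _ h)// (sn_ge0 sN).
Qed.

(** The approximants [s n] converge almost everywhere but need not be dominated. The values with
    [N (s n t) > 2 * N (phi t)] are replaced by 0, so that the error stays below [3 * N (phi t)] and
    dominated convergence applies. *)
Lemma bL2_simple_approx phi eps : bL2 phi -> 0 < eps ->
  exists (k : nat) (A : 'I_k -> set (measurableTypeR R)) (val : 'I_k -> E),
    [/\ forall i, S (val i), forall i, measurable (A i) &
      \int[mu]_(t in I) (N (phi t - \sum_(i < k) \1_(A i) t *: val i)) ^+ 2 <= eps].
Proof.
move=> hp eps0; have [Sp mp _] := hp; have [s [ss sc]] := mp.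
have [g mg Ng] := aemeas_norm sN Sp mp.
have /choice[X HX] : forall n, exists k : nat, exists val : 'I_k -> E,
    exists2 idx : R -> 'I_k, (forall i, S (val i)) /\
      (forall i, measurable (idx @^-1` [set i] : set (measurableTypeR R))) &
      forall t, s n t = val (idx t).
  by move=> n; have [k [val [idx [? ? ?]]]] := ss n; exists k, val, idx.
pose val n := projT1 (cid (HX n)).
have H' n : exists2 idx : R -> 'I_(X n), (forall i, S (val n i)) /\
      (forall i, measurable (idx @^-1` [set i] : set (measurableTypeR R))) &
      forall t, s n t = val n (idx t) by exact: projT2 (cid (HX n)).
pose idx n := projT1 (cid2 (H' n)).
have Sval n : forall i, S (val n i) by case: (projT2 (cid2 (H' n))) => -[].
have midx n i : measurable (idx n @^-1` [set i] : set (measurableTypeR R)).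
  by rewrite /idx; case: (cid2 (H' n)) => /= ? [].
have sE n t : s n t = val n (idx n t).
  by rewrite /idx; case: (cid2 (H' n)) => /= ? [].
(* The comparison uses the measurable version [g] of [N (phi t)], so that the sets are
   measurable. *)
pose A n i := idx n @^-1` [set i] `&` (I `&` g @^-1` `[N (val n i) / 2, +oo[%classic).
have mA n i : measurable (A n i : set (measurableTypeR R)).
  apply: measurableI; first exact: midx.
  by apply: mg; [exact: mI|exact: measurable_itv].
pose r n t := \sum_(i < X n) \1_(A n i) t *: val n i.
have rE n t : t \in `]0, T[ ->
    r n t = if N (s n t) <= 2 * g t then s n t else 0.
  move=> tI; rewrite /r (bigD1 (idx n t))//= big1 ?addr0; last first.
    move=> i /eqP ni; rewrite indicE memNset ?scale0r// => -[/= h _].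
    by apply: ni.
  rewrite -sE indicE; case: ifPn => h.
    rewrite mem_set ?scale1r//; split => //; split => //=.
    by rewrite in_itv/= andbT -sE ler_pdivrMr// mulrC.
  rewrite memNset ?scale0r// => -[_ [_ /=]]; rewrite in_itv/= andbT -sE.
  by rewrite ler_pdivrMr// mulrC; exact/negP.
have hr n : bL2 (r n).
  apply: bL2_sum => i; apply: bL2_scale => // t.
  by rewrite indicE; case: (_ \in _); rewrite /= ?ler01 ?lexx.
have Sr n t : S (r n t) by apply: sp_sum => // i _; exact: spZ.
have hd n : bL2 (fun t => phi t - r n t) by exact: bL2B.
have ig : aeint mu I (fun t => 9 * N (phi t) ^+ 2).
  by apply: (aeintZ mI); exact: (bL2_sqint sN hp).2.
have : (\int[mu]_(t in I) (N (phi t - r n t)) ^+ 2) @[n --> \oo] -->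
    \int[mu]_(t in I) (fun=> 0 : R) t.
  apply: (aeRint_dct mI _ ig).
  - by move=> n; exact: aeint_aemeas (bL2_sqint sN (hd n)).2.
  - move=> n; apply: (ae_in2 Sp Ng) => t tI St gt.
    rewrite ger0_norm ?sqr_ge0// (_ : 9 * _ = (3 * N (phi t)) ^+ 2); last by ring.
    rewrite ler_pXn2r ?nnegrE ?mulr_ge0 ?(sn_ge0 sN)//; last exact: spB.
    rewrite (le_trans (snB sN St (Sr n t)))// rE//.
    case: ifPn => [|_]; last by rewrite (sn0 sN) addr0; have := sn_ge0 sN St; lra.
    by rewrite -gt; lra.
  - apply: (ae_in3 Sp Ng sc) => t tI St gt cs.
    apply: (cvg0_le (v := fun n => N (s n t - phi t) * N (s n t - phi t))).
      move=> n; have Ss := simple_fun_S t (ss n).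
      rewrite ger0_norm ?sqr_ge0// -expr2 ler_pXn2r ?nnegrE ?(sn_ge0 sN)//; try exact: spB.
      rewrite rE//; case: ifPn => [_|]; first by rewrite (snC sN).
      (* Where the value was discarded the error is [N (phi t)], and [N (s n t) > 2 * N (phi t)]
         forces it below [N (s n t - phi t)]: convergence is not lost. *)
      rewrite -ltNge subr0 -gt => h.
      by have := snB sN (spB sS Ss St) (spN sS St); rewrite opprK subrK (snN sN St); lra.
    by rewrite -[0 in X in _ --> X](mul0r 0); exact: cvgM.
rewrite Rintegral_cst ?mul0r; last exact: mI.
move=> /cvgrPdist_le /(_ _ eps0) [n _ /(_ n (leqnn n))] /=.
rewrite sub0r normrN => h; exists (X n), (A n), (val n); split => //.
exact: le_trans (ler_norm _) h.
Qed.

(** The indicators of a simple approximant are replaced by continuous functions. The change is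
    bounded pointwise by [M], the sum of the norms of the values, so its square is at most [M] times
    a combination of the scalar errors: smallness in L^1 of these is enough. *)
Lemma bL2_continuous_approx phi eps : bL2 phi -> 0 < eps ->
  exists (k : nat) (al : 'I_k -> R -> R) (val : 'I_k -> E),
    [/\ forall i, S (val i), forall i, continuous (al i),
      forall i t, 0 <= al i t <= 1 &
      \int[mu]_(t in I) (N (phi t - \sum_(i < k) al i t *: val i)) ^+ 2 <= eps].
Proof.
move=> hp eps0.
have e4 : 0 < eps / 4 by lra.
have [k [A [val [Sval mA le]]]] := bL2_simple_approx hp e4.
pose M := \sum_(i < k) N (val i).
have M0 : 0 <= M by apply: sumr_ge0 => i _; exact: (sn_ge0 sN).
(* From (x + y)^2 <= 2 x^2 + 2 y^2, the simple approximation costs 2 eps/4, and the scalar errors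
   cost 2 M^2 times this number, at most eps/2. The 1 in the denominator covers [M = 0]. *)
have d0 : 0 < eps / (4 * (M ^+ 2 + 1)).
  by rewrite divr_gt0// mulr_gt0// ltr_wpDl// sqr_ge0.
have /choice[al Hal] := fun i => indic_continuous_approx (mA i) d0.
exists k, al, val; split => // [i|i t|]; try by have [] := Hal i.
pose r t := \sum_(i < k) \1_(A i) t *: val i.
pose z t := \sum_(i < k) al i t *: val i.
have hr : bL2 r.
  apply: bL2_sum => i; apply: bL2_scale => // t.
  by rewrite indicE; case: (_ \in _); rewrite /= ?ler01 ?lexx.
have hz : bL2 z.
  apply: bL2_sum => i; have [ca al01 _] := Hal i; apply: bL2_scale => //.
  exact: continuous_measurable_fun.
have ip := bL2_sqint sN (bL2B hp hr).
have idl i : aeint mu I (fun t => `|\1_(A i) t - al i t|).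
  apply: integrable_aeint; apply: measurable_bounded_integrable.
  - exact: mI.
  - exact: itv_lty.
  - apply: measurable_funTS; apply: measurableT_comp => //.
    apply: measurable_funB => //; have [ca _ _] := Hal i.
    exact: continuous_measurable_fun.
  - exists 1; split => // x x1 t _ /=; rewrite normr_id (le_trans _ (ltW x1))//.
    have [_ /(_ t) /andP[h1 h2] _] := Hal i.
    by rewrite indicE ler_norml; case: (_ \in _) => /=; apply/andP; split; lra.
have isum : aeint mu I (fun t => \sum_(i < k) N (val i) * `|\1_(A i) t - al i t|).
  by apply: (aeint_sum mI) => i; exact: (aeintZ mI).
have ib := aeintD mI (aeintZ mI 2 ip.2) (aeintZ mI (2 * M) isum).
apply: le_trans (aeRint_le mI (bL2_sqint sN (bL2B hp hz)).2 ib _) _.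
  have [Sp _ _] := hp; apply: (ae_in1 Sp) => t tI St.
  have Sr : S (r t) by apply: sp_sum => // i _; exact: spZ.
  have Sz : S (z t) by apply: sp_sum => // i _; exact: spZ.
  have tri := sn_tri sN St Sr Sz.
  have rz : N (r t - z t) <= \sum_(i < k) N (val i) * `|\1_(A i) t - al i t|.
    rewrite /r /z -sumrB (eq_bigr (fun i => (\1_(A i) t - al i t) *: val i)); last first.
      by move=> i _; rewrite scalerBl.
    apply: le_trans (sn_sum sN _ _) _ => [i|]; first exact: spZ.
    by apply: ler_sum => i _; rewrite (sn_Z sN)// mulrC.
  have rM : N (r t - z t) <= M.
    apply: le_trans rz _; apply: ler_sum => i _; rewrite ler_piMr ?(sn_ge0 sN)//.
    have [_ /(_ t) /andP[h1 h2] _] := Hal i.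
    by rewrite indicE ler_norml; case: (_ \in _) => /=; apply/andP; split; lra.
  have p0 := sn_ge0 sN (spB sS St Sr); have q0 := sn_ge0 sN (spB sS Sr Sz).
  apply: (@le_trans _ _ ((N (phi t - r t) + N (r t - z t)) ^+ 2)).
    by rewrite ler_pXn2r// nnegrE ?addr_ge0// (sn_ge0 sN)//; exact: spB.
  have := sqr_ge0 (N (phi t - r t) - N (r t - z t)); rewrite sqrrB sqrrD => h.
  have : N (r t - z t) ^+ 2 <=
      M * \sum_(i < k) N (val i) * `|\1_(A i) t - al i t|.
    by rewrite expr2 ler_pM.
  move: h; rewrite !mulr2n; set P := _ ^+ 2; set Q := _ ^+ 2; lra.
rewrite (aeRintD mI (aeintZ mI 2 ip.2) (aeintZ mI (2 * M) isum)).
rewrite (aeRintZ mI 2 ip.2) (aeRintZ mI (2 * M) isum) (aeRint_sum mI); last first.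
  by move=> i; exact: (aeintZ mI).
have : \sum_(i < k) \int[mu]_(t in I) (N (val i) * `|\1_(A i) t - al i t|) <=
    M * (eps / (4 * (M ^+ 2 + 1))).
  rewrite mulr_suml; apply: ler_sum => i _; rewrite (aeRintZ mI _ (idl i)).
  by rewrite ler_wpM2l ?(sn_ge0 sN)//; have [] := Hal i.
have -> : M * (eps / (4 * (M ^+ 2 + 1))) = (M / (M ^+ 2 + 1)) * (eps / 4).
  by field; rewrite gt_eqF// ltr_wpDl// sqr_ge0.
move=> h.
have h2 : M * (M / (M ^+ 2 + 1) * (eps / 4)) <= eps / 4.
  rewrite mulrA ler_piMl ?(ltW e4)// mulrA -expr2 ler_pdivrMr ?mul1r ?lerDl//.
  by rewrite ltr_wpDl// sqr_ge0.
have := ler_wpM2l M0 h; move: le; rewrite -/(r _).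
rewrite -[2 * M * _]mulrA; lra.
Qed.

End one_space.
End bochner_L2.

(** * A smooth step *)

Section smooth_functions.
Variable R : realType.
Implicit Types (f g : R -> R) (n : nat) (x : R).

Lemma is_derive_congr f x a b : is_derive (x : R^o) 1 f a -> a = b ->
  is_derive (x : R^o) 1 f b.
Proof. by move=> d <-. Qed.

(** The derivative is taken on the inside, unlike in [derive1n], so that the closure properties
    below follow by induction on [n] with the function generalized. *)
Fixpoint derivs n f : Prop :=
  if n is n'.+1 then (forall t : R, derivable f t 1) /\ derivs n' (derive1 f) else True.

Lemma derivsP f :
  (forall n, derivs n f) <-> forall n (t : R), derivable (derive1n n f) t 1.
Proof.
have S n g : derive1n n.+1 g = derive1n n (derive1 g) by rewrite /derive1n iterSr.
split=> H n.
  elim: n f {H}(H n.+1) => [|n IH] f [d ds]; first exact: d.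
  by rewrite S; exact: IH.
elim: n f H => [//|n IH] f H; split; first exact: (H 0%N).
by apply: IH => m t; rewrite -S.
Qed.

Lemma derivsW n f : derivs n.+1 f -> derivs n f.
Proof. by elim: n f => [//|n IH] f [d ds]; split => //; exact: IH. Qed.

Lemma is_derive_derivs n f g : (forall t : R, is_derive (t : R^o) 1 f (g t)) ->
  derivs n g -> derivs n.+1 f.
Proof.
move=> fg dg; split => [t|]; first exact: ex_derive.
by rewrite (_ : (derive1 f) = g)//; apply/funext => t; rewrite derive1E derive_val.
Qed.

Lemma derivs_is_derive n f (t : R) : derivs n.+1 f -> is_derive (t : R^o) 1 f ((derive1 f) t).
Proof. by move=> [d _]; rewrite derive1E; apply: DeriveDef. Qed.

Lemma derivs_cst n (c : R) : derivs n (fun=> c).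
Proof.
by elim: n c => [//|n IH] c; exact: (is_derive_derivs _ (IH 0)).
Qed.

Lemma derivsD n f g : derivs n f -> derivs n g -> derivs n (fun t => f t + g t).
Proof.
elim: n f g => [//|n IH] f g df dg.
apply: (is_derive_derivs (g := fun t => (derive1 f) t + (derive1 g) t)).
  by move=> t; exact: (is_deriveD (derivs_is_derive t df) (derivs_is_derive t dg)).
exact: (IH _ _ df.2 dg.2).
Qed.

Lemma derivsM n f g : derivs n f -> derivs n g -> derivs n (fun t => f t * g t).
Proof.
elim: n f g => [//|n IH] f g df dg.
apply: (is_derive_derivs (g := fun t => f t * (derive1 g) t + g t * (derive1 f) t)).
  by move=> t; exact: (is_deriveM (derivs_is_derive t df) (derivs_is_derive t dg)).
apply: derivsD; first exact: (IH _ _ (derivsW df) dg.2).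
exact: (IH _ _ (derivsW dg) df.2).
Qed.

(** The derivative of 1/f is a product containing 1/f itself. The induction therefore keeps [f]
    fixed and uses the same statement one order lower. *)
Lemma derivsV n f : (forall t, f t != 0) -> derivs n f -> derivs n (fun t => (f t)^-1).
Proof.
move=> f0; elim: n => [//|n IH] df.
have dV := IH (derivsW df).
apply: (is_derive_derivs (g := fun t => -1 * (f t)^-1 * (f t)^-1 * (derive1 f) t)).
  move=> t; have fd := derivs_is_derive t df.
  apply: (is_derive_congr (is_deriveV (f0 t) fd)).
  by rewrite /GRing.scale/= -exprVn; ring.
apply: derivsM df.2.
by apply: derivsM => //; apply: derivsM => //; exact: derivs_cst.
Qed.

Lemma derivs_affine n f a b : derivs n f -> derivs n (fun t => f (a * t + b)).
Proof.
elim: n f => [//|n IH] f df.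
apply: (is_derive_derivs (g := fun t => a * (derive1 f) (a * t + b))).
  move=> t; have d1 : is_derive (t : R^o) 1 (fun t => a * t + b) a.
    apply: (is_derive_congr (is_deriveD (is_deriveZ a (is_derive_id (t : R^o) 1))
      (is_derive_cst b (t : R^o) 1))).
    by rewrite /GRing.scale/= mulr1 addr0.
  have := @is_derive1_comp _ f (fun t => a * t + b) t _ _ (derivs_is_derive _ df) d1.
  by rewrite mulrC.
apply: derivsM; [exact: derivs_cst|exact: (IH _ df.2)].
Qed.

(* The flat function [exp (- 1 / x)] times a power of [1 / x]; its derivatives
   are combinations of functions of the same family. *)
Definition flat k (x : R) := if 0 < x then x^-1 ^+ k * expR (- x^-1) else 0.

Lemma flat_le0 k x : x <= 0 -> flat k x = 0.
Proof. by rewrite /flat ltNge => ->. Qed.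

Lemma flat_gt0 k x : 0 < x -> flat k x = x^-1 ^+ k * expR (- x^-1).
Proof. by rewrite /flat => ->. Qed.

Lemma flat_ge0 k x : 0 <= flat k x.
Proof.
rewrite /flat; case: ifP => // x0.
by rewrite mulr_ge0 ?expR_ge0// exprn_ge0// invr_ge0 ltW.
Qed.

(** With y = 1/x, the inequality exp(y) >= (1 + y/(k+1))^(k+1) >= (y/(k+1))^(k+1) gives y^k exp(-y)
    <= (k+1)^(k+1) / y. *)
Lemma flat_le k x : flat k x <= (k.+1%:R ^+ k.+1) * `|x|.
Proof.
rewrite /flat; case: ifPn => [x0|_]; last by rewrite mulr_ge0 ?exprn_ge0.
have y0 : 0 < x^-1 by rewrite invr_gt0.
have k0 : (0 : R) < k.+1%:R by rewrite ltr0n.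
have h : (x^-1 / k.+1%:R) ^+ k.+1 <= expR x^-1.
  rewrite -[X in expR X](divfK (lt0r_neq0 k0)) expRM_natr.
  have z0 : 0 <= x^-1 / k.+1%:R by rewrite divr_ge0// ltW.
  rewrite ler_pXn2r ?nnegrE ?expR_ge0//.
  by rewrite (le_trans _ (expR_ge1Dx _))// lerDr.
rewrite expRN ger0_norm ?(ltW x0)// ler_pdivrMr ?expR_gt0//.
rewrite -ler_pdivrMl ?mulr_gt0 ?exprn_gt0//.
apply: le_trans h; rewrite expr_div_n [x^-1 ^+ k.+1]exprS.
have : k.+1%:R ^+ k.+1 != 0 :> R by rewrite expf_neq0// lt0r_neq0.
move: (_ ^+ k.+1) (_ ^+ k) => K Y K0.
by rewrite le_eqVlt; apply/orP; left; apply/eqP; field; rewrite K0 gt_eqF.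
Qed.

Lemma is_derive_flat k x :
  is_derive (x : R^o) 1 (flat k) (flat k.+2 x + (- k%:R) * flat k.+1 x).
Proof.
have [x0|x0|->] := ltgtP x 0.
- rewrite !(flat_le0 _ (ltW x0)) mulr0 addr0.
  apply: (@near_eq_is_derive _ _ _ (cst 0)).
  near=> y; rewrite flat_le0// ltW//.
  by near: y; exact: lt_nbhsl.
- rewrite !(flat_gt0 _ x0).
  pose g (y : R) := y^-1 ^+ k * expR (- y^-1).
  apply: (@near_eq_is_derive _ _ _ (g : R^o -> R^o)).
    near=> y; rewrite flat_gt0//.
    by near: y; exact: lt_nbhsr.
  have dV : is_derive (x : R^o) 1 (fun y : R => y^-1) (- x^-1 ^+ 2).
    apply: (is_derive_congr (is_deriveV (f := id) (lt0r_neq0 x0) (is_derive_id (x : R^o) 1))).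
    by rewrite /GRing.scale/= mulr1 exprVn.
  have dN : is_derive (x : R^o) 1 (fun y : R => - y^-1) (x^-1 ^+ 2).
    by apply: (is_derive_congr (is_deriveN dV)); rewrite opprK.
  have dX : is_derive (x : R^o) 1 (fun y : R => y^-1 ^+ k) (k%:R * x^-1 ^+ k.-1 * (- x^-1 ^+ 2)).
    rewrite (_ : (fun y => _) = (fun y : R^o => y^-1) ^+ k); last first.
      by apply/funext => y; rewrite exprfctE.
    apply: (is_derive_congr (is_deriveX k dV)).
    by rewrite /GRing.scale/= -mulr_natl.
  have dE := @is_derive1_comp _ expR (fun y => - y^-1) x _ _ (is_derive_expR _) dN.
  apply: (is_derive_congr (is_deriveM dX dE)).
  rewrite /GRing.scale/=; case: k {g dX} => [|k] /=.
    by rewrite !expr0 !expr2 expr1; ring.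
  by rewrite !exprS expr0; ring.
- rewrite !(flat_le0 _ (lexx 0)) mulr0 addr0.
  (* At 0 the difference quotient of [flat k] is [flat k.+1 h], which [flat_le] bounds by a multiple
     of |h|. *)
  have c : (fun h : R => h^-1 *: ((flat k \o shift 0) (h *: 1) - flat k 0)) h @[h --> 0^'] --> (0 : R).
    apply/cvgrPdist_le => e e0.
    have C0 : 0 < (k.+2%:R : R) ^+ k.+2 by rewrite exprn_gt0// ltr0n.
    near=> h; rewrite sub0r normrN /= /GRing.scale/= addr0 mulr1 (flat_le0 _ (lexx 0)) subr0.
    have h0 : h != 0 by near: h; exact: nbhs_dnbhs_neq.
    have -> : h^-1 * flat k h = flat k.+1 h.
      by rewrite /flat; case: ifPn => _; [rewrite exprS mulrA|rewrite mulr0].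
    rewrite ger0_norm ?flat_ge0// (le_trans (flat_le _ _))// -ler_pdivlMl//.
    near: h; apply: dnbhs0_le; by rewrite mulr_gt0 ?invr_gt0.
  apply: DeriveDef; first by apply/cvg_ex; exists 0.
  by rewrite /derive; apply/cvg_lim.
Unshelve. all: by end_near. Qed.

Lemma derivs_flat n k : derivs n (flat k).
Proof.
elim: n k => [//|n IH] k; apply: is_derive_derivs (is_derive_flat k) _.
by apply: derivsD => //; apply: derivsM => //; exact: derivs_cst.
Qed.

(** The classical transition from 0 to 1. Of x and 1 - x at least one is positive, so the
    denominator never vanishes; 1 - x is spelled in the form expected by [derivs_affine]. *)
Definition smooth_step (x : R) := flat 0 x / (flat 0 x + flat 0 (-1 * x + 1)).

Let den_gt0 x : 0 < flat 0 x + flat 0 (-1 * x + 1).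
Proof.
have pos y : 0 < y -> 0 < flat 0 y by rewrite /flat => ->; rewrite mul1r expR_gt0.
have [x0|x0] := ltP 0 x; first by rewrite ltr_pwDl ?pos ?flat_ge0.
by rewrite ltr_wpDl ?flat_ge0 ?pos//; lra.
Qed.

Lemma derivs_smooth_step n : derivs n smooth_step.
Proof.
apply: derivsM; first exact: derivs_flat.
apply: derivsV => [t|]; first by rewrite gt_eqF.
apply: derivsD; first exact: derivs_flat.
by apply: derivs_affine; exact: derivs_flat.
Qed.

Lemma smooth_step_bound x : 0 <= smooth_step x <= 1.
Proof.
rewrite /smooth_step divr_ge0 ?flat_ge0 ?(ltW (den_gt0 x))//=.
by rewrite ler_pdivrMr// mul1r lerDl flat_ge0.
Qed.

Lemma smooth_step0 x : x <= 0 -> smooth_step x = 0.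
Proof. by move=> x0; rewrite /smooth_step {1}/flat ltNge x0 mul0r. Qed.

Lemma smooth_step1 x : 1 <= x -> smooth_step x = 1.
Proof.
move=> x1; rewrite /smooth_step [flat 0 (_ + _)]/flat ifF; last by apply/negbTE; rewrite -leNgt; lra.
rewrite addr0 divff// gt_eqF//; have := den_gt0 x.
by rewrite [flat 0 (_ + _)]/flat ifF ?addr0//; apply/negbTE; rewrite -leNgt; lra.
Qed.

Lemma derivs_continuous f : (forall n, derivs n f) -> continuous (derive1 f).
Proof.
move=> df t; apply: differentiable_continuous; apply/derivable1_diffP.
by have [_ [d _]] := df 2%N; exact: d.
Qed.

End smooth_functions.

(** * Weak derivatives of scalar functions *)

Section ae_subdomain.
Context d (X : measurableType d) (R : realType).
Variables (mu : {measure set X -> \bar R}) (A D : set X).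
Hypotheses (mA : measurable A) (mD : measurable D) (AD : A `<=` D).
Implicit Types f : X -> R.

Lemma ae_sub (P : X -> Prop) : {ae mu, forall x, D x -> P x} ->
  {ae mu, forall x, A x -> P x}.
Proof. by apply: filterS => x h /AD. Qed.

Lemma aeintS f : aeint mu D f -> aeint mu A f.
Proof.
by move=> [g ig fg]; exists g; [exact: integrableS ig|exact: ae_sub fg].
Qed.

Lemma Rintegral_supp f : (forall x, D x -> ~ A x -> f x = 0) ->
  \int[mu]_(x in D) f x = \int[mu]_(x in A) f x.
Proof.
move=> f0; rewrite Rintegral_mkcond [RHS]Rintegral_mkcond; congr Rintegral.
apply/funext => x; rewrite !patchE; have [Ax|nAx] := pselect (A x).
  by rewrite !mem_set//; exact: AD.
rewrite [in RHS]memNset//; case: ifPn => // /set_mem Dx; exact: f0.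
Qed.

Lemma aeint_supp f : (forall x, D x -> ~ A x -> f x = 0) ->
  aeint mu A f -> aeint mu D f.
Proof.
move=> f0 [g ig fg]; exists (g \_ A).
  rewrite -restrict_EFin; apply/integrable_restrict => //=.
  by rewrite setIidr.
apply: filterS fg => x h Dx; rewrite patchE; have [Ax|nAx] := pselect (A x).
  by rewrite mem_set// h.
by rewrite memNset// f0.
Qed.

End ae_subdomain.

Section mollification.
Variables (R : realType) (T : R).
Local Notation mu := (@lebesgue_measure R).
Local Notation I := (`]0, T[%classic : set (measurableTypeR R)).
Local Notation mI := (mI T).
Local Notation B := (@smooth_step R).
Local Notation D := (derive1 B).

Lemma aeRint_itv_split (f : R -> R) (a b c : R) : a <= b -> b <= c ->
  aeint mu `]a, c]%classic f ->
  \int[mu]_(t in `]a, c]) f t = \int[mu]_(t in `]a, b]) f t + \int[mu]_(t in `]b, c]) f t.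
Proof.
move=> ab bc [g ig fg].
have sub1 : (`]a, b]%classic : set (measurableTypeR R)) `<=` `]a, c]%classic.
  by apply: subset_itvl; rewrite bnd_simp.
have sub2 : (`]b, c]%classic : set (measurableTypeR R)) `<=` `]a, c]%classic.
  by apply: subset_itvr; rewrite bnd_simp.
rewrite (ae_eq_Rintegral fg) (ae_eq_Rintegral (ae_eq_subset sub1 fg)).
rewrite (ae_eq_Rintegral (ae_eq_subset sub2 fg)).
by apply/eqP; rewrite addrC -subr_eq; apply/eqP; apply: Rintegral_itvB ig _ _; rewrite bnd_simp.
Qed.

Lemma smooth_step_cont : continuous B.
Proof.
move=> t; apply: differentiable_continuous; apply/derivable1_diffP.
by have [d _] := @derivs_smooth_step R 1%N; exact: d.
Qed.

Lemma dsmooth_step_cont : continuous D.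
Proof. by apply: derivs_continuous => n; exact: derivs_smooth_step. Qed.

Lemma dsmooth_step_out x : x < 0 \/ 1 < x -> D x = 0.
Proof.
move=> h; have [c hc] : exists c, \near x, cst c x = B x.
  case: h => x0; [exists 0|exists 1]; near=> y.
    by rewrite smooth_step0// ltW//; near: y; exact: lt_nbhsl.
  by rewrite smooth_step1// ltW//; near: y; exact: lt_nbhsr.
have [_] := @near_eq_is_derive _ _ _ (cst c : R^o -> R^o) B x 1 0 hc (is_derive_cst _ _ _).
by rewrite derive1E.
Unshelve. all: by end_near. Qed.

Lemma dsmooth_step_bounded : exists2 C, 0 < C & forall x, `|D x| <= C.
Proof.
have cD : {within `[0, 1], continuous (fun x => `|D x|)}.
  apply: continuous_subspaceT => x; apply: continuous_comp.
    exact: dsmooth_step_cont.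
  exact: norm_continuous.
have [c _ hc] := EVT_max ler01 cD.
exists (`|D c| + 1) => [|x]; first by rewrite ltr_wpDl.
have [h|h] := boolP (x \in `[0, 1]).
  by rewrite (le_trans (hc _ h))// lerDl.
rewrite dsmooth_step_out ?normr0 ?addr_ge0//.
move: h; rewrite in_itv/= negb_and -!ltNge => /orP[]; by [left|right].
Qed.

Lemma is_derive_scaled_step (m x t : R) :
  is_derive (t : R^o) 1 (fun t => B (m * t + - (m * x))) (m * D (m * t + - (m * x))).
Proof.
have d1 : is_derive (t : R^o) 1 (fun t : R => m * t + - (m * x)) m.
  apply: (is_derive_congr (is_deriveD (is_deriveZ m (is_derive_id (t : R^o) 1))
    (is_derive_cst (- (m * x)) (t : R^o) 1))).
  by rewrite /GRing.scale/= mulr1 addr0.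
have dB := derivs_is_derive (m * t + - (m * x)) (derivs_smooth_step R 1).
exact: (is_derive_congr (@is_derive1_comp _ B _ t _ _ dB d1) (mulrC _ _)).
Qed.

Lemma scaled_dstep_cont (m x : R) :
  continuous (fun t => m * D (m * t + - (m * x))).
Proof.
move=> t; apply: cvgMr; apply: (@continuous_comp _ _ _ (fun t => m * t + - (m * x)) D).
  by apply: cvgD; [apply: cvgMr; exact: cvg_id|exact: cvg_cst].
exact: dsmooth_step_cont.
Qed.

(** The kernel is bounded by m C, lives on [x, x + 1/m] and has integral 1. If [a] varies by at most
    e/C there, the error is at most (m C)(e/C)(1/m) = e. *)
Lemma mollify (a : R -> R) x e : 0 < x < T -> measurable_fun I a ->
  {for x, continuous a} -> 0 < e ->
  exists n0, forall n, (n0 <= n)%N -> let m := n.+1%:R : R in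
    aeint mu I (fun t => m * D (m * t + - (m * x)) * a t) /\
    `|\int[mu]_(t in I) (m * D (m * t + - (m * x)) * a t) - a x| <= e.
Proof.
move=> /andP[x0 xT] ma ca e0.
have [C C0 DC] := dsmooth_step_bounded.
have eC : 0 < e / C by rewrite divr_gt0.
have /cvgrPdist_le /(_ _ eC) /nbhs_ballP[r /= r0 hr] := ca.
(* The kernel lies to the right of [x], so only the distance to [T] and the radius [r] restrict
   m. *)
pose q := Num.min r (T - x).
have q0 : 0 < q by rewrite lt_min r0 subr_gt0.
have [n0 hn0] := @ltr_add_invr R 0 q q0.
exists n0 => n n0n; set m := n.+1%:R.
have m0 : 0 < m by rewrite ltr0n.
have mq : m^-1 < q.
  rewrite add0r in hn0; apply: le_lt_trans hn0.
  by rewrite lef_pV2 ?posrE ?ltr0n// ler_nat ltnS.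
have [mr mT] : m^-1 < r /\ m^-1 < T - x.
  by move: mq; rewrite lt_min => /andP.
pose J : set (measurableTypeR R) := `[x, x + m^-1]%classic.
have xmT : x + m^-1 < T by rewrite -ltrBrDl.
have JI : J `<=` I.
  move=> t; rewrite /J /= !in_itv/= => /andP[h1 h2].
  by rewrite (lt_le_trans x0 h1) (le_lt_trans h2 xmT).
have mJ : measurable J by exact: measurable_itv.
pose K t := m * D (m * t + - (m * x)).
have K0 t : ~ J t -> K t = 0.
  rewrite /K => nJ; rewrite dsmooth_step_out ?mulr0//.
  have [h|h] := ltP t x; [left|right].
    by rewrite subr_lt0 ltr_pM2l.
  rewrite -mulrBr -ltr_pdivrMl// mulr1 ltrBrDl ltNge.
  by apply/negP => h'; apply: nJ; rewrite /J /= in_itv/= h.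
have KC t : `|K t| <= m * C by rewrite normrM (gtr0_norm m0) ler_pM2l.
have xm : x < x + m^-1 by rewrite ltrDl invr_gt0.
have iK : mu.-integrable J (EFin \o K).
  apply: continuous_compact_integrable; first exact: segment_compact.
  by apply: continuous_subspaceT; exact: scaled_dstep_cont.
have b0 : B (m * x + - (m * x)) = 0 by rewrite subrr smooth_step0.
have b1 : B (m * (x + m^-1) + - (m * x)) = 1.
  by rewrite mulrDr mulfV ?gt_eqF// addrAC subrr add0r smooth_step1.
have intK : \int[mu]_(t in J) K t = 1.
  rewrite /Rintegral (@continuous_FTC2 _ K (fun t => B (m * t + - (m * x))))//=.
  - by rewrite b0 b1 subr0.
  - by apply: continuous_subspaceT; exact: scaled_dstep_cont.
  - have c : continuous (fun t => B (m * t + - (m * x))).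
      move=> t; apply: (@continuous_comp _ _ _ (fun t => m * t + - (m * x)) B).
        by apply: cvgD; [apply: cvgMr; exact: cvg_id|exact: cvg_cst].
      exact: smooth_step_cont.
    split; last 2 first.
    + by apply: cvg_at_right_filter; exact: c.
    + by apply: cvg_at_left_filter; exact: c.
    + by move=> t _; have [] := is_derive_scaled_step m x t.
  - by move=> t _; rewrite derive1E; have [_ ->] := is_derive_scaled_step m x t.
have mKa : aemeas mu J (fun t => K t * (a t - a x)).
  apply: measurable_aemeas; apply: measurable_funM.
    by apply/measurable_EFinP; exact: measurable_int iK.
  by apply: measurable_funB => //; exact: measurable_funS ma.
have JT : (mu J < +oo)%E by rewrite lebesgue_measure_itv/=; case: ifP => _; rewrite ltry.
have iE : aeint mu J (fun=> m * C * (e / C)).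
  apply: integrable_aeint; apply: measurable_bounded_integrable => //.
  by exists `|m * C * (e / C)|; split => // y yc t _ /=; exact: ltW.
have bd : {ae mu, forall t, J t -> `|K t * (a t - a x)| <= m * C * (e / C)}.
  apply: ae_in0 => t; rewrite /J /= in_itv/= => /andP[t1 t2].
  rewrite normrM ler_pM// distrC; apply: hr.
  rewrite /ball/= distrC ger0_norm ?subr_ge0// ltrBlDl.
  by rewrite (le_lt_trans t2)// ltrD2l.
have iKa := aeint_le mJ mKa iE bd.
have iKx : aeint mu J (fun t => a x * K t).
  by apply: (aeintZ mJ); exact: integrable_aeint.
have iKaJ : aeint mu J (fun t => K t * a t).
  apply: aeint_eq (aeintD mJ iKa iKx); apply: ae_in0 => t _.
  by rewrite mulrBr [a x * _]mulrC subrK.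
have supp t : I t -> ~ J t -> K t * a t = 0 by move=> _ /K0 ->; rewrite mul0r.
split; first by apply: aeint_supp supp iKaJ => //; exact: mI.
rewrite (Rintegral_supp mu JI supp).
rewrite (_ : a x = a x * \int[mu]_(t in J) K t); last by rewrite intK mulr1.
rewrite -(aeRintZ mJ _ (integrable_aeint iK)) -(aeRintB mJ iKaJ iKx).
rewrite (_ : \int[mu]_(t in J) _ = \int[mu]_(t in J) (K t * (a t - a x))); last first.
  by congr Rintegral; apply/funext => t; rewrite mulrBr [a x * _]mulrC.
apply: le_trans (aeRint_norm_le mJ mKa iE bd) _.
have fJ : fine (mu J) = m^-1.
  by rewrite /J lebesgue_measure_itv/= lte_fin xm -EFinB/= addrAC subrr add0r.
rewrite Rintegral_cst// fJ le_eqVlt; apply/orP; left; apply/eqP; field.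
by rewrite !gt_eqF.
Qed.

Let three_thirds (A1 A2 P K x y e : R) : A1 - A2 = - P ->
  `|A1 - x| <= e / 3 -> `|A2 - y| <= e / 3 -> `|K - P| <= e / 3 ->
  `|y - x - K| <= e.
Proof. by rewrite !ler_norml => eq /andP[? ?] /andP[? ?] /andP[? ?]; lra. Qed.

(* The test functions [B (m (t - s)) - B (m (t - s'))] are primitives of a
   difference of two approximate identities, concentrated at [s] and [s']. *)
Lemma weak_derivative_increment (a k : R -> R) : measurable_fun I a ->
  (forall s, 0 < s < T -> {for s, continuous a}) -> aeint mu I k ->
  (forall psi, time_test_fun T psi ->
    \int[mu]_(t in I) (derive1 psi t * a t) = - \int[mu]_(t in I) (psi t * k t)) ->
  forall s s', 0 < s -> s <= s' -> s' < T ->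
    a s' - a s = \int[mu]_(t in `]s, s']) k t.
Proof.
move=> ma ca ik H s s' s0 ss' s'T.
have sT := le_lt_trans ss' s'T; have s'0 := lt_le_trans s0 ss'.
pose psi n t := B (n.+1%:R * t + - (n.+1%:R * s)) - B (n.+1%:R * t + - (n.+1%:R * s')).
have dpsi n t : is_derive (t : R^o) 1 (psi n)
    (n.+1%:R * D (n.+1%:R * t + - (n.+1%:R * s)) - n.+1%:R * D (n.+1%:R * t + - (n.+1%:R * s'))).
  exact: (is_deriveB (is_derive_scaled_step _ _ _) (is_derive_scaled_step _ _ _)).
have cpsi : (\int[mu]_(t in I) (psi n t * k t)) @[n --> \oo] -->
    \int[mu]_(t in I) (\1_(`]s, s']%classic) t * k t).
  have ink := aeint_aemeas ik.
  have ik' : aeint mu I (fun t => `|k t|).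
    have [k' ik' kk'] := ik; exists (fun t => `|k' t|); first exact: integrable_norm ik'.
    by apply: (ae_in1 kk') => t _ ->.
  apply: (aeRint_dct mI _ ik').
  - move=> n; apply: aemeasM => //; apply: measurable_aemeas; apply: measurable_funTS.
    apply: continuous_measurable_fun => t; apply: differentiable_continuous.
    by apply/derivable1_diffP; have [] := dpsi n t.
  - move=> n; apply: ae_in0 => t _; rewrite normrM ler_piMl//.
    have /andP[h1 h2] := smooth_step_bound (n.+1%:R * t + - (n.+1%:R * s)).
    have /andP[h3 h4] := smooth_step_bound (n.+1%:R * t + - (n.+1%:R * s')).
    by rewrite ler_norml; apply/andP; split; rewrite /psi; lra.
  - apply: ae_in0 => t _; apply: cvgMl.
    (* At [t = y] the step is evaluated at 0 and vanishes, so the limit has a strict inequality;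
       this is why the half-open interval, closed on the right, appears. *)
    have cB (y : R) : B (n.+1%:R * t + - (n.+1%:R * y)) @[n --> \oo] --> ((y < t)%R%:R : R).
      have [yt|ty] := ltP y t; last first.
        rewrite (_ : (fun n => _) = cst 0); first exact: cvg_cst.
        apply/funext => n; rewrite smooth_step0//.
        by rewrite subr_le0 ler_pM2l.
      have yt0 : 0 < t - y by rewrite subr_gt0.
      apply/cvgrPdist_le => e e0; have [n0 hn0] := @ltr_add_invr R 0 _ yt0.
      exists n0 => // n /= n0n; rewrite smooth_step1 ?subrr ?normr0 ?(ltW e0)//.
      rewrite -mulrBr -ler_pdivrMl// mulr1.
      rewrite add0r in hn0; apply: le_trans (ltW hn0).
      by rewrite lef_pV2 ?posrE ?ltr0n// ler_nat ltnS.
    rewrite (_ : \1_ _ t = ((s < t)%R%:R - (s' < t)%R%:R : R)).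
      by apply: cvgB; exact: cB.
    rewrite indicE; have [h1|h1] := ltP s t; have [h2|h2] := ltP s' t.
    + rewrite memNset ?subrr//= in_itv/= => /andP[_]; lra.
    + by rewrite mem_set ?subr0//= in_itv/= h1.
    + lra.
    + rewrite memNset ?subrr//= in_itv/= => /andP[]; lra.
have subI : (`]s, s']%classic : set (measurableTypeR R)) `<=` I.
  by move=> t /=; rewrite !in_itv/= => /andP[h1 h2]; rewrite (lt_trans s0 h1) (le_lt_trans h2).
have intk : \int[mu]_(t in I) (\1_(`]s, s']%classic) t * k t) = \int[mu]_(t in `]s, s']) k t.
  rewrite (Rintegral_supp mu subI); last first.
    by move=> t _ nt; rewrite indicE memNset// mul0r.
  apply: eq_Rintegral => t /set_mem ts; rewrite indicE mem_set ?mul1r//.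
apply/eqP; rewrite -subr_eq0 -normr_le0; apply/ler_addgt0Pr => e e0; rewrite add0r.
have e3 : 0 < e / 3 by rewrite divr_gt0.
have sI : 0 < s < T by rewrite s0.
have s'I : 0 < s' < T by rewrite s'0.
have [n1 h1] := mollify sI ma (ca _ sI) e3.
have [n2 h2] := mollify s'I ma (ca _ s'I) e3.
have /cvgrPdist_le /(_ _ e3) [n3 _ h3] := cpsi.
have Ts' : 0 < T - s' by rewrite subr_gt0.
have [n4 h4] := @ltr_add_invr R 0 _ Ts'.
pose n := maxn (maxn n1 n2) (maxn n3 n4).
have [i1 {}h1] := h1 n ltac:(by rewrite /n !leq_max leqnn ?orbT).
have [i2 {}h2] := h2 n ltac:(by rewrite /n !leq_max leqnn ?orbT).
have {}h3 := h3 n ltac:(by rewrite /= /n !leq_max leqnn ?orbT).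
have h4' : n.+1%:R^-1 < T - s'.
  rewrite add0r in h4; apply: le_lt_trans h4.
  by rewrite lef_pV2 ?posrE ?ltr0n// ler_nat ltnS /n !leq_max leqnn ?orbT.
have m0 : (0 : R) < n.+1%:R by rewrite ltr0n.
have test : time_test_fun T (psi n).
  split.
    apply/derivsP => l.
    have -> : psi n = (fun t => B (n.+1%:R * t + - (n.+1%:R * s)) +
        (-1) * B (n.+1%:R * t + - (n.+1%:R * s'))).
      by apply/funext => t; rewrite mulN1r.
    apply: derivsD; first by apply: derivs_affine; exact: derivs_smooth_step.
    apply: derivsM; first exact: derivs_cst.
    by apply: derivs_affine; exact: derivs_smooth_step.
  (* Before [s] both steps vanish, and after s' + 1/(n+1) both equal 1. The index [n4] keeps this
     point below [T]. *)
  exists s, (s' + n.+1%:R^-1); split => //; first by rewrite -ltrBrDl.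
  move=> t; rewrite in_itv/= negb_and -!ltNge => /orP[ts|ts].
    by rewrite /psi !smooth_step0 ?subrr// subr_le0 ler_pM2l// ltW// (lt_le_trans ts).
  have i0 : 0 < (n.+1%:R^-1 : R) by rewrite invr_gt0.
  have B1 y : y <= s' -> B (n.+1%:R * t + - (n.+1%:R * y)) = 1.
    move=> ys; rewrite smooth_step1// -mulrBr -ler_pdivrMl// mulr1 lerBrDl.
    by rewrite (le_trans _ (ltW ts))// lerD2r.
  by rewrite /psi !B1 ?subrr.
have := H _ test.
rewrite (_ : (fun t => derive1 (psi n) t * a t) =
  (fun t => n.+1%:R * D (n.+1%:R * t + - (n.+1%:R * s)) * a t -
            n.+1%:R * D (n.+1%:R * t + - (n.+1%:R * s')) * a t)); last first.
  by apply/funext => t; rewrite derive1E; have [_ ->] := dpsi n t; rewrite mulrBl.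
rewrite (aeRintB mI i1 i2) => eqn.
rewrite intk in h3; exact: three_thirds eqn h1 h2 h3.
Qed.

(** Lebesgue differentiation: the primitive of [k], extended by zero, has derivative [k] almost
    everywhere, while the hypothesis makes it constant on the open interval. *)
Lemma integral_increment_null (k : R -> R) : aeint mu I k ->
  (forall s s', 0 < s -> s <= s' -> s' < T -> \int[mu]_(t in `]s, s']) k t = 0) ->
  {ae mu, forall t, t \in `]0, T[ -> k t = 0}.
Proof.
move=> [k' ik kk'] H.
pose kI := (k' \_ I) : R -> R.
have iT : mu.-integrable setT (EFin \o kI).
  by rewrite /kI -restrict_EFin; apply/integrable_restrict => //=; rewrite setTI.
have iy (y : R) : mu.-integrable `]-oo, y] (EFin \o kI).
  by apply: integrableS iT => //; exact: measurable_itv.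
have loc : locally_integrable [set: R] kI.
  exact: integrable_locally.
have H' s s' : 0 < s -> s <= s' -> s' < T -> \int[mu]_(t in `]s, s']) kI t = 0.
  move=> s0 ss' s'T; rewrite -(H s s' s0 ss' s'T); apply: ae_eq_Rintegral.
  apply: filterS kk' => t h; rewrite /= in_itv/= => /andP[h1 h2].
  have tI : t \in `]0, T[ by rewrite in_itv/= (lt_trans s0 h1) (le_lt_trans h2).
  by rewrite /kI patchE mem_set//= h.
have := FTC1Ny iy loc; set F := fun x => _ => dF.
have Fc x y : 0 < x -> x <= y -> y < T -> F y = F x.
  move=> x0 xy yT; apply/eqP; rewrite -subr_eq0 /F; apply/eqP.
  rewrite Rintegral_itvB ?H'//; exact: iy.
have dF' : {ae mu, forall x, x \in `]0, T[ -> derive1 F x = kI x}.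
  move: dF; apply: filterS; first exact: (ae_filter_ringOfSetsType mu).
  by move=> x [].
apply: (ae_in2 kk' dF') => t tI kt Ft.
have kIt : kI t = k t by rewrite /kI patchE mem_set// kt.
rewrite -kIt -Ft derive1E; move: tI; rewrite /= in_itv/= => /andP[t0 tT].
pose c := F t; have nc : \near t, cst c t = F t.
  near=> y; have y0 : 0 < y by near: y; exact: lt_nbhsr.
  have yT : y < T by near: y; exact: lt_nbhsl.
  have [ty|yt] := leP t y; first by rewrite /= (Fc t y).
  by rewrite /= /c (Fc y t)// ltW.
by have [_ ->] := @near_eq_is_derive _ _ _ (cst c : R^o -> R^o) F t 1 0 nc (is_derive_cst _ _ _).
Unshelve. all: by end_near. Qed.

End mollification.

(** * The energy identity *)

Section energy_identity.
Variables (R : realType) (T : R).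
Hypothesis T0 : 0 < T.
Local Notation mu := (@lebesgue_measure R).
Local Notation I := (`]0, T[%classic : set (measurableTypeR R)).
Local Notation mI := (mI T).

(** [E] carries no topology, only a seminorm on [S], so the Heine argument is run by hand from the
    compactness of the segment. Only [t] ranges over the segment; [r] is any point close to it. *)
Lemma seminorm_uniformly_continuous (E : lmodType R) (S : set E) (N : E -> R)
    (z : R -> E) (a b : R) : seminorm_on S N -> (forall t, S (z t)) ->
  (forall t : R, N (z r - z t) @[r --> t] --> (0 : R)) ->
  forall eps, 0 < eps -> exists2 del, 0 < del & forall r t, a <= t <= b ->
    `|r - t| < del -> N (z r - z t) <= eps.
Proof.
move=> sN Sz cz eps eps0; have e2 : 0 < eps / 2 by rewrite divr_gt0.
pose P (del t : R) := forall r, `|r - t| < del -> N (z r - z t) <= eps.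
have /compact_near_coveringP := @segment_compact R a b.
move=> /(_ R (0 : R)^'+ P _) cov.
have key : \forall del \near (0 : R)^'+, `[a, b]%classic `<=` P del.
  apply: cov => x _; have /cvgrPdist_le /(_ _ e2) /nbhs_ballP[d /= d0 hd] := cz x.
  near=> t del; move=> r /= rt.
  have h y : `|y - x| < d -> N (z y - z x) <= eps / 2.
    move=> yx; have := hd y; rewrite /ball/= distrC => /(_ yx).
    by rewrite sub0r normrN; exact: le_trans (ler_norm _).
  have tx : `|t - x| < d / 2.
    by rewrite distrC; near: t; apply: (nbhsx_ballx x (d / 2)); rewrite divr_gt0.
  have del2 : del < d / 2.
    by near: del; apply: nbhs_right_lt; rewrite divr_gt0.
  have := sn_tri sN (Sz r) (Sz x) (Sz t).
  have rx : N (z r - z x) <= eps / 2.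
    apply: h; rewrite (_ : r - x = (r - t) + (t - x)); last by rewrite addrA subrK.
    by rewrite (le_lt_trans (ler_normD _ _))//; lra.
  have : N (z x - z t) <= eps / 2.
    rewrite (snC sN)//; apply: h; apply: lt_le_trans tx _.
    by rewrite ler_pdivrMr// ler_peMr ?ler1n// ltW.
  lra.
near (0 : R)^'+ => del.
have Pdel : `[a, b]%classic `<=` P del by near: del.
by exists del => // r t tab; exact: Pdel.
Unshelve. all: by end_near. Qed.

Lemma itvoo_lty (a b : R) : (mu (`]a, b[%classic : set R) < +oo)%E.
Proof. by rewrite lebesgue_measure_itv/=; case: ifP => _; rewrite ltry. Qed.

Lemma fine_itvoo (a b : R) : a < b -> fine (mu (`]a, b[%classic : set R)) = b - a.
Proof. by move=> ab; rewrite lebesgue_measure_itv/= lte_fin ab -EFinB. Qed.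

Lemma fine_itvoc (a b : R) : a <= b -> fine (mu (`]a, b]%classic : set R)) = b - a.
Proof.
move=> ab; rewrite lebesgue_measure_itv/= lte_fin -EFinB.
by case: ltP => //= ba; apply/esym/eqP; rewrite subr_eq0 eq_le ba ab.
Qed.

Lemma itvoc_lt (a b r : R) : 0 < r -> b - a < r -> (mu (`]a, b]%classic : set R) < r%:E)%E.
Proof.
by move=> r0 h; rewrite lebesgue_measure_itv/= lte_fin; case: ifP => _;
  rewrite -?EFinB lte_fin.
Qed.

Lemma aeRint_oc (f : R -> R) (a b : R) : aeint mu `]a, b]%classic f ->
  \int[mu]_(t in `]a, b[) f t = \int[mu]_(t in `]a, b]) f t.
Proof.
move=> [g ig fg].
have sub : (`]a, b[%classic : set (measurableTypeR R)) `<=` `]a, b]%classic.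
  by apply: subset_itvl; rewrite bnd_simp.
rewrite (ae_eq_Rintegral fg) (ae_eq_Rintegral (ae_eq_subset sub fg)).
apply: Rintegral_itv_bndo_bndc.
have mo : measurable (`]a, b[%classic : set (measurableTypeR R)) by exact: measurable_itv.
have mc : measurable (`]a, b]%classic : set (measurableTypeR R)) by exact: measurable_itv.
exact: (integrableS mc mo sub ig).
Qed.

Lemma aeint_patch (f : R -> R) : aeint mu I f -> aeint mu setT (f \_ I).
Proof.
move=> fi; apply: (aeint_supp mI measurableT (@subsetT _ _)) => [t _ nt|].
  by rewrite patchE memNset.
by apply: aeint_eq fi; apply: ae_in0 => t It; rewrite patchE mem_set.
Qed.

(** If every point satisfying [G] failed, [q] would exceed its mean by at least [eta / (b - a)]
    almost everywhere, and integration would give a contradiction. [G] carries the generic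
    properties wanted at the chosen point. *)
Lemma exists_below_mean (q : R -> R) (G : R -> Prop) (a b eta : R) :
  a < b -> aeint mu `]a, b[%classic q ->
  {ae mu, forall t, t \in `]a, b[ -> G t} -> 0 < eta ->
  exists t, [/\ a < t < b, G t &
    q t * (b - a) <= \int[mu]_(r in `]a, b[) q r + eta].
Proof.
move=> ab qi aG eta0; apply: contrapT => /forallNP H.
set Q := Rintegral _ _ _ in H.
have mJ : measurable (`]a, b[%classic : set (measurableTypeR R)) by exact: measurable_itv.
have ba0 : 0 < b - a by rewrite subr_gt0.
have le : {ae mu, forall t, t \in `]a, b[ -> (Q + eta) / (b - a) <= q t}.
  apply: (ae_in1 aG) => t tab Gt; rewrite ler_pdivrMr// leNgt; apply/negP => lt.
  by apply: (H t); split => //; exact: ltW.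
have ic : aeint mu `]a, b[%classic (fun=> (Q + eta) / (b - a)).
  apply: integrable_aeint; apply: measurable_bounded_integrable => //.
    exact: itvoo_lty.
  by exists `|(Q + eta) / (b - a)|; split => // y yc t _ /=; exact: ltW.
have := aeRint_le mJ ic qi le.
have fJ : fine (mu (`]a, b[%classic : set (measurableTypeR R))) = b - a.
  exact: fine_itvoo.
rewrite Rintegral_cst// fJ.
by rewrite divfK ?gt_eqF// -/Q leNgt ltrDl eta0.
Qed.

Let arith_len (j tau a b : R) :
  j * tau < a -> b < (j + 1 + 1) * tau -> b - a <= 2 * tau.
Proof. by move=> *; lra. Qed.

Let arith_step (eps qj qj' tau l : R) : 0 < eps -> 0 <= qj -> 0 <= qj' -> l <= 2 * tau ->
  2 / eps * (qj + qj' + 4 * eps ^+ 2) * l <=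
  8 * eps * l + 4 / eps * (qj * tau + qj' * tau).
Proof.
move=> e0 q0 q1 l0; have -> : 2 / eps * (qj + qj' + 4 * eps ^+ 2) * l =
  8 * eps * l + 2 / eps * ((qj + qj') * l) by field; rewrite gt_eqF.
have -> : 4 / eps * (qj * tau + qj' * tau) =
  2 / eps * ((qj + qj') * (2 * tau)) by field; rewrite gt_eqF.
by rewrite lerD2l ler_pM2l ?divr_gt0// ler_wpM2l// addr_ge0.
Qed.

Let arith_add (L a h h' b c q q' x t t' d : R) :
  L <= a * (h' - h) + x + b * (q' - q) -> x <= c * (t' - t) + d ->
  L <= a * h' + b * q' + c * t' - (a * h + b * q + c * t) + d.
Proof. by move=> *; lra. Qed.

Let arith_4div (eps s1 s2 : R) : 0 < eps -> s1 <= 2 * eps ^+ 2 -> s2 <= 2 * eps ^+ 2 ->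
  4 / eps * (s1 + s2) <= 16 * eps.
Proof.
move=> e0 h1 h2; have -> : 16 * eps = 4 / eps * (4 * eps ^+ 2) by field; rewrite gt_eqF.
by rewrite ler_pM2l ?divr_gt0//; lra.
Qed.

Let arith_final (eps FT F0 Fm Fz PT Pm Pz HT Hm Hz QT Qm Qz T1 tm tz : R) :
  0 < eps -> `|Fm - 2 * Pm - (Fz - 2 * Pz)| <=
    eps / 2 * Hm + 8 / eps * Qm + 8 * eps * tm
    - (eps / 2 * Hz + 8 / eps * Qz + 8 * eps * tz) + 16 * eps ->
  `|Fz - F0| <= eps -> `|FT - Fm| <= eps -> `|Pz| <= eps -> `|PT - Pm| <= eps ->
  0 <= Hz -> Hm <= HT -> 0 <= Qz -> Qm <= QT -> QT <= eps ^+ 2 ->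
  0 <= tz -> tm <= T1 ->
  `|FT - F0 - 2 * PT| <= eps * (HT / 2 + 8 * T1 + 30).
Proof.
move=> e0 h hF0 hFT hP0 hPT Hz0 HmT Qz0 QmT QTe tz0 tmT.
have W1 : eps / 2 * (Hm - Hz) <= eps / 2 * HT by rewrite ler_pM2l ?divr_gt0//; lra.
have W2 : 8 / eps * (Qm - Qz) <= 8 * eps.
  have -> : 8 * eps = 8 / eps * eps ^+ 2 by field; rewrite gt_eqF.
  by rewrite ler_pM2l ?divr_gt0//; lra.
have W3 : 8 * eps * (tm - tz) <= 8 * eps * T1 by rewrite ler_pM2l ?mulr_gt0//; lra.
move: h hF0 hFT hP0 hPT; rewrite !ler_norml.
move: W1 W2 W3; rewrite !mulrBr => W1 W2 W3.
move=> /andP[h1 h2] /andP[? ?] /andP[? ?] /andP[? ?] /andP[? ?].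
by apply/andP; split; lra.
Qed.

(** The scalar core of the energy identity: [P], [H] and [q] stand for the pairing of h and e, for
    |h|'^2 and for the squared distance from e to its continuous approximation z. In the bound, 8 T
    comes from the terms 4 eps^2 summed over lengths. The constant 30 is 16 (nodal values of [q]) +
    8 (integral of [q]) + 2 ([F] at both ends) + 4 (twice the integral of [P] near both ends). *)
Lemma riemann_energy (F P H q : R -> R) (G : R -> Prop) (eps del : R) :
  0 < eps -> 0 < del ->
  aeint mu I P -> aeint mu I H -> aeint mu I q ->
  (forall t, 0 <= H t) -> (forall t, 0 <= q t) ->
  \int[mu]_(t in I) q t <= eps ^+ 2 ->
  {ae mu, forall t, t \in `]0, T[ -> G t} ->
  (forall t, 0 < t < T -> t <= del -> `|F t - F 0| <= eps) ->
  (forall t, 0 < t < T -> T - t <= del -> `|F T - F t| <= eps) ->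
  (forall s s', G s -> G s' -> 0 < s -> s <= s' -> s' < T -> s' - s <= del ->
    `|F s' - F s - 2 * \int[mu]_(r in `]s, s']) P r| <=
    eps / 2 * \int[mu]_(r in `]s, s']) H r
    + 2 / eps * (q s + q s' + 4 * eps ^+ 2) * (s' - s)
    + 8 / eps * \int[mu]_(r in `]s, s']) q r) ->
  `|F T - F 0 - 2 * \int[mu]_(r in I) P r| <=
    eps * (\int[mu]_(r in I) H r / 2 + 8 * T + 30).
Proof.
move=> e0 d0 iP iH iq H0 q0 qe aG F0 FT step.
have iP' := aeint_patch iP; have iH' := aeint_patch iH; have iq' := aeint_patch iq.
set P' := P \_ I in iP'; set H' := H \_ I in iH'; set q' := q \_ I in iq'.
have sub f s s' : 0 < s -> s' < T ->
    \int[mu]_(r in `]s, s']) f r = \int[mu]_(r in `]s, s']) (f \_ I) r.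
  move=> s0 sT; apply: eq_Rintegral => r; rewrite inE/= in_itv/= => /andP[r1 r2].
  by rewrite patchE mem_set//= in_itv/= (lt_trans s0 r1) (le_lt_trans r2 sT).
have ia f a b : aeint mu setT f -> aeint mu `]a, b]%classic f.
  by apply: aeintS => //; exact: measurable_itv.
have full f : aeint mu I f -> \int[mu]_(r in I) f r = \int[mu]_(r in `]0, T]) (f \_ I) r.
  move=> fi; rewrite -aeRint_oc.
    by apply: eq_Rintegral => r rI; rewrite patchE rI.
  exact: ia (aeint_patch fi).
(* Integrals between consecutive nodes become differences of one primitive and telescope. *)
pose c f t := \int[mu]_(r in `]0, t]) f r : R.
have cB f s s' : aeint mu setT f -> 0 <= s -> s <= s' ->
    \int[mu]_(r in `]s, s']) f r = c f s' - c f s.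
  move=> fi s0 ss'; rewrite /c (aeRint_itv_split s0 ss'); last exact: ia.
  by rewrite addrAC subrr add0r.
have c0 f : c f 0 = 0 by rewrite /c set_itvoc0 Rintegral_set0.
have [d1 [d10 hd1]] : exists d1, 0 < d1 /\ forall a b, 0 <= a -> a <= b -> b - a < d1 ->
    `|\int[mu]_(r in `]a, b]) P' r| <= eps.
  have [g ig gP] := iP'.
  have [d1 [d10 hd1]] := integral_normr_continuous ig e0.
  exists d1; split => // a b a0 ab bad.
  have mab : measurable (`]a, b]%classic : set (measurableTypeR R)) by exact: measurable_itv.
  have sb : (`]a, b]%classic : set (measurableTypeR R)) `<=` setT by [].
  have gab := integrableS measurableT mab sb ig.
  rewrite (ae_eq_Rintegral (ae_eq_subset sb gP)).
  rewrite (le_trans (le_normr_Rintegral mab gab))// ltW// hd1//.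
  exact: itvoc_lt.
(* Nodes of adjacent cells are at most two mesh sizes apart, hence [del / 2]. The other term is
   [d1], below which the integral of [P] over the two end pieces is at most [eps]. *)
pose r := Num.min (del / 2) (d1 / T * T).
have r0 : 0 < r by rewrite lt_min divr_gt0//= divfK ?gt_eqF.
have [m hm] := @ltr_add_invr R 0 (r / T) (divr_gt0 r0 T0).
pose tau := T / m.+1%:R.
have m0 : (0 : R) < m.+1%:R by rewrite ltr0n.
have tau0 : 0 < tau by rewrite divr_gt0.
have taur : tau < r by rewrite /tau mulrC -ltr_pdivlMr// -[_^-1]add0r.
have [taud taud1] : tau < del / 2 /\ tau < d1.
  by move: taur; rewrite /r divfK ?gt_eqF// lt_min => /andP.
have mtau : m.+1%:R * tau = T by rewrite /tau mulrCA mulfV ?mulr1// gt_eqF.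
(* The slack of one cell; over all m+1 cells it adds up to [eps ^+ 2]. *)
pose eta := eps ^+ 2 / m.+1%:R.
have eta0 : 0 < eta by rewrite divr_gt0// exprn_gt0.
have node (j : nat) : exists t, (j < m.+1)%N -> [/\ j%:R * tau < t < j.+1%:R * tau,
    G t & q t * tau <= c q' (j.+1%:R * tau) - c q' (j%:R * tau) + eta].
  have [jm|jm] := ltnP j m.+1; last by exists 0.
  have j1 : j%:R * tau < j.+1%:R * tau by rewrite ltr_pM2r// ltr_nat.
  have jT : j.+1%:R * tau <= T by rewrite -mtau ler_pM2r// ler_nat.
  have j0 : 0 <= j%:R * tau by rewrite mulr_ge0// ltW.
  have sJ : (`]j%:R * tau, j.+1%:R * tau[%classic : set (measurableTypeR R)) `<=` I.
    move=> t /=; rewrite !in_itv/= => /andP[h1 h2].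
    by rewrite (le_lt_trans j0 h1) (lt_le_trans h2 jT).
  have qJ : aeint mu `]j%:R * tau, j.+1%:R * tau[%classic q.
    by apply: (aeintS _ mI sJ iq); exact: measurable_itv.
  have [t [tj Gt qt]] := exists_below_mean j1 qJ (ae_sub sJ aG) eta0.
  exists t => _; split => //.
  move: qt; rewrite -mulrBl -natrB// subSnn mul1r.
  rewrite -(cB _ _ _ iq' j0 (ltW j1)) -aeRint_oc; last exact: ia.
  congr (_ <= _ + _); apply: eq_Rintegral => s /set_mem /sJ Is.
  by rewrite /q' patchE mem_set.
have /choice[t ht] := node.
have tb j : (j < m.+1)%N -> 0 < t j < T.
  move=> jm; have [/andP[h1 h2] _ _] := ht j jm.
  rewrite (le_lt_trans (mulr_ge0 (ler0n _ _) (ltW tau0)) h1) (lt_le_trans h2)//.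
  by rewrite -mtau ler_pM2r// ler_nat.
have stepj j : (j.+1 < m.+1)%N ->
  `|(F (t j.+1) - 2 * c P' (t j.+1)) - (F (t j) - 2 * c P' (t j))| <=
   (eps / 2 * c H' (t j.+1) + 8 / eps * c q' (t j.+1) + 8 * eps * t j.+1)
   - (eps / 2 * c H' (t j) + 8 / eps * c q' (t j) + 8 * eps * t j)
   + 4 / eps * (q (t j) * tau + q (t j.+1) * tau).
  move=> jm; have jm' : (j < m.+1)%N by exact: ltnW.
  have [/andP[h1 h2] Gj _] := ht j jm'; have [/andP[h3 h4] Gj1 _] := ht j.+1 jm.
  have /andP[tj0 tjT] := tb j jm'; have /andP[tj10 tj1T] := tb j.+1 jm.
  have tt : t j <= t j.+1 by rewrite ltW// (lt_trans h2 h3).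
  have len : t j.+1 - t j <= 2 * tau.
    by apply: (@arith_len j%:R) => //; rewrite !natr1.
  have lend : t j.+1 - t j <= del.
    by rewrite (le_trans len)// mulrC -ler_pdivlMr// ltW.
  have := step _ _ Gj Gj1 tj0 tt tj1T lend.
  rewrite (sub P _ _ tj0 tj1T) (sub H _ _ tj0 tj1T) (sub q _ _ tj0 tj1T).
  rewrite (cB _ _ _ iP' (ltW tj0) tt) (cB _ _ _ iH' (ltW tj0) tt) (cB _ _ _ iq' (ltW tj0) tt).
  rewrite (_ : F (t j.+1) - F (t j) - 2 * (c P' (t j.+1) - c P' (t j)) =
    F (t j.+1) - 2 * c P' (t j.+1) - (F (t j) - 2 * c P' (t j))); last by ring.
  move=> st; apply: arith_add st _.
  exact: arith_step.
(* The local integrals of [q] add up to its integral over the whole interval, at most [eps ^+ 2],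
   and the slacks contribute as much again. *)
have sumq : \sum_(j < m.+1) q (t j) * tau <= 2 * eps ^+ 2.
  have : \sum_(j < m.+1) q (t j) * tau <=
      \sum_(j < m.+1) (c q' (j.+1%:R * tau) - c q' (j%:R * tau) + eta).
    by apply: ler_sum => j _; have [_ _] := ht j (ltn_ord j).
  rewrite big_split/= -(big_mkord xpredT (fun j => c q' (j.+1%:R * tau) - c q' (j%:R * tau))).
  rewrite telescope_sumr// mul0r c0 subr0 sumr_const card_ord mtau.
  have -> : eta *+ m.+1 = eps ^+ 2.
    by rewrite -mulr_natl /eta mulrCA mulfV ?mulr1// gt_eqF.
  rewrite {1}/c -(full _ iq).
  by move=> /le_trans; apply; rewrite [2 * _]mulrDl mul1r lerD2r.
have tele : `|(F (t m) - 2 * c P' (t m)) - (F (t 0%N) - 2 * c P' (t 0%N))| <=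
   (eps / 2 * c H' (t m) + 8 / eps * c q' (t m) + 8 * eps * t m)
   - (eps / 2 * c H' (t 0%N) + 8 / eps * c q' (t 0%N) + 8 * eps * t 0%N)
   + 16 * eps.
  pose A j := F (t j) - 2 * c P' (t j).
  pose V j := eps / 2 * c H' (t j) + 8 / eps * c q' (t j) + 8 * eps * t j.
  rewrite -/(A _) -/(A _) -/(V _) -/(V _).
  rewrite -(telescope_sumr A (leq0n m)) -(telescope_sumr V (leq0n m)).
  apply: le_trans (ler_norm_sum _ _ _) _.
  apply: (@le_trans _ _ (\sum_(0 <= j < m)
     (V j.+1 - V j + 4 / eps * (q (t j) * tau + q (t j.+1) * tau)))).
    rewrite big_nat [leRHS]big_nat; apply: ler_sum => j /andP[_ jm].
    exact: stepj.
  rewrite big_split/= lerD2l -mulr_sumr big_split/=.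
  have q1 : \sum_(0 <= j < m) q (t j) * tau <= 2 * eps ^+ 2.
    apply: le_trans sumq; rewrite big_mkord big_ord_recr/= lerDl.
    by rewrite mulr_ge0// ltW.
  have q2 : \sum_(0 <= j < m) q (t j.+1) * tau <= 2 * eps ^+ 2.
    apply: le_trans sumq; rewrite big_mkord big_ord_recl/= lerDr.
    by rewrite mulr_ge0// ltW.
  exact: arith_4div.
have /andP[t00 t0T] := tb 0%N isT; have /andP[tm0 tmT] := tb m (leqnn _).
have [/andP[_ t0tau] _ _] := ht 0%N isT; have [/andP[tmtau _] _ _] := ht m (leqnn _).
rewrite mul1r in t0tau.
have Ttm : T - t m < tau by rewrite ltrBlDr addrC -ltrBlDr -mtau -natr1 mulrDl mul1r addrK.
have mono (f : R -> R) : aeint mu setT f -> (forall r, 0 <= f r) ->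
    forall a b, 0 <= a -> a <= b -> c f a <= c f b.
  move=> fi f0 a b a0 ab; rewrite -subr_ge0 -cB//.
  by apply: Rintegral_ge0 => x _.
have pge0 (f : R -> R) : (forall r, 0 <= f r) -> forall r, 0 <= (f \_ I) r.
  by move=> f0 x; rewrite patchE; case: ifP.
have H1 := mono _ iH' (pge0 _ H0) _ _ (ltW tm0) (ltW tmT).
have H2 := mono _ iH' (pge0 _ H0) _ _ (lexx 0) (ltW t00).
have q1 := mono _ iq' (pge0 _ q0) _ _ (ltW tm0) (ltW tmT).
have q2 := mono _ iq' (pge0 _ q0) _ _ (lexx 0) (ltW t00).
have P1 := hd1 _ _ (lexx 0) (ltW t00) ltac:(by rewrite subr0 (lt_trans t0tau taud1)).
have P2 := hd1 _ _ (ltW tm0) (ltW tmT) (lt_trans Ttm taud1).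
rewrite cB// in P1; last exact: ltW.
rewrite cB// in P2; [|exact: ltW|exact: ltW].
have taud' : tau <= del by rewrite (le_trans (ltW taud))// ler_pdivrMr// ler_peMr ?ler1n// ltW.
have F1 := F0 _ (tb 0%N isT) (le_trans (ltW t0tau) taud').
have F2 := FT _ (tb m (leqnn _)) (le_trans (ltW Ttm) taud').
rewrite !c0 ?subr0 in H2 q2 P1.
rewrite (full _ iq) -/(c q' T) in qe.
rewrite (full _ iP) (full _ iH) -/(c P' T) -/(c H' T).
exact: (arith_final e0 tele F1 F2 P1 P2 H2 H1 q2 q1 qe (ltW t00) (ltW tmT)).
Qed.

End energy_identity.

(** * The energy identity for a function and its dual-valued derivative *)

Section lions_magenes.
Variables (R : realType) (T : R).
Hypothesis T0 : 0 < T.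
Local Notation mu := (@lebesgue_measure R).
Local Notation I := (`]0, T[%classic : set (measurableTypeR R)).
Local Notation mI := (mI T).
Variables (E : lmodType R) (S : set E) (N : E -> R) (Nd : (E -> R) -> R).
Hypothesis sN : seminorm_on S N.
Hypothesis dN : dual_norm S N Nd.
Let sS := sn_sub sN.
Let sD : seminorm_on (dual S N) Nd := dual_seminorm dN.

Lemma aeint_pairing (h : R -> E -> R) (e : R -> E) :
  bochnerL2 (dual S N) Nd T h -> bochnerL2 S N T e ->
  aeint mu I (fun t => h t (e t)).
Proof.
move=> hh he; have [Dh mh _] := hh; have [Se me _] := he.
apply: (aeint_le mI (aemeas_pairing sN dN Dh Se mh me)
  (sqint_mul mI (bL2_sqint sD hh) (bL2_sqint sN he))).
by apply: (ae_in2 Dh Se) => t _ D1 S1; exact: (dn_ub dN).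
Qed.

(* Young's inequality [A B <= eps A^2 / 2 + B^2 / (2 eps)]. *)
Let young (A a b c eps n1 n2 : R) : 0 < eps -> 0 <= A ->
  n1 <= a + eps + c -> n2 <= b + eps + c ->
  A * n1 + A * n2 <= eps / 2 * A ^+ 2 + 2 / eps * (a ^+ 2 + b ^+ 2 + 4 * eps ^+ 2)
    + 8 / eps * c ^+ 2.
Proof.
move=> e0 A0 h1 h2; set B := a + b + 2 * eps + 2 * c.
have h : A * n1 + A * n2 <= A * B.
  by rewrite -mulrDr ler_wpM2l// /B; lra.
apply: le_trans h _.
have hB : B ^+ 2 <= 4 * (a ^+ 2 + b ^+ 2 + 4 * eps ^+ 2 + 4 * c ^+ 2).
  rewrite -subr_ge0 /B.
  have -> : 4 * (a ^+ 2 + b ^+ 2 + 4 * eps ^+ 2 + 4 * c ^+ 2)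
      - (a + b + 2 * eps + 2 * c) ^+ 2 =
    (a - b) ^+ 2 + (a - 2 * eps) ^+ 2 + (a - 2 * c) ^+ 2 + (b - 2 * eps) ^+ 2
     + (b - 2 * c) ^+ 2 + (2 * eps - 2 * c) ^+ 2 by ring.
  by rewrite !addr_ge0// sqr_ge0.
have := sqr_ge0 (eps * A - B) => hq.
rewrite -subr_ge0.
have -> : eps / 2 * A ^+ 2 + 2 / eps * (a ^+ 2 + b ^+ 2 + 4 * eps ^+ 2)
    + 8 / eps * c ^+ 2 - A * B =
   ((eps * A - B) ^+ 2 + (4 * (a ^+ 2 + b ^+ 2 + 4 * eps ^+ 2 + 4 * c ^+ 2) - B ^+ 2))
     / (2 * eps) by field; rewrite gt_eqF.
by rewrite divr_ge0 ?mulr_ge0 ?(ltW e0)// addr_ge0// subr_ge0.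
Qed.

(** [F] is the squared L^2 norm of the continuous representative and [G] selects the times at which
    [e] is a genuine element of [S]. The difference between the two sides is bounded by [eps * K]
    with [K] independent of [eps]. *)
Lemma energy_identity (h : R -> E -> R) (e : R -> E) (F : R -> R) (G : R -> Prop) :
  bochnerL2 (dual S N) Nd T h -> bochnerL2 S N T e ->
  (forall eps, 0 < eps -> exists2 del, 0 < del &
    forall t, 0 < t < T -> t <= del -> `|F t - F 0| <= eps) ->
  (forall eps, 0 < eps -> exists2 del, 0 < del &
    forall t, 0 < t < T -> T - t <= del -> `|F T - F t| <= eps) ->
  {ae mu, forall t, t \in `]0, T[ -> G t} ->
  (forall t, G t -> S (e t)) ->
  (forall s s', G s -> G s' -> 0 < s -> s <= s' -> s' < T ->
    F s' - F s = \int[mu]_(r in `]s, s']) h r (e s + e s')) ->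
  F T - F 0 = 2 * \int[mu]_(r in I) h r (e r).
Proof.
move=> hh he F0 FT aG GS Fs.
have [Dh mh _] := hh; have [Se me _] := he.
have iP := aeint_pairing hh he.
have iH := (bL2_sqint sD hh).2.
set K := \int[mu]_(r in I) (Nd (h r) ^+ 2) / 2 + 8 * T + 30.
have K0 : 0 < K.
  have : 0 <= \int[mu]_(r in I) (Nd (h r) ^+ 2).
    by apply: Rintegral_ge0 => r _; exact: sqr_ge0.
  by move=> h0; rewrite /K ltr_wpDl// addr_ge0 ?divr_ge0// mulr_ge0// ltW.
suff key eps : 0 < eps ->
    `|F T - F 0 - 2 * \int[mu]_(r in I) h r (e r)| <= eps * K.
  apply/eqP; rewrite -subr_eq0 -normr_le0; apply/ler_addgt0Pr => x x0.
  by have := key (x / K) (divr_gt0 x0 K0); rewrite divfK ?gt_eqF// add0r.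
move=> e0.
(* The tolerance is a square because [q] is a squared distance and the Young inequality divides it
   by [eps]. *)
have [k [al [val [Sval cal al01 hz]]]] := bL2_continuous_approx sN he (exprn_gt0 2 e0).
pose z t := \sum_(i < k) al i t *: val i.
have Sz t : S (z t) by apply: sp_sum => // i _; exact: spZ.
have bz : bochnerL2 S N T z.
  apply: (bL2_sum sN) => i; apply: (bL2_scale T sN) => //.
  exact: continuous_measurable_fun.
have iq := (bL2_sqint sN (bL2B sN he bz)).2.
have cz (t : R) : N (z r - z t) @[r --> t] --> (0 : R).
  have c : (\sum_(i < k) `|al i r - al i t| * N (val i)) @[r --> t] --> (0 : R).
    rewrite [X in _ --> X](_ : 0 = \sum_(i < k) `|al i t - al i t| * N (val i)); last first.
      by rewrite big1// => i _; rewrite subrr normr0 mul0r.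
    apply: cvg_big => [|i _]; first exact: add_continuous.
    apply: cvgMl; apply: cvg_norm.
    by apply: cvgB; [exact: cal|exact: cvg_cst].
  apply: (squeeze_cvgr _ (cvg_cst 0) c).
  apply: nearW => r; rewrite (sn_ge0 sN)//=; last exact: spB.
  rewrite /z -sumrB (eq_bigr (fun i => (al i r - al i t) *: val i)); last first.
    by move=> i _; rewrite scalerBl.
  apply: le_trans (sn_sum sN _ _) _ => [i|]; first exact: spZ.
  by apply: ler_sum => i _; rewrite (sn_Z sN).
have [d1 d10 hd1] := seminorm_uniformly_continuous 0 T sN Sz cz e0.
have [d2 d20 hd2] := F0 _ e0; have [d3 d30 hd3] := FT _ e0.
pose del := Num.min (d1 / 2) (Num.min d2 d3).
have d0 : 0 < del by rewrite !lt_min divr_gt0//= d20.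
have [dd1 dd2 dd3] : [/\ del <= d1 / 2, del <= d2 & del <= d3].
  by rewrite /del !ge_min !lexx ?orbT.
apply: (riemann_energy T0 (P := fun r => h r (e r)) (H := fun r => Nd (h r) ^+ 2)
  (q := fun r => N (e r - z r) ^+ 2) (G := G) e0 d0 iP iH iq) => //.
- by move=> t; exact: sqr_ge0.
- by move=> t; exact: sqr_ge0.
- by move=> t tI td; apply: hd2 => //; exact: le_trans dd2.
- by move=> t tI td; apply: hd3 => //; exact: le_trans dd3.
move=> s s' Gs Gs' s0 ss' s'T len.
have Ss := GS _ Gs; have Ss' := GS _ Gs'.
pose J : set (measurableTypeR R) := `]s, s']%classic.
have mJ : measurable J by exact: measurable_itv.
have JI : J `<=` I.
  by move=> r; rewrite /J /= !in_itv/= => /andP[h1 h2]; rewrite (lt_trans s0 h1) (le_lt_trans h2).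
have iv := aeintS mJ mI JI (aeint_pairing hh (bL2_cst T sN (spD sS Ss Ss'))).
have iPJ := aeintS mJ mI JI iP.
have iHJ := aeintS mJ mI JI iH.
have iqJ := aeintS mJ mI JI iq.
rewrite (Fs _ _ Gs Gs' s0 ss' s'T) -(aeRintZ mJ 2 iPJ) -(aeRintB mJ iv (aeintZ mJ 2 iPJ)).
set C := N (e s - z s) ^+ 2 + N (e s' - z s') ^+ 2 + 4 * eps ^+ 2.
have ic : aeint mu J (fun=> 2 / eps * C).
  apply: integrable_aeint; apply: measurable_bounded_integrable => //.
    apply: lt_trans (ltry (s' - s + 1)); apply: itvoc_lt; last by rewrite ltrDl.
    by rewrite ltr_wpDl// subr_ge0.
  by exists `|2 / eps * C|; split => // y yc t _ /=; exact: ltW.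
have ib := aeintD mJ (aeintD mJ (aeintZ mJ (eps / 2) iHJ) ic) (aeintZ mJ (8 / eps) iqJ).
apply: le_trans (aeRint_norm_le mJ (aeint_aemeas (aeintB mJ iv (aeintZ mJ 2 iPJ))) ib _) _.
  apply: (ae_in2 (ae_sub JI Dh) (ae_sub JI Se)) => r rJ Dr Sr.
  have rr : s < r <= s' by move: rJ; rewrite /J /= in_itv.
  have /andP[r1 r2] := rr.
  (* The freezing error. Each difference is then passed through [z]: from e(s) to z(s), to z(r) by
     uniform continuity, to e(r). *)
  have -> : h r (e s + e s') - 2 * h r (e r) = h r (e s - e r) + h r (e s' - e r).
    by rewrite (dualD Dr)// !(dualB sN Dr)//; ring.
  have tri t : S (e t) -> 0 <= t <= T -> `|t - r| < d1 ->
      N (e t - e r) <= N (e t - z t) + eps + N (e r - z r).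
    move=> St tT tr.
    have := hd1 r t tT; rewrite distrC => /(_ tr) zz.
    apply: le_trans (sn_tri sN St (Sz t) Sr) _; rewrite -addrA lerD2l.
    apply: le_trans (sn_tri sN (Sz t) (Sz r) Sr) _.
    by rewrite (snC sN (Sz r) Sr) lerD2r (snC sN (Sz t) (Sz r)).
  have lt1 : d1 / 2 < d1 by rewrite ltr_pdivrMr// ltr_pMr// ltr1n.
  have close1 : `|s - r| < d1.
    rewrite distrC ger0_norm ?subr_ge0 ?(ltW r1)//.
    by apply: le_lt_trans lt1; apply: le_trans dd1; apply: le_trans len; rewrite lerD2r.
  have close2 : `|s' - r| < d1.
    rewrite ger0_norm ?subr_ge0//.
    by apply: le_lt_trans lt1; apply: le_trans dd1; apply: le_trans len; rewrite lerD2l lerN2 ltW.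
  have sT : 0 <= s <= T by rewrite (ltW s0)/= (le_trans ss')// ltW.
  have s'T' : 0 <= s' <= T by rewrite (le_trans (ltW s0) ss')/= ltW.
  apply: le_trans (ler_normD _ _) _.
  apply: le_trans (lerD (dn_ub dN Dr (spB sS Ss Sr)) (dn_ub dN Dr (spB sS Ss' Sr))) _.
  by apply: young => //; [exact: (dn_ge0 dN)|exact: tri|exact: tri].
rewrite (aeRintD mJ (aeintD mJ (aeintZ mJ (eps / 2) iHJ) ic) (aeintZ mJ (8 / eps) iqJ)).
rewrite (aeRintD mJ (aeintZ mJ (eps / 2) iHJ) ic).
rewrite (aeRintZ mJ _ iHJ) (aeRintZ mJ _ iqJ) lerD2r lerD2l.
rewrite Rintegral_cst//.
suff -> : fine (mu J) = s' - s by [].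
exact: fine_itvoc.
Qed.

End lions_magenes.

(** * Sobolev spaces on the domain *)

Section measurable_space_rV.
Variables (R : realType) (d : nat).
Implicit Types A : set 'rV[R]_d.

Lemma measurable_box (A : 'I_d -> set (measurableTypeR R)) :
  (forall i, measurable (A i)) ->
  measurable [set x : 'rV[R]_d | forall i, A i (x ord0 i)].
Proof.
move=> mA; rewrite (_ : [set x | _] = \bigcap_(i in [set: 'I_d])
    ((fun x : 'rV[R]_d => x ord0 i) @^-1` A i)); last first.
  by apply/seteqP; split=> x /= h; [move=> i _; exact: h|move=> i; exact: h].
apply: fin_bigcap_measurable => // i _.
by rewrite -[X in measurable X]setTI; exact: measurable_coord.
Qed.

(** Links the topology to the sigma-algebra generated by the coordinates: an open set is the union
    of the countably many rational boxes that it contains. *)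
Lemma open_measurable_rV A : open A -> measurable A.
Proof.
move=> oA.
pose box (p : 'rV[rat]_d * rat) := [set x : 'rV[R]_d |
  forall i, `]ratr (p.1 ord0 i) - ratr p.2, ratr (p.1 ord0 i) + ratr p.2[%classic (x ord0 i)].
pose F n := if unpickle n is Some p then if `[< box p `<=` A >] then box p else set0
  else set0.
have -> : A = \bigcup_n F n.
  apply/seteqP; split => [x Ax|x [n _]]; last first.
    by rewrite /F; case: unpickle => [p|//]; case: ifP => // /asboolP; exact.
  have [e /= e0 he] : nbhs_ball x A by apply/nbhs_ballP; exact: open_nbhs_nbhs.
  (* With a rational radius below e/2 and a rational centre within that radius of [x], every point
     of the box is within [e] of [x]. *)
  have e2 : 0 < e / 2 by rewrite divr_gt0.
  have [q] := rat_in_itvoo e2; rewrite in_itv/= => /andP[q0 qe].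
  have /choice[c hc] : forall i, exists c : rat, ratr c \in `]x ord0 i - ratr q, x ord0 i + ratr q[.
    by move=> i; apply: rat_in_itvoo; rewrite ltrD2l; rewrite gtrN.
  pose p : 'rV[rat]_d * rat := (\row_i c i, q).
  have xp : box p x.
    move=> i; have := hc i; rewrite /= !in_itv/= mxE => /andP[h1 h2].
    by apply/andP; split; lra.
  exists (pickle p) => //; rewrite /F pickleK; case: asboolP => // -[].
  move=> y yp; apply: he; split => // i j; rewrite (ord1 i).
  have := xp j; have := yp j; rewrite /= !in_itv/= => /andP[h1 h2] /andP[h3 h4].
  by rewrite /ball/= ltr_norml; apply/andP; split; lra.
apply: bigcupT_measurable => n; rewrite /F; case: unpickle => [p|]; last exact: measurable0.
case: ifP => _; last exact: measurable0.
have mi i : measurable (`]ratr (p.1 ord0 i) - ratr p.2,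
    ratr (p.1 ord0 i) + ratr p.2[%classic : set (measurableTypeR R)).
  exact: measurable_itv.
exact: (measurable_box mi).
Qed.

Lemma continuous_measurable_rV (f : 'rV[R]_d -> R) : continuous f ->
  measurable_fun setT (f : 'rV[R]_d -> measurableTypeR R).
Proof.
move=> /continuousP cf; apply: (measurability _ (RGenOpens.measurableE R)).
move=> _ [_ [a [b ->] <-]]; rewrite setTI; apply: open_measurable_rV.
exact/cf/interval_open.
Qed.

Lemma bounded_rV_lty A : measurable A -> bounded_set A -> (lebesgue_rV R d A < +oo)%E.
Proof.
move=> mA [M [_ hM]]; pose C := `|M| + 1.
have hC x : A x -> `|x| <= C by apply: hM; rewrite /C (le_lt_trans (ler_norm M))// ltrDl.
pose box := [set x : 'rV[R]_d | forall i, `[- C, C]%classic (x ord0 i)].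
have mi : forall i : 'I_d, measurable (`[- C, C]%classic : set (measurableTypeR R)).
  by move=> i; exact: measurable_itv.
have mbox : measurable box by exact: (measurable_box (A := fun=> `[- C, C]%classic)).
pose J : set (measurableTypeR R) := `[- C, C]%classic.
have Abox : A `<=` box.
  move=> x Ax i; rewrite /= in_itv/= -ler_norml (le_trans _ (hC _ Ax))//.
  rewrite [`|x|]mx_normrE; exact: (le_bigmax _ (fun ij => `|x ij.1 ij.2|) (ord0, i)).
have box_lty : (lebesgue_rV R d box < +oo)%E.
  have -> : lebesgue_rV R d box = (\prod_(i < d) lebesgue_measure J)%E.
    exact: (lebesgue_rV_box mi).
  rewrite ltey_eq; apply/orP; left.
  elim/big_ind : _ => [//|x y hx hy|i _]; first exact: fin_numM.
  by rewrite lebesgue_measure_itv/=; case: ifP.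
by apply: le_lt_trans box_lty; apply: le_measure; rewrite ?inE.
Qed.

End measurable_space_rV.

(** * Test functions and the L^2 form on the domain *)

Section test_functions.
Variables (R : realType) (d : nat) (Om : set 'rV[R]_d).
Local Notation fct := ('rV[R]_d -> R).
Implicit Types (f g : fct) (s : seq 'I_d).

Local Notation dpart s f := (foldr (@partial R d) f s).

Lemma partialL a f g i : (forall x, derivable f x (delta_mx ord0 i)) ->
  (forall x, derivable g x (delta_mx ord0 i)) ->
  partial i (a *: f + g) = a *: partial i f + partial i g.
Proof.
move=> df dg; apply/funext => x; rewrite /partial deriveD; last exact: dg.
  by rewrite deriveZ//; exact: df.
by apply: derivableZ; exact: df.
Qed.

Lemma dpartL a f g s : smooth f -> smooth g ->
  dpart s (a *: f + g) = a *: dpart s f + dpart s g.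
Proof.
move=> sf sg; elim: s => [//|i s IH] /=.
by rewrite IH partialL// => x; [exact: (sf s).2|exact: (sg s).2].
Qed.

Lemma smoothL a f g : smooth f -> smooth g -> smooth (a *: f + g).
Proof.
move=> sf sg s; rewrite dpartL//; have [cf df] := sf s; have [cg dg] := sg s; split.
  suff : continuous (fun x => a * dpart s f x + dpart s g x) by [].
  move=> x; exact: (cvgD (cvgM (cvg_cst a) (cf x)) (cg x)).
by move=> i x; apply: derivableD; [apply: derivableZ; exact: df|exact: dg].
Qed.

Lemma smooth_partial f i : smooth f -> smooth (partial i f).
Proof. by move=> sf s; have := sf (rcons s i); rewrite foldr_rcons. Qed.

(** The same compact set works: its complement is open, so [f] vanishes near each point of it and so
    does the derivative. *)
Lemma test_partial f i : test_fun Om f -> test_fun Om (partial i f).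
Proof.
move=> [sf [K [cK KOm f0]]]; split; first exact: smooth_partial.
exists K; split => // x nKx.
have clK : closed K by apply: compact_closed cK; exact: norm_hausdorff.
have oK : open (~` K) by exact: closed_openC.
have nK : \near x, cst 0 x = f x.
  have : nbhs x (~` K) by apply: open_nbhs_nbhs; split.
  by apply: filterS => y nKy; rewrite f0.
rewrite /partial -(near_eq_derive _ nK); exact: derive_cst.
Qed.

Lemma test_funL a f g : test_fun Om f -> test_fun Om g -> test_fun Om (a *: f + g).
Proof.
move=> [sf [K [cK KOm f0]]] [sg [K' [cK' KOm' g0]]]; split; first exact: smoothL.
exists (K `|` K'); split; first exact: compactU.
  by move=> x [/KOm|/KOm'].
move=> x /not_orP[nK nK'].
by change (a * f x + g x = 0); rewrite f0// g0// mulr0 addr0.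
Qed.

Lemma test_fun0 : test_fun Om (0 : fct).
Proof.
split.
  have E s : dpart s (0 : fct) = 0.
    elim: s => [//|i s /= ->]; apply/funext => x; exact: derive_cst.
  move=> s; rewrite E; split; first exact: (@cst_continuous _ _ (0 : R)).
  by move=> i x; exact: derivable_cst.
exists set0; split => //; exact: compact0.
Qed.

Hypotheses (Om_open : open Om) (Om_bounded : bounded_set Om).
Local Notation leb := (lebesgue_rV R d).

Lemma mOm : measurable Om.
Proof. exact: open_measurable_rV. Qed.

Lemma L2_sqint f : L2 Om f -> sqint leb Om f.
Proof.
move=> [mf ff]; split; first exact: measurable_aemeas.
apply: aeintP => //; first exact: aemeasX (measurable_aemeas _ mf).
by apply: aeW => x _; exact: sqr_ge0.
Qed.

Lemma sqint_L2 f : measurable_fun Om f -> sqint leb Om f -> L2 Om f.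
Proof. by move=> mf [_ sf]; split => //; exact: (aeint_lty mOm sf). Qed.

Lemma L2_psd : psd_form (L2 Om) (L2dot Om).
Proof.
have [sS sym lin ge] := L2form_psd leb mOm.
split.
- split; first by apply: sqint_L2; [exact: measurable_cst|exact: sp0 sS].
  move=> a f g Lf Lg; apply: sqint_L2; last by apply: spL => //; exact: L2_sqint.
  apply: measurable_funD; last exact: Lg.1.
  by apply: measurable_funM; [exact: measurable_cst|exact: Lf.1].
- by move=> f g Lf Lg; apply: sym; exact: L2_sqint.
- by move=> a f f' g Lf Lf' Lg; apply: lin; exact: L2_sqint.
- by move=> f Lf; apply: ge; exact: L2_sqint.
Qed.

Lemma L2dot_ae f f' g g' : ae_eq leb Om f f' -> ae_eq leb Om g g' ->
  L2dot Om f g = L2dot Om f' g'.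
Proof.
move=> ff gg; apply: ae_eq_Rintegral; apply: (ae_in2 ff gg) => x _ -> -> //.
Qed.

Lemma test_L2 f : test_fun Om f -> L2 Om f.
Proof.
move=> [sf [K [cK KOm f0]]].
have cf : continuous f := (sf [::]).1.
have mf : measurable_fun Om f.
  by apply: measurable_funTS; exact: continuous_measurable_rV.
apply: sqint_L2 => //; split; first exact: measurable_aemeas.
have cfK : {within K, continuous f} by exact: continuous_subspaceT.
have [M [_ hM]] := compact_bounded (continuous_compact cfK cK).
have bf x : `|f x| <= `|M| + 1.
  have [Kx|nKx] := pselect (K x); last by rewrite f0// normr0 addr_ge0.
  by apply: hM; [rewrite (le_lt_trans (ler_norm M))// ltrDl|exists x].
apply: integrable_aeint; apply: measurable_bounded_integrable.
- exact: mOm.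
- exact: bounded_rV_lty mOm _.
- exact: measurable_funX.
- exists ((`|M| + 1) ^+ 2); split => // y yC x _ /=.
  by rewrite normrX (le_trans _ (ltW yC))// ler_pXn2r// nnegrE ?normr_ge0// addr_ge0.
Qed.

End test_functions.

(** * The gradient form and its dual norm *)

Section sobolev.
Variables (R : realType) (d : nat) (Om : set 'rV[R]_d).
Hypotheses (Om_open : open Om) (Om_bounded : bounded_set Om).
Local Notation fct := ('rV[R]_d -> R).
Local Notation leb := (lebesgue_rV R d).
Implicit Types (v w : fct) (G H : 'I_d -> fct).
Let pL := L2_psd Om_open.
Let sL := psd_seminorm pL.
Let LS := psd_sub pL.

Lemma L2norm_cvgL a (u u' : nat -> fct) v v' :
  (forall n, L2 Om (u n)) -> (forall n, L2 Om (u' n)) -> L2 Om v -> L2 Om v' ->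
  L2norm Om (u n \- v) @[n --> \oo] --> (0 : R) ->
  L2norm Om (u' n \- v') @[n --> \oo] --> (0 : R) ->
  L2norm Om ((a *: u n + u' n) \- (a *: v + v')) @[n --> \oo] --> (0 : R).
Proof.
move=> Lu Lu' Lv Lv' cu cu'.
apply: (cvg0_le (v := fun n => `|a| * L2norm Om (u n \- v) + L2norm Om (u' n \- v'))).
  move=> n; rewrite ger0_norm; last exact: sqrtr_ge0.
  rewrite (_ : _ \- _ = a *: (u n - v) + (u' n - v')).
    have := sn_D sL (spZ a LS (spB LS (Lu n) Lv)) (spB LS (Lu' n) Lv').
    by rewrite (sn_Z sL)//; exact: spB.
  by rewrite scalerBr addrACA -opprD.
rewrite [X in _ --> X](_ : 0 = `|a| * 0 + 0); last by rewrite mulr0 addr0.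
by apply: cvgD => //; exact: cvgMr.
Qed.

Lemma L2dot_cvg (u : nat -> fct) v w : (forall n, L2 Om (u n)) -> L2 Om v -> L2 Om w ->
  L2norm Om (u n \- v) @[n --> \oo] --> (0 : R) ->
  L2dot Om w (u n) @[n --> \oo] --> L2dot Om w v.
Proof.
move=> Lu Lv Lw cu; apply: cvg_zero.
apply: (cvg0_le (v := fun n => L2norm Om w * L2norm Om (u n \- v))).
  move=> n; change (`|L2dot Om w (u n) - L2dot Om w v| <= L2norm Om w * L2norm Om (u n - v)).
  by rewrite -(psdrB pL)//; apply: (psd_cs pL) => //; exact: spB.
by rewrite -[0 in X in _ --> X](mulr0 (L2norm Om w)); exact: cvgMr.
Qed.

Lemma H10_gradientL a v w G H : H10_gradient Om v G -> H10_gradient Om w H ->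
  H10_gradient Om (a *: v + w) (fun i => a *: G i + H i).
Proof.
move=> [[Lv LG wv] [phi [tp cp dp]]] [[Lw LH ww] [chi [tc cc dc]]].
have TL f := @test_L2 _ _ _ f.
split.
  split; first exact: spL.
    by move=> i; exact: spL.
  move=> i f tf; have Lf := test_L2 Om_open Om_bounded tf.
  have Lpf := test_L2 Om_open Om_bounded (test_partial i tf).
  by rewrite !(psd_lin pL)// wv// ww//; ring.
exists (fun n => a *: phi n + chi n); split.
- by move=> n; exact: test_funL.
- by apply: L2norm_cvgL => // n; exact: test_L2.
- move=> i; have -> : (fun n => L2norm Om (partial i (a *: phi n + chi n) \- (a *: G i + H i)))
    = (fun n => L2norm Om ((a *: partial i (phi n) + partial i (chi n)) \- (a *: G i + H i))).
    apply/funext => n; rewrite partialL// => x.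
      exact: ((tp n).1 [::]).2.
    exact: ((tc n).1 [::]).2.
  by apply: L2norm_cvgL => // n; apply: test_L2 => //; exact: test_partial.
Qed.

Lemma H10_gradient0 : H10_gradient Om (0 : fct) (fun=> 0).
Proof.
have L0 := sp0 LS.
have n0 : L2norm Om (0 \- 0 : fct) = 0.
  by change (form_norm (L2dot Om) (0 - 0) = 0); rewrite subrr (sn0 sL).
split.
  split => // i f tf; rewrite !(psdl0 pL) ?oppr0//; first exact: test_L2.
  by apply: test_L2 => //; exact: test_partial.
exists (fun=> 0); split.
- by move=> n; exact: test_fun0.
- by rewrite n0; exact: cvg_cst.
- move=> i; have -> : partial i (0 : fct) = 0.
    by apply/funext => x; exact: derive_cst.
  by rewrite n0; exact: cvg_cst.
Qed.

(* Each [partial i (phi n)] is itself a test function, so the gradient of a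
   null function is orthogonal to its own approximants. *)
Lemma H10_gradient_null v G i : H10_gradient Om v G -> L2norm Om v = 0 ->
  L2norm Om (G i) = 0.
Proof.
move=> [[Lv LG wv] [phi [tp cp dp]]] v0.
have tpp n := test_partial i (tp n).
have Lp n := test_L2 Om_open Om_bounded (tpp n).
have := L2dot_cvg Lp (LG i) (LG i) (dp i).
have -> : (fun n => L2dot Om (G i) (partial i (phi n))) = fun=> 0.
  apply/funext => n; apply/eqP; rewrite -oppr_eq0 -wv//.
  have Lpp := test_L2 Om_open Om_bounded (test_partial i (tpp n)).
  by rewrite (psd_null pL Lv Lpp v0).
move=> /cvg_lim => /(_ (@Rhausdorff R)); rewrite lim_cst; last exact: Rhausdorff.
by rewrite /L2norm => <-; rewrite sqrtr0.
Qed.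

Lemma H10_subspace : subspace (H10 Om).
Proof.
split; first by exists (fun=> 0); exact: H10_gradient0.
by move=> a v w [G hG] [H hH]; exists (fun i => a *: G i + H i); exact: H10_gradientL.
Qed.

Lemma H10_L2 v : H10 Om v -> L2 Om v.
Proof. by move=> [G [[]]]. Qed.

Lemma grad_spec v : H10 Om v -> H10_gradient Om v (grad Om v).
Proof. by move=> [G hG]; exact: (xgetPex _ (ex_intro _ G hG)). Qed.

(** By linearity [G - H] is a gradient of the zero function, to which [H10_gradient_null]
    applies. *)
Lemma H10_gradient_uniq v G H i : H10_gradient Om v G -> H10_gradient Om v H ->
  L2norm Om (G i - H i) = 0.
Proof.
move=> hG hH; have := H10_gradientL (-1) hH hG.
rewrite scaleN1r addNr => /(H10_gradient_null i).
rewrite scaleN1r addrC; apply.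
by change (form_norm (L2dot Om) 0 = 0); exact: (sn0 sL).
Qed.

(** [grad] is an arbitrary choice, so it is not visibly linear. Since gradients are unique up to
    null functions, the form can be computed with any of them, in particular with sums of
    gradients. *)
Lemma graddotE v w G H : H10_gradient Om v G -> H10_gradient Om w H ->
  graddot Om v w = \sum_(i < d) L2dot Om (G i) (H i).
Proof.
move=> hG hH; apply: eq_bigr => i _.
have gv := grad_spec (ex_intro _ G hG); have gw := grad_spec (ex_intro _ H hH).
have [[_ LG _] _] := hG; have [[_ LH _] _] := hH.
have [[_ Lgv _] _] := gv; have [[_ Lgw _] _] := gw.
have e1 := H10_gradient_uniq i gv hG; have e2 := H10_gradient_uniq i gw hH.
have h1 : L2dot Om (grad Om v i) (grad Om w i) = L2dot Om (G i) (grad Om w i).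
  by apply/eqP; rewrite -subr_eq0 -(psdlB pL)// (psd_null pL)//; exact: spB.
rewrite h1; apply/eqP; rewrite -subr_eq0 -(psdrB pL)//.
by rewrite (psd_sym pL)// ?(psd_null pL)//; exact: spB.
Qed.

Lemma graddot_psd : psd_form (H10 Om) (graddot Om).
Proof.
split; first exact: H10_subspace.
- move=> v w [G hG] [H hH]; rewrite (graddotE hG hH) (graddotE hH hG).
  have [[_ LG _] _] := hG; have [[_ LH _] _] := hH.
  by apply: eq_bigr => i _; exact: (psd_sym pL).
- move=> a v v' w [G hG] [G' hG'] [H hH].
  rewrite (graddotE (H10_gradientL a hG hG') hH) (graddotE hG hH) (graddotE hG' hH).
  have [[_ LG _] _] := hG; have [[_ LH _] _] := hH; have [[_ LG' _] _] := hG'.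
  rewrite mulr_sumr -big_split/=; apply: eq_bigr => i _.
  exact: (psd_lin pL).
- move=> v [G hG]; rewrite (graddotE hG hG); apply: sumr_ge0 => i _.
  by have [[_ LG _] _] := hG; exact: (psd_ge0 pL).
Qed.

Lemma gradnorm_seminorm : seminorm_on (H10 Om) (gradnorm Om).
Proof. exact: psd_seminorm graddot_psd. Qed.

Lemma L2norm_ae0 v : L2 Om v -> ae_eq leb Om v (cst 0) -> L2norm Om v = 0.
Proof.
move=> Lv v0; rewrite /L2norm (L2dot_ae v0 v0).
by change (form_norm (L2dot Om) 0 = 0); exact: (sn0 sL).
Qed.

Lemma gradnorm_ae0 v : H10 Om v -> ae_eq leb Om v (cst 0) -> gradnorm Om v = 0.
Proof.
move=> [G hG] v0; rewrite /gradnorm (graddotE hG hG) big1 ?sqrtr0// => i _.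
have [[Lv LG _] _] := hG.
have := H10_gradient_null i hG (L2norm_ae0 Lv v0).
by rewrite /L2norm => /eqP; rewrite sqrtr_eq0 => h; apply/eqP; rewrite eq_le h (psd_ge0 pL).
Qed.

(** The supremum in [Hm1norm] excludes the [v] that vanish almost everywhere, whereas the interface
    speaks of all of H^1_0. The two are reconciled by [gradnorm_ae0] and by the bound in [dual],
    which makes [Phi v] vanish whenever [gradnorm Om v] does. *)
Lemma Hm1norm_dual : dual_norm (H10 Om) (gradnorm Om) (Hm1norm Om).
Proof.
have sN := gradnorm_seminorm; have sS := H10_subspace.
set A := fun Phi : fct -> R => [set Phi v / gradnorm Om v |
       v in [set v : fct | H10 Om v /\ ~ ae_eq leb Om v (cst 0)]].
have ub (Phi : fct -> R) : dual (H10 Om) (gradnorm Om) Phi -> exists2 C, 0 <= C & ubound (A Phi) C.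
  move=> [_ [C hC]]; exists `|C| => // _ [v [Hv _] <-].
  (* A quotient with zero denominator is 0 by convention, hence harmless for an upper bound. *)
  have [->|N0] := eqVneq (gradnorm Om v) 0; first by rewrite invr0 mulr0.
  rewrite ler_pdivrMr ?lt_def ?N0 ?sqrtr_ge0//.
  by rewrite (le_trans (ler_norm _))// (le_trans (hC _ Hv))// ler_wpM2r ?ler_norm// sqrtr_ge0.
have hub (Phi : fct -> R) v : dual (H10 Om) (gradnorm Om) Phi -> H10 Om v ->
    Phi v <= Hm1norm Om Phi * gradnorm Om v.
  move=> dP Hv; have [N0|N0] := eqVneq (gradnorm Om v) 0.
    by case: dP => _ [C /(_ _ Hv)]; rewrite N0 !mulr0 normr_le0 => /eqP ->.
  rewrite -ler_pdivrMr ?lt_def ?N0 ?sqrtr_ge0//.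
  have [C _ hC] := ub _ dP.
  apply: (@ub_le_sup _ (A Phi)); first by exists C.
  exists v => //; split => // v0; move: N0; rewrite gradnorm_ae0// eqxx//.
split.
- move=> Phi dP; have [A0|/nonemptyPn A0] := pselect (A Phi !=set0); last first.
    by rewrite /Hm1norm -/(A Phi) A0 sup0.
  have [_ [v [Hv nv] _]] := A0.
  (* Nonnegativity: either the quotient 0 belongs to the set, or the bounds for [v] and [- v] are
     added. *)
  have [g0|g0] := eqVneq (gradnorm Om v) 0.
    have [C _ hC] := ub _ dP.
    apply: (@ub_le_sup _ (A Phi)); first by exists C.
    by exists v => //; rewrite g0 invr0 mulr0.
  have gp : 0 < gradnorm Om v by rewrite lt_def g0 sqrtr_ge0.
  have h1 := hub _ _ dP Hv; have h2 := hub _ _ dP (spN sS Hv).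
  rewrite (dualN sN dP Hv) (snN sN Hv) in h2.
  by rewrite -(pmulr_lge0 _ gp); lra.
- move=> Phi v dP Hv; rewrite ler_norml hub// andbT lerNl.
  by rewrite -(dualN sN dP Hv) -[in leRHS](snN sN Hv) hub//; exact: spN.
- move=> Phi C dP C0 hC; have [A0|/nonemptyPn A0] := pselect (A Phi !=set0); last first.
    by rewrite /Hm1norm -/(A Phi) A0 sup0.
  apply: ge_sup => // _ [v [Hv _] <-].
  have [->|N0] := eqVneq (gradnorm Om v) 0; first by rewrite invr0 mulr0.
  by rewrite ler_pdivrMr ?lt_def ?N0 ?sqrtr_ge0// hC.
Qed.

End sobolev.

(** * The time grid *)

Section time_grid_expansions.
Variables (R : realType) (T : R) (N : nat) (tn : nat -> R).
Hypothesis grid : time_grid T N tn.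
Local Notation mu := (@lebesgue_measure R).
Local Notation I := (`]0, T[%classic : set (measurableTypeR R)).

Lemma tn_lt n : (n < N)%N -> tn n < tn n.+1.
Proof. by case: grid => _ _ _; apply. Qed.

Lemma tn_le m n : (m <= n)%N -> (n <= N)%N -> tn m <= tn n.
Proof.
elim: n => [|n IH]; first by rewrite leqn0 => /eqP ->.
rewrite leq_eqVlt => /predU1P[->//|mn] nN.
by rewrite (le_trans (IH mn (ltnW nN)))// ltW// tn_lt.
Qed.

Lemma tn_ge0 n : (n <= N)%N -> 0 <= tn n.
Proof. by move=> nN; case: grid => _ <- _ _; exact: tn_le. Qed.

Lemma tn_leT n : (n <= N)%N -> tn n <= T.
Proof. by move=> nN; case: grid => _ _ <- _; exact: tn_le. Qed.

Lemma grid_cell_oc t : 0 < t <= T ->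
  exists k, [/\ (k < N)%N, tn k < t & t <= tn k.+1].
Proof.
case: grid => N1 t0 tN _ /andP[tpos tT].
have ex : exists n, t <= tn n by exists N; rewrite tN.
have [n nP nmin] := ex_minnP ex; case: n nP nmin => [|k] nP nmin.
  by move: nP; rewrite t0 leNgt tpos.
exists k; split => //; first by apply: nmin; rewrite tN.
by rewrite ltNge; apply/negP => /nmin; rewrite ltnn.
Qed.

Lemma grid_cell t : 0 <= t <= T ->
  exists k, [/\ (k < N)%N, tn k <= t & t <= tn k.+1].
Proof.
case: (grid) => N1 t0 _ _ /andP[]; rewrite le_eqVlt => /predU1P[<-|tpos] tT.
  by exists 0%N; split => //; rewrite ?t0// -t0; exact: tn_le.
have [|k [kN k1 k2]] := @grid_cell_oc t; first by rewrite tpos.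
by exists k; split => //; exact: ltW.
Qed.

(** Writes both reconstructions as finite sums of fixed vectors with scalar coefficients in [0, 1],
    so that measurability, integrability and continuity reduce to the coefficients. Steps before the
    current one have coefficient 1, later ones 0. *)
Lemma sum_increments (E : lmodType R) (b : nat -> E) (c : nat -> R) k :
  (k < N)%N -> (forall n, (n < k)%N -> c n = 1) ->
  (forall n, (k < n < N)%N -> c n = 0) ->
  b 0%N + \sum_(n < N) c n *: (b n.+1 - b n) = b k + c k *: (b k.+1 - b k).
Proof.
move=> kN c1 c0; rewrite -(big_mkord xpredT (fun n => c n *: (b n.+1 - b n))).
rewrite (big_cat_nat (n := k))//=; last exact: ltnW.
have z : \sum_(k.+1 <= n < N) c n *: (b n.+1 - b n) = 0.
  by rewrite big_nat_cond big1// => n; rewrite andbT => /c0 ->; rewrite scale0r.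
rewrite (big_ltn kN) z addr0.
rewrite (eq_big_nat _ _ (F2 := fun n => b n.+1 - b n)); last first.
  by move=> n /andP[_ /c1 ->]; rewrite scale1r.
by rewrite telescope_sumr// addrA [b 0%N + _]addrC subrK.
Qed.

(** Index [n] refers to the step from [tn n] to [tn n.+1], whose Euler value is [un n.+1]. [ramp]
    builds [U_tau], [jump] builds [u_tau], and [cell], divided by the step length, is the derivative
    of [ramp]. *)
Definition ramp n t := clip01 ((t - tn n) / (tn n.+1 - tn n)).
Definition jump n t : R := \1_(`]tn n, +oo[%classic) t.
Definition cell n t : R := \1_(`]tn n, tn n.+1]%classic) t.

Lemma sum_ramp (E : lmodType R) (b : nat -> E) k t :
  (k < N)%N -> tn k <= t -> t <= tn k.+1 ->
  b 0%N + \sum_(n < N) ramp n t *: (b n.+1 - b n) =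
  b k + ((t - tn k) / (tn k.+1 - tn k)) *: (b k.+1 - b k).
Proof.
move=> kN k1 k2; have tau0 n : (n < N)%N -> 0 < tn n.+1 - tn n.
  by move=> nN; rewrite subr_gt0 tn_lt.
rewrite (@sum_increments _ b (ramp ^~ t) k)//.
- congr (_ + _ *: _); rewrite /ramp clip01_id// divr_ge0 ?subr_ge0 ?(ltW (tn_lt kN))//=.
  by rewrite ler_pdivrMr ?tau0// mul1r lerD2r.
- move=> n nk; rewrite /ramp clip01_1// ler_pdivlMr ?tau0 ?(ltn_trans nk)// mul1r lerD2r.
  by rewrite (le_trans _ k1)// tn_le// ltnW.
- move=> n /andP[kn nN]; rewrite /ramp clip01_0// pmulr_lle0 ?invr_gt0 ?tau0// subr_le0.
  by rewrite (le_trans k2)// tn_le// ltnW.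
Qed.

Lemma sum_jump (E : lmodType R) (b : nat -> E) k t :
  (k < N)%N -> tn k < t -> t <= tn k.+1 ->
  b 0%N + \sum_(n < N) jump n t *: (b n.+1 - b n) = b k.+1.
Proof.
move=> kN k1 k2; have j n : jump n t = (tn n < t)%R%:R.
  rewrite /jump indicE; have [h|h] := ltP (tn n) t.
    by rewrite mem_set//= in_itv/= h.
  by rewrite memNset//= in_itv/= andbT; apply/negP; rewrite -leNgt.
rewrite (@sum_increments _ b (jump ^~ t) k)//.
- by rewrite j k1 scale1r addrC subrK.
- move=> n nk; rewrite j (le_lt_trans _ k1)// tn_le//; exact: ltnW.
- move=> n /andP[kn nN]; rewrite j ltNge (le_trans k2)// tn_le//; exact: ltnW.
Qed.

Lemma sum_cell (E : lmodType R) (a : nat -> E) k t :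
  (k < N)%N -> tn k < t -> t <= tn k.+1 ->
  \sum_(n < N) cell n t *: a n = a k.
Proof.
move=> kN k1 k2; rewrite (bigD1 (Ordinal kN))//= big1 ?addr0.
  by rewrite /cell indicE mem_set ?scale1r//= in_itv/= k1.
move=> n nk; rewrite /cell indicE memNset ?scale0r//= in_itv/= => /andP[h1 h2].
have [h|h|h] := ltngtP n k.
- by move: (lt_le_trans k1 h2); rewrite ltNge tn_le// ltnW.
- by move: (lt_le_trans h1 k2); rewrite ltNge tn_le// ltnW.
- by move: nk; rewrite -val_eqE/= h eqxx.
Qed.

Lemma ramp_continuous n : continuous (ramp n).
Proof.
move=> t; apply: (@continuous_comp _ _ _ (fun t => (t - tn n) / (tn n.+1 - tn n)) (@clip01 R)).
  by apply: cvgMl; apply: cvgB; [exact: cvg_id|exact: cvg_cst].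
exact: clip01_continuous.
Qed.

Lemma ramp_bound n t : 0 <= ramp n t <= 1.
Proof. exact: clip01_bound. Qed.

Lemma indic_bound (A : set R) t : 0 <= (\1_A t : R) <= 1.
Proof. by rewrite indicE; case: (_ \in _); rewrite /= ?ler01 ?lexx. Qed.

Lemma measurable_ramp n :
  measurable_fun setT (ramp n : measurableTypeR R -> measurableTypeR R).
Proof. by apply: continuous_measurable_fun; exact: ramp_continuous. Qed.

Lemma measurable_jump n :
  measurable_fun setT (jump n : measurableTypeR R -> measurableTypeR R).
Proof. by apply: measurable_indic; exact: measurable_itv. Qed.

Lemma measurable_cell n :
  measurable_fun setT (cell n : measurableTypeR R -> measurableTypeR R).
Proof. by apply: measurable_indic; exact: measurable_itv. Qed.

Section reconstruction_expansions.
Variables (d : nat) (un : nat -> 'rV[R]_d -> R).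

Lemma piecewise_affine_ramp t : 0 <= t <= T ->
  piecewise_affine N tn un t = un 0%N + \sum_(n < N) ramp n t *: (un n.+1 - un n).
Proof.
move=> /grid_cell[k [kN k1 k2]]; rewrite (sum_ramp un kN k1 k2).
apply/funext => x; rewrite (@piecewise_affineE R N tn T grid d un k.+1)//=; last by rewrite k1.
change ((t - tn k) / (tn k.+1 - tn k) * un k.+1 x + (tn k.+1 - t) / (tn k.+1 - tn k) * un k x
  = un k x + (t - tn k) / (tn k.+1 - tn k) * (un k.+1 x - un k x)).
by field; rewrite subr_eq0 gt_eqF// tn_lt.
Qed.

Lemma piecewise_constant_jump t : 0 < t <= T ->
  piecewise_constant N tn un t = un 0%N + \sum_(n < N) jump n t *: (un n.+1 - un n).
Proof.
move=> /grid_cell_oc[k [kN k1 k2]]; rewrite (sum_jump un kN k1 k2).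
by rewrite (@piecewise_constantE R N tn T grid _ un k.+1)// k1.
Qed.

End reconstruction_expansions.

Lemma piecewise_constant_cell (E : lmodType R) (a : nat -> E) t : 0 < t <= T ->
  piecewise_constant N tn a t = \sum_(n < N) cell n t *: a n.+1.
Proof.
move=> /grid_cell_oc[k [kN k1 k2]]; rewrite (sum_cell (fun n => a n.+1) kN k1 k2).
by rewrite (@piecewise_constantE R N tn T grid _ a k.+1)// k1.
Qed.

(** * Time test functions against the ramps *)

Section integration_by_parts.
Variable psi : R -> R.
Hypothesis tpsi : time_test_fun T psi.

Lemma test_derivs n : derivs n psi.
Proof. by case: tpsi => /derivsP. Qed.

Lemma test_cont : continuous psi.
Proof.
move=> t; apply: differentiable_continuous; apply/derivable1_diffP.
by have [d _] := test_derivs 1; exact: d.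
Qed.

Lemma dtest_cont : continuous (derive1 psi).
Proof. by apply: derivs_continuous; exact: test_derivs. Qed.

Lemma test0 : psi 0 = 0.
Proof.
case: tpsi => _ [a [b [a0 bT h]]]; apply: h.
by rewrite in_itv/= negb_and -ltNge a0.
Qed.

Lemma testT : psi T = 0.
Proof.
case: tpsi => _ [a [b [a0 bT h]]]; apply: h.
by rewrite in_itv/= negb_and -!ltNge bT orbT.
Qed.

Lemma aeint_continuous (f : R -> R) a b : continuous f ->
  aeint mu `]a, b]%classic f.
Proof.
move=> cf; apply: (aeintS (D := `[a, b]%classic : set (measurableTypeR R))).
- exact: measurable_itv.
- exact: measurable_itv.
- exact: subset_itv_oc_cc.
apply: integrable_aeint; apply: continuous_compact_integrable; first exact: segment_compact.
exact: continuous_subspaceT.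
Qed.

Lemma Rintegral_oc_cc (f : R -> R) a b : continuous f ->
  \int[mu]_(t in `]a, b]) f t = \int[mu]_(t in `[a, b]) f t.
Proof.
move=> cf; apply: Rintegral_itv_obnd_cbnd.
apply: (integrableS (E := `[a, b]%classic : set (measurableTypeR R))).
- exact: measurable_itv.
- exact: measurable_itv.
- exact: subset_itv_oc_cc.
apply: continuous_compact_integrable; first exact: segment_compact.
exact: continuous_subspaceT.
Qed.

Lemma integral_dtest a b : a <= b ->
  \int[mu]_(t in `]a, b]) derive1 psi t = psi b - psi a.
Proof.
rewrite le_eqVlt => /predU1P[->|ab]; first by rewrite set_itvoc0 Rintegral_set0 subrr.
rewrite (Rintegral_oc_cc _ _ dtest_cont) /Rintegral.
rewrite (@continuous_FTC2 _ (derive1 psi) psi)//=.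
- by apply: continuous_subspaceT; exact: dtest_cont.
- split.
  + by move=> t _; have [d _] := test_derivs 1; exact: d.
  + by apply: cvg_at_right_filter; exact: test_cont.
  + by apply: cvg_at_left_filter; exact: test_cont.
Qed.

Lemma integral_dtest_affine a b : a < b ->
  \int[mu]_(t in `]a, b]) (derive1 psi t * ((t - a) / (b - a))) =
  psi b - \int[mu]_(t in `]a, b]) (psi t / (b - a)).
Proof.
move=> ab; have ba0 : b - a != 0 by rewrite subr_eq0 gt_eqF.
have caff : continuous (fun t : R => (t - a) / (b - a)).
  by move=> t; apply: cvgMl; apply: cvgB; [exact: cvg_id|exact: cvg_cst].
have daff t : is_derive (t : R^o) 1 (fun t : R => (t - a) / (b - a)) (b - a)^-1.
  have d1 := is_deriveZ (b - a)^-1 (is_deriveB (is_derive_id (t : R^o) 1) (is_derive_cst a (t : R^o) 1)).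
  rewrite (_ : (fun t : R => _) = (b - a)^-1 \*: (id - cst a)); last first.
    by apply/funext => x; rewrite mulrC.
  by apply: (is_derive_congr d1); rewrite /GRing.scale/= subr0 mulr1.
rewrite Rintegral_oc_cc; last first.
  by move=> t; apply: cvgM; [exact: dtest_cont|exact: caff].
rewrite Rintegral_oc_cc; last by move=> t; apply: cvgMl; exact: test_cont.
rewrite (_ : (fun t => _) = (fun t => (t - a) / (b - a) * derive1 psi t)); last first.
  by apply/funext => t; rewrite mulrC.
rewrite (@Rintegration_by_parts _ (fun t => (t - a) / (b - a)) psi (cst (b - a)^-1) (derive1 psi))//.
- rewrite subrr !mul0r subr0 divff// mul1r; congr (_ - _).
  by congr Rintegral; apply/funext => t; rewrite mulrC.
- by apply: continuous_subspaceT => x; exact: cvg_cst.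
- split.
  + by move=> t _; have [] := daff t.
  + by apply: cvg_at_right_filter; exact: caff.
  + by apply: cvg_at_left_filter; exact: caff.
- by move=> t _; rewrite derive1E; have [_ ->] := daff t.
- by apply: continuous_subspaceT; exact: dtest_cont.
- split.
  + by move=> t _; have [d _] := test_derivs 1; exact: d.
  + by apply: cvg_at_right_filter; exact: test_cont.
  + by apply: cvg_at_left_filter; exact: test_cont.
Qed.

Lemma integral_dtest0 : 0 < T -> \int[mu]_(t in I) derive1 psi t = 0.
Proof.
move=> T0; rewrite aeRint_oc; last exact: aeint_continuous dtest_cont.
by rewrite (integral_dtest (ltW T0)) test0 testT subrr.
Qed.

Lemma integral_dtest_ramp n : 0 < T -> (n < N)%N ->
  \int[mu]_(t in I) (derive1 psi t * ramp n t) =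
  - \int[mu]_(t in I) (psi t * (cell n t / (tn n.+1 - tn n))).
Proof.
move=> T0 nN; have ab := tn_lt nN.
have a0 := tn_ge0 (ltnW nN); have bT := tn_leT nN.
set a := tn n in ab a0 *; set b := tn n.+1 in ab bT *.
have ba0 : 0 < b - a by rewrite subr_gt0.
have cr : continuous (fun t => derive1 psi t * ramp n t).
  by move=> t; apply: cvgM; [exact: dtest_cont|exact: ramp_continuous].
have i1 x y := @aeint_continuous _ x y cr.
rewrite aeRint_oc//.
(* The ramp is 0, affine and 1 on the three pieces. Integration by parts on the middle one gives the
   boundary term [psi b], which cancels against the third piece because [psi] vanishes at [T]. *)
rewrite (aeRint_itv_split a0 (le_trans (ltW ab) bT))// (aeRint_itv_split (ltW ab) bT)//.
have e1 : \int[mu]_(t in `]0, a]) (derive1 psi t * ramp n t) = 0.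
  transitivity (\int[mu]_(t in `]0, a]) (0 : R)); last first.
    by rewrite Rintegral_cst ?mul0r//; exact: measurable_itv.
  apply: eq_Rintegral => t; rewrite inE/= in_itv/= => /andP[_ ta].
  by rewrite /ramp clip01_0 ?mulr0// pmulr_lle0 ?invr_gt0// subr_le0.
have e2 : \int[mu]_(t in `]a, b]) (derive1 psi t * ramp n t) =
    psi b - \int[mu]_(t in `]a, b]) (psi t / (b - a)).
  rewrite -integral_dtest_affine//; apply: eq_Rintegral => t.
  rewrite inE/= in_itv/= => /andP[h1 h2]; rewrite /ramp clip01_id//.
  by rewrite divr_ge0 ?subr_ge0 ?(ltW h1) ?(ltW ab)//= ler_pdivrMr// mul1r lerD2r.
have e3 : \int[mu]_(t in `]b, T]) (derive1 psi t * ramp n t) = - psi b.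
  rewrite -[RHS]add0r -testT -integral_dtest//; apply: eq_Rintegral => t.
  rewrite inE/= in_itv/= => /andP[h1 h2]; rewrite /ramp clip01_1 ?mulr1//.
  by rewrite ler_pdivlMr// mul1r lerD2r ltW.
rewrite e1 e2 e3 add0r addrAC subrr add0r; congr (- _).
pose J : set (measurableTypeR R) := `]a, b]%classic.
have -> : \int[mu]_(t in I) (psi t * (cell n t / (b - a))) =
    \int[mu]_(t in `]0, T]) (psi t * (cell n t / (b - a))).
  have ik : aeint mu `]0, T]%classic (fun t => `|psi t / (b - a)|).
    by apply: aeint_continuous => t; apply: cvg_norm; apply: cvgMl; exact: test_cont.
  have mT : measurable (`]0, T]%classic : set (measurableTypeR R)) by exact: measurable_itv.
  rewrite aeRint_oc//; apply: (aeint_le mT _ ik).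
    apply: measurable_aemeas; apply: measurable_funTS; apply: measurable_funM.
      by apply: continuous_measurable_fun; exact: test_cont.
    by apply: measurable_funM => //; exact: measurable_cell.
  apply: ae_in0 => t _; rewrite mulrCA normrM ler_piMl//.
  have /andP[c0 c1] := indic_bound `]tn n, tn n.+1]%classic t.
  by rewrite ger0_norm.
rewrite (@Rintegral_supp _ _ _ mu J `]0, T]%classic).
- apply: eq_Rintegral => t tJ; rewrite /cell indicE tJ mul1r//.
- by move=> t; rewrite /J /= !in_itv/= => /andP[h1 h2]; rewrite (le_lt_trans a0 h1) (le_trans h2 bT).
- by move=> t _ nt; rewrite /cell indicE memNset// mul0r mulr0.
Qed.

End integration_by_parts.
End time_grid_expansions.

(** * The parabolic space *)

Section parabolic.
Variables (R : realType) (d : nat) (Om : set 'rV[R]_d) (T : R).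
Hypotheses (Om_open : open Om) (Om_bounded : bounded_set Om) (T0 : 0 < T).
Local Notation mu := (@lebesgue_measure R).
Local Notation I := (`]0, T[%classic : set (measurableTypeR R)).
Local Notation mI := (mI T).
Local Notation fct := ('rV[R]_d -> R).
Local Notation leb := (lebesgue_rV R d).
Implicit Types (phi c : R -> fct) (g h : R -> fct -> R) (v w : fct).
Let pL := L2_psd Om_open.
Let sL := psd_seminorm pL.
Let LS := psd_sub pL.
Let pB := graddot_psd Om_open Om_bounded.
Let sN := gradnorm_seminorm Om_open Om_bounded.
Let dN := Hm1norm_dual Om_open Om_bounded.
Let sD : seminorm_on (dual (H10 Om) (gradnorm Om)) (Hm1norm Om) := dual_seminorm dN.

Let half_lt (x : R) : 0 < x -> x / 2 < x.
Proof. by move=> ?; lra. Qed.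

Lemma aeint_continuous_mul (psi f : R -> R) : continuous psi -> aeint mu I f ->
  aeint mu I (fun t => psi t * f t).
Proof.
move=> cp fi; have cn : {within `[0, T], continuous (fun t => `|psi t|)}.
  apply: continuous_subspaceT => x; apply: continuous_comp; first exact: cp.
  exact: norm_continuous.
have [m _ hm] := EVT_max (ltW T0) cn.
have fn : aeint mu I (fun t => `|f t|).
  have [k ik fk] := fi; exists (fun t => `|k t|); first exact: integrable_norm ik.
  by apply: (ae_in1 fk) => t _ ->.
apply: (aeint_le mI _ (aeintZ mI `|psi m| fn)).
  apply: aemeasM (aeint_aemeas fi); apply: measurable_aemeas.
  by apply: measurable_funTS; exact: continuous_measurable_fun.
apply: ae_in0 => t; rewrite /= in_itv/= => /andP[t0 tT].
by rewrite normrM ler_wpM2r// hm// in_itv/= !ltW.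
Qed.

Lemma aeint_dual_pairing h v : inL2Hm1 Om T h -> H10 Om v ->
  aeint mu I (fun t => h t v).
Proof. by move=> hh Hv; exact: (aeint_pairing sN dN hh (bL2_cst T sN Hv)). Qed.

Lemma crep_near phi c s e : continuous_representative Om T phi c ->
  0 <= s <= T -> 0 < e -> exists2 del, 0 < del &
    forall r, 0 <= r <= T -> `|r - s| < del -> L2norm Om (c r - c s) <= e.
Proof.
move=> [_ cc _] sT e0.
have /cvgrPdist_le /(_ _ e0) := cc s sT.
rewrite near_withinE => /nbhs_ballP[del /= del0 h].
exists del => // r rT rs; have := h r; rewrite /ball/= distrC => /(_ rs rT).
by rewrite sub0r normrN; exact: le_trans (ler_norm _).
Qed.

Lemma crep_L2 phi c s : continuous_representative Om T phi c -> 0 <= s <= T ->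
  L2 Om (c s).
Proof. by move=> [h _ _]; exact: h. Qed.

Lemma crep_dot_continuous phi c v s : continuous_representative Om T phi c ->
  L2 Om v -> 0 < s < T -> {for s, continuous (fun t => L2dot Om (c t) v)}.
Proof.
move=> hc Lv /andP[s0 sT]; apply/cvgrPdist_le => e e0.
have sI : 0 <= s <= T by rewrite !ltW.
have p0 : 0 < L2norm Om v + 1 by rewrite ltr_wpDl// sqrtr_ge0.
have [del del0 hd] := crep_near hc sI (divr_gt0 e0 p0).
near=> r.
have rI : 0 <= r <= T.
  apply/andP; split; apply: ltW; near: r; [exact: lt_nbhsr|exact: lt_nbhsl].
have rs : `|r - s| < del.
  by rewrite distrC; near: r; apply: (nbhsx_ballx s del).
have Lr := crep_L2 hc rI; have Ls := crep_L2 hc sI.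
rewrite -(psdlB pL)//.
apply: le_trans (psd_cs pL (spB LS Ls Lr) Lv) _.
rewrite [form_norm _ _](snC sL)//.
have := hd r rI rs; rewrite ler_pdivlMr// => h.
apply: le_trans h; rewrite ler_wpM2l ?sqrtr_ge0// lerDl//.
Unshelve. all: by end_near. Qed.

Lemma weak_dt_increment phi c h v s s' : continuous_representative Om T phi c ->
  weak_dt Om T phi h -> H10 Om v -> 0 < s -> s <= s' -> s' < T ->
  L2dot Om (c s') v - L2dot Om (c s) v = \int[mu]_(r in `]s, s']) h r v.
Proof.
move=> hc [hh wh] Hv; have Lv := H10_L2 Hv; have [_ _ cphi] := hc.
apply: (@weak_derivative_increment R T (fun t => L2dot Om (c t) v) (fun r => h r v)) => //.
- apply: open_continuous_measurable_fun; first exact: interval_open.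
  by move=> t; rewrite inE/= in_itv/= => tI; exact: (crep_dot_continuous hc).
- by move=> t tI; exact: (crep_dot_continuous hc).
- exact: aeint_dual_pairing.
- move=> psi tpsi; rewrite -(wh _ _ tpsi Hv); apply: ae_eq_Rintegral.
  apply: (ae_in1 cphi) => t _ ct; congr (_ * _).
  by apply: L2dot_ae => //; exact: ae_eq_refl.
Qed.

Lemma weak_dt_uniq phi g h v : weak_dt Om T phi g -> weak_dt Om T phi h -> H10 Om v ->
  {ae mu, forall t, t \in `]0, T[ -> g t v = h t v}.
Proof.
move=> [hg wg] [hh wh] Hv.
have ig := aeint_dual_pairing hg Hv; have ih := aeint_dual_pairing hh Hv.
have igh := aeintB mI ig ih.
have /(integral_increment_null igh) : forall s s', 0 < s -> s <= s' -> s' < T ->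
    \int[mu]_(t in `]s, s']) (g t v - h t v) = 0.
  move=> s s' s0 ss' s'T.
  (* The difference [g - h] is a weak derivative of the zero function, which is continuous; its
     integrals over subintervals are therefore increments of 0. *)
  rewrite -(@weak_derivative_increment _ T (cst 0) (fun t => g t v - h t v))//=.
  - by rewrite subrr.
  - by move=> t _; exact: cvg_cst.
  - move=> psi tpsi; have cpsi := test_cont tpsi.
    have e0 : \int[mu]_(t in I) (derive1 psi t * 0) = 0.
      transitivity (\int[mu]_(t in I) (0 : R)).
        by apply: eq_Rintegral => t _; rewrite mulr0.
      by rewrite Rintegral_cst ?mul0r//; exact: mI.
    rewrite e0.
    have -> : \int[mu]_(t in I) (psi t * (g t v - h t v)) =
      \int[mu]_(t in I) (psi t * g t v - psi t * h t v).
      by apply: eq_Rintegral => t _; rewrite mulrBr.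
    rewrite (aeRintB mI (aeint_continuous_mul cpsi ig) (aeint_continuous_mul cpsi ih)).
    apply/esym/eqP; rewrite oppr_eq0 subr_eq0 -eqr_opp; apply/eqP.
    by rewrite -(wg _ _ tpsi Hv) -(wh _ _ tpsi Hv).
by move=> H; apply: (ae_in1 H) => t _ /eqP; rewrite subr_eq0 => /eqP.
Qed.

(** Both representatives agree with [phi], hence with each other, at times arbitrarily close to [t];
    continuity transfers this to [t], end points included. *)
Lemma crep_uniq phi c c' t : continuous_representative Om T phi c ->
  continuous_representative Om T phi c' -> 0 <= t <= T ->
  L2norm Om (c t - c' t) = 0.
Proof.
move=> hc hc' tT; have Lt := crep_L2 hc tT; have Lt' := crep_L2 hc' tT.
apply/eqP; rewrite eq_le sqrtr_ge0 andbT; apply/ler_addgt0Pr => e e0; rewrite add0r.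
have e2 : 0 < e / 2 by rewrite divr_gt0.
have [d1 d10 h1] := crep_near hc tT e2; have [d2 d20 h2] := crep_near hc' tT e2.
pose del := Num.min d1 d2.
have d0 : 0 < del by rewrite lt_min d10.
pose a := Num.max 0 (t - del); pose b := Num.min T (t + del).
have /andP[t0 tT'] := tT.
have ab : a < b.
  rewrite lt_min !gt_max T0/=; apply/andP; split; last apply/andP; try split; lra.
have [_ _ cphi] := hc; have [_ _ cphi'] := hc'.
have sI : (`]a, b[%classic : set (measurableTypeR R)) `<=` I.
  move=> r /=; rewrite !in_itv/= => /andP[r1 r2].
  have a0 : 0 <= a by rewrite le_max lexx.
  have bT : b <= T by rewrite ge_min lexx.
  by rewrite (le_lt_trans a0 r1) (lt_le_trans r2 bT).
have G : {ae mu, forall r, r \in `]a, b[ -> ae_eq leb Om (c r) (c' r)}.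
  apply: (ae_in2 (ae_sub sI cphi) (ae_sub sI cphi')) => r _ /= e1 e2'.
  by apply: (ae_in2 e1 e2') => x _ -> ->.
have i0 : aeint mu `]a, b[%classic (fun=> 0 : R).
  by apply: aeint0; exact: measurable_itv.
(* Used with the zero function, only to pick a point of the interval at which the property [G]
   holds. *)
have [r [/andP[r1 r2] Gr _]] := exists_below_mean ab i0 G e0.
have rT : 0 <= r <= T.
  have := sI r; rewrite /= !in_itv/= r1 r2 => /(_ isT) /andP[h h'].
  by rewrite !ltW.
have rt : `|r - t| < del.
  move: r1 r2; rewrite /a /b gt_max lt_min => /andP[_ r1] /andP[_ r2].
  by rewrite ltr_norml; apply/andP; split; lra.
have Lr := crep_L2 hc rT; have Lr' := crep_L2 hc' rT.
have z : L2norm Om (c r - c' r) = 0.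
  apply: (L2norm_ae0 Om_open (spB LS Lr Lr')).
  by apply: (ae_in1 Gr) => x _ e1; change (c r x - c' r x = 0); rewrite e1 subrr.
have m1 : L2norm Om (c r - c t) <= e / 2.
  by apply: h1 => //; apply: lt_le_trans rt _; rewrite ge_min lexx.
have m2 : L2norm Om (c' r - c' t) <= e / 2.
  by apply: h2 => //; apply: lt_le_trans rt _; rewrite ge_min lexx orbT.
have t1 := sn_tri sL Lt Lr Lt'; have t2 := sn_tri sL Lr Lr' Lt'.
have sw : form_norm (L2dot Om) (c t - c r) = L2norm Om (c r - c t) by exact: (snC sL).
move: t1 t2; rewrite sw.
change (form_norm (L2dot Om) (c r - c' r)) with (L2norm Om (c r - c' r)).
change (form_norm (L2dot Om) (c' r - c' t)) with (L2norm Om (c' r - c' t)).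
change (form_norm (L2dot Om) (c t - c' t)) with (L2norm Om (c t - c' t)).
rewrite z; move: m1 m2.
move: (L2norm _ _) (L2norm _ _) (L2norm _ _) (form_norm _ _) => *; lra.
Qed.

(** [value_at] is chosen among all values of all continuous representatives; by [crep_uniq] its norm
    does not depend on the choice. *)
Lemma value_at_norm phi c : continuous_representative Om T phi c ->
  L2norm Om (value_at Om T phi T) = L2norm Om (c T).
Proof.
move=> hc; have TT : 0 <= T <= T by rewrite lexx ltW.
have LT := crep_L2 hc TT.
have : has_value Om T phi T (value_at Om T phi T).
  apply: (@xgetPex _ (cst 0) (has_value Om T phi T)).
  by exists (c T); split => //; exists c => //; exact: ae_eq_refl.
move=> [Lv [c' hc' cv]].
have LT' := crep_L2 hc' TT.
have -> : L2norm Om (value_at Om T phi T) = L2norm Om (c' T).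
  by rewrite /L2norm; congr Num.sqrt; apply: L2dot_ae => //; exact: ae_eq_sym.
have := sn_lip sL LT' LT.
change (form_norm (L2dot Om) (c' T - c T)) with (L2norm Om (c' T - c T)).
rewrite (crep_uniq hc' hc TT) normr_le0 subr_eq0 => /eqP.
by [].
Qed.

Lemma parabolic_energy phi c h : inX Om T phi -> weak_dt Om T phi h ->
  continuous_representative Om T phi c ->
  L2dot Om (c T) (c T) - L2dot Om (c 0) (c 0) = 2 * \int[mu]_(r in I) h r (phi r).
Proof.
move=> hp wh hc; have [hh _] := wh; have [Hphi _ _] := hp; have [_ _ cphi] := hc.
pose G t := [/\ 0 < t < T, H10 Om (phi t) & ae_eq leb Om (c t) (phi t)].
have aG : {ae mu, forall t, t \in `]0, T[ -> G t}.
  by apply: (ae_in2 Hphi cphi) => t; rewrite in_itv/= => tI *; split.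
have lim0 s : 0 <= s <= T -> forall eps, 0 < eps -> exists2 del, 0 < del &
    forall t, 0 < t < T -> `|t - s| <= del ->
      `|L2dot Om (c t) (c t) - L2dot Om (c s) (c s)| <= eps.
  move=> sT eps e0; have Ls := crep_L2 hc sT.
  pose M := L2norm Om (c s).
  have M0 : 0 <= M by exact: sqrtr_ge0.
  (* With D = |c(t) - c(s)| <= 1, the difference of the squares is at most D^2 + 2 D M <= D (2 M +
     1), hence this choice. *)
  pose e := Num.min 1 (eps / (2 * M + 1)).
  have M1 : 0 < 2 * M + 1 by rewrite ltr_wpDl// mulr_ge0.
  have e00 : 0 < e by rewrite lt_min ltr01 divr_gt0.
  have [del del0 hd] := crep_near hc sT e00.
  exists (del / 2); first by rewrite divr_gt0.
  move=> t /andP[t0 tT] ts; have tI : 0 <= t <= T by rewrite !ltW.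
  have Lt := crep_L2 hc tI.
  have hD := hd t tI (le_lt_trans ts (half_lt del0)).
  set D := L2norm Om (c t - c s) in hD.
  have D0 : 0 <= D by exact: sqrtr_ge0.
  have -> : L2dot Om (c t) (c t) - L2dot Om (c s) (c s) =
      L2dot Om (c t - c s) (c t - c s) + 2 * L2dot Om (c t - c s) (c s).
    have := psdDD pL (spB LS Lt Ls) Ls; rewrite subrK => ->; ring.
  have c1 : `|L2dot Om (c t - c s) (c t - c s)| <= D * D.
    exact: (psd_cs pL (spB LS Lt Ls) (spB LS Lt Ls)).
  have c2 : `|L2dot Om (c t - c s) (c s)| <= D * M.
    exact: (psd_cs pL (spB LS Lt Ls) Ls).
  have D1 : D <= 1 by rewrite (le_trans hD)// ge_min lexx.
  have De : D * (2 * M + 1) <= eps.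
    by rewrite -ler_pdivlMr// (le_trans hD)// ge_min lexx orbT.
  apply: le_trans (ler_normD _ _) _; rewrite normrM (ger0_norm (ler0n _ _)).
  have DD : D * D <= D by rewrite ler_piMl.
  move: c1 c2 De DD; move: `|_| `|_| => x y c1 c2 De DD.
  by move: De; rewrite mulrDr mulr1 [D * (2 * M)]mulrCA; lra.
apply: (energy_identity T0 sN dN hh hp (F := fun t => L2dot Om (c t) (c t)) (G := G)) => //.
- move=> eps e0; have s0 : 0 <= (0 : R) <= T by rewrite lexx ltW.
  have [del del0 hd] := lim0 0 s0 eps e0; exists del => // t tI td.
  by apply: hd => //; rewrite subr0 ger0_norm//; case/andP: tI => /ltW.
- move=> eps e0; have sT : 0 <= T <= T by rewrite lexx ltW.
  have [del del0 hd] := lim0 T sT eps e0; exists del => // t tI td.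
  rewrite distrC; apply: hd => //; rewrite distrC ger0_norm// subr_ge0.
  by case/andP: tI => _ /ltW.
- by move=> t [].
- move=> s s' [sI Hs cs] [s'I Hs' cs'] s0 ss' s'T.
  have Hv := spD (H10_subspace Om_open Om_bounded) Hs Hs'.
  rewrite -(weak_dt_increment hc wh Hv s0 ss' s'T).
  have r0 w : ae_eq leb Om w w by exact: ae_eq_refl.
  rewrite (L2dot_ae cs cs) (L2dot_ae cs' cs') (L2dot_ae cs (r0 _)) (L2dot_ae cs' (r0 _)).
  have Ls := H10_L2 Hs; have Ls' := H10_L2 Hs'.
  by rewrite !(psdrD pL)// (psd_sym pL Ls Ls'); ring.
Qed.

(** The map from v to [graddot Om v], the weak form of minus the Laplacian, is linear and isometric
    into the dual, hence the constant 1. *)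
Lemma bL2_graddot phi : inX Om T phi ->
  bochnerL2 (dual (H10 Om) (gradnorm Om)) (Hm1norm Om) T (fun t => graddot Om (phi t)).
Proof.
apply: (bL2_comp (C := 1) sN sD).
- by move=> v Hv; exact: (psd_dual pB).
- by move=> v Hv; rewrite mul1r (dual_norm_psd pB dN).
- move=> v w Hv Hw; rewrite mul1r.
  have Hvw := spB (psd_sub pB) Hv Hw.
  rewrite (_ : gradnorm Om (v - w) = Hm1norm Om (graddot Om (v - w))); last first.
    by rewrite (dual_norm_psd pB dN).
  have D1 := spB (dual_subspace _ _) (psd_dual pB Hv) (psd_dual pB Hw).
  apply: (dn_least dN D1); first exact: (dn_ge0 dN (psd_dual pB Hvw)).
  move=> x Hx; change (is_true (graddot Om v x - graddot Om w x <=
    Hm1norm Om (graddot Om (v - w)) * gradnorm Om x)).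
  rewrite -(psdlB pB)//; apply: le_trans (ler_norm _) _.
  exact: (dn_ub dN (psd_dual pB Hvw)).
Qed.

Lemma bL2_graddot_norm phi : inX Om T phi ->
  bochnerL2_norm (Hm1norm Om) T (fun t => graddot Om (phi t)) = normX Om T phi.
Proof.
move=> [Hphi _ _]; congr Num.sqrt; apply: ae_eq_Rintegral.
by apply: (ae_in1 Hphi) => t _ Ht; rewrite (dual_norm_psd pB dN).
Qed.

(* The cross term of [dual_norm_shift] integrates to the squared L2 norm at the
   final time. *)
Lemma normY_residual phi c (Res : R -> fct -> R) :
  inX Om T phi -> (exists g, weak_dt Om T phi g) ->
  continuous_representative Om T phi c -> L2norm Om (c 0) = 0 ->
  inL2Hm1 Om T Res ->
  (forall v, H10 Om v -> {ae mu, forall t, t \in `]0, T[ ->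
    dt Om T phi t v + graddot Om (phi t) v = Res t v}) ->
  normY Om T phi = normL2Hm1 Om T Res.
Proof.
move=> hp exg hc c0 hRes eqR.
have wh : weak_dt Om T phi (dt Om T phi) by exact: (xgetPex _ exg).
set h := dt Om T phi in eqR wh; have [hh _] := wh.
have hA := bL2_graddot hp.
have hhA := bL2D sD hh hA.
have hZ := bL2B sD hhA hRes.
(* Passes from an equation with a null set depending on [v] to an identity in H^{-1} at almost every
   time. *)
have Z0 : {ae mu, forall t, t \in `]0, T[ ->
    Hm1norm Om ((h t + graddot Om (phi t)) - Res t) = 0}.
  have [DZ mZ _] := hZ.
  apply: (weakly_null sN dN DZ mZ) => v Hv; apply: (ae_in1 (eqR v Hv)) => t _ e.
  by change (h t v + graddot Om (phi t) v - Res t v = 0); rewrite e subrr.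
have TT : 0 <= T <= T by rewrite lexx ltW.
have z0 : 0 <= (0 : R) <= T by rewrite lexx ltW.
rewrite /normY (value_at_norm hc) -/h.
have LT := crep_L2 hc TT; have L0 := crep_L2 hc z0.
have := parabolic_energy hp wh hc.
rewrite -(form_norm_sqr pL L0) -(form_norm_sqr pL LT).
change (form_norm (L2dot Om) (c 0)) with (L2norm Om (c 0)).
change (form_norm (L2dot Om) (c T)) with (L2norm Om (c T)).
rewrite c0 expr0n/= subr0 => ->.
have ih2 := (bL2_sqint sD hh).2; have ip2 := (bL2_sqint sN hp).2.
have ihp := aeint_pairing sN dN hh hp.
rewrite -(aeRintZ mI 2 ihp) -(aeRintD mI (aeintD mI ih2 ip2) (aeintZ mI 2 ihp)).
congr Num.sqrt; apply: ae_eq_Rintegral.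
have [Dh _ _] := hh; have [Hphi _ _] := hp; have [DR _ _] := hRes.
apply: (ae_in4 Dh Hphi DR Z0) => t _ Dt Ht DRt z.
have DA := psd_dual pB Ht.
have DhA := spD (dual_subspace _ _) Dt DA.
(* The two functionals are only at seminorm distance zero; this is enough for their norms to
   coincide. *)
have -> : Hm1norm Om (Res t) = Hm1norm Om (h t + graddot Om (phi t)).
  have := sn_lip sD DhA DRt; rewrite z normr_le0 subr_eq0 => /eqP ->//.
rewrite (dual_norm_shift pB dN Dt Ht) -(form_norm_sqr pB Ht).
change (form_norm (graddot Om) (phi t)) with (gradnorm Om (phi t)).
ring.
Qed.

End parabolic.

(** * The implicit Euler error *)

Section implicit_euler.
Variables (R : realType) (d : nat) (Om : set 'rV[R]_d) (T : R).
Variables (N : nat) (tn : nat -> R).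
Variables (u0 : 'rV[R]_d -> R) (f : R -> ('rV[R]_d -> R) -> R) (u : R -> 'rV[R]_d -> R).
Variables (fn : nat -> ('rV[R]_d -> R) -> R) (un : nat -> 'rV[R]_d -> R).
Hypotheses (Om_open : open Om) (Om_bounded : bounded_set Om).
Hypotheses (T0 : 0 < T) (grid : time_grid T N tn).
Hypotheses (hu0 : H10 Om u0) (hf : inL2Hm1 Om T f) (hu : heat_solution Om T f u0 u).
Hypothesis hfn : forall n, (1 <= n <= N)%N -> Hm1 Om (fn n).
Hypothesis hun : implicit_euler Om N tn u0 fn un.
Local Notation mu := (@lebesgue_measure R).
Local Notation I := (`]0, T[%classic : set (measurableTypeR R)).
Local Notation mI := (mI T).
Local Notation leb := (lebesgue_rV R d).
Local Notation E := ('rV[R]_d -> R).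
Local Notation u_tau := (piecewise_constant N tn un).
Local Notation U_tau := (piecewise_affine N tn un).
Local Notation f_tau := (piecewise_constant N tn fn).
Local Notation ramp := (ramp tn).
Local Notation jump := (jump tn).
Local Notation cell := (cell tn).
Let pL := L2_psd Om_open.
Let sL := psd_seminorm pL.
Let LS := psd_sub pL.
Let pB := graddot_psd Om_open Om_bounded.
Let sN := gradnorm_seminorm Om_open Om_bounded.
Let dN := Hm1norm_dual Om_open Om_bounded.
Let sD : seminorm_on (dual (H10 Om) (gradnorm Om)) (Hm1norm Om) := dual_seminorm dN.
Let HS := H10_subspace Om_open Om_bounded.
Let DS := dual_subspace (H10 Om) (gradnorm Om).

Local Notation increment n := (un n.+1 - un n).

Definition difference_quotient n : E -> R :=
  (tn n.+1 - tn n)^-1 *: (L2dot Om (increment n) : E -> R).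

Local Notation DU := (fun t => \sum_(n < N) cell n t *: difference_quotient n).

Lemma euler_H10 n : (n <= N)%N -> H10 Om (un n).
Proof.
by case: hun => e h; case: n => [|n] nN; [rewrite e|have [] := h n.+1 nN].
Qed.

Lemma increment_H10 n : (n < N)%N -> H10 Om (increment n).
Proof. by move=> nN; apply: (spB HS); apply: euler_H10 => //; exact: ltnW. Qed.

Lemma euler_scheme n v : (n < N)%N -> H10 Om v ->
  difference_quotient n v + graddot Om (un n.+1) v = fn n.+1 v.
Proof.
move=> nN Hv; have [_ /(_ n.+1 nN)[_ /(_ v Hv) <-]] := hun; congr (_ + _).
rewrite (_ : (fun _ => _) = (tn n.+1 - tn n)^-1 *: increment n).
  by rewrite (psdlZ pL)//; [exact: H10_L2 (increment_H10 nN)|exact: H10_L2].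
by apply/funext => x /=; rewrite mulrC.
Qed.

(* The scheme bounds the difference quotients in H^{-1}, with no need for the
   Poincare inequality behind the embedding of L^2 in H^{-1}. *)
Lemma difference_quotient_dual n : (n < N)%N ->
  dual (H10 Om) (gradnorm Om) (difference_quotient n).
Proof.
move=> nN; have D1 := spB DS (@hfn n.+1 nN : dual _ _ _) (psd_dual pB (euler_H10 nN)).
have e v : H10 Om v -> difference_quotient n v = (fn n.+1 - graddot Om (un n.+1)) v.
  by move=> Hv; rewrite -[RHS]/(fn n.+1 v - graddot Om (un n.+1) v) -euler_scheme// addrK.
have [D2 [C DC]] := D1; split=> [a v w Hv Hw|].
  by rewrite !e//; [exact: D2|exact: (spD HS (spZ _ HS Hv) Hw)].
by exists C => v Hv; rewrite e//; exact: DC.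
Qed.

Lemma U_tau_H10 t : 0 <= t <= T -> H10 Om (U_tau t).
Proof.
move=> tT; rewrite (piecewise_affine_ramp grid)//; apply: (spD HS); first exact: euler_H10.
by apply: sp_sum => // n _; apply: (spZ _ HS); exact: increment_H10.
Qed.

Lemma U_tau_inX : inX Om T U_tau.
Proof.
apply: (bL2_eq sN (psi := fun t => un 0 + \sum_(n < N) ramp n t *: increment n)).
  apply: ae_in0 => t; rewrite in_itv/= => /andP[/ltW t0 /ltW tT].
  by rewrite (piecewise_affine_ramp grid)// t0.
apply: (bL2D sN); first by apply: bL2_cst => //; exact: euler_H10.
apply: (bL2_sum sN) => n; apply: bL2_scale => //.
- exact: increment_H10.
- exact: measurable_ramp.
- by move=> t; exact: ramp_bound.
Qed.

Lemma u_tau_inX : inX Om T u_tau.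
Proof.
apply: (bL2_eq sN (psi := fun t => un 0 + \sum_(n < N) jump n t *: increment n)).
  apply: ae_in0 => t; rewrite in_itv/= => /andP[t0 /ltW tT].
  by rewrite (piecewise_constant_jump grid)// t0.
apply: (bL2D sN); first by apply: bL2_cst => //; exact: euler_H10.
apply: (bL2_sum sN) => n; apply: bL2_scale => //.
- exact: increment_H10.
- exact: measurable_jump.
- by move=> t; exact: indic_bound.
Qed.

Lemma cell_combination_inL2Hm1 (a : nat -> E -> R) :
  (forall n, (n < N)%N -> dual (H10 Om) (gradnorm Om) (a n)) ->
  inL2Hm1 Om T (fun t => \sum_(n < N) cell n t *: a n).
Proof.
move=> ha; apply: (bL2_sum sD) => n; apply: bL2_scale => //.
- exact: ha.
- exact: measurable_cell.
- by move=> t; exact: indic_bound.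
Qed.

Lemma f_tau_inL2Hm1 : inL2Hm1 Om T f_tau.
Proof.
apply: (bL2_eq sD (psi := fun t => \sum_(n < N) cell n t *: fn n.+1)).
  apply: ae_in0 => t; rewrite in_itv/= => /andP[t0 /ltW tT].
  by rewrite (piecewise_constant_cell grid)// t0.
by apply: (cell_combination_inL2Hm1 (a := fun n => fn n.+1)) => n nN; exact: (@hfn n.+1 nN).
Qed.

Lemma discrete_equation t v : 0 < t <= T -> H10 Om v ->
  DU t v + graddot Om (u_tau t) v = f_tau t v.
Proof.
move=> tT Hv; have [k [kN k1 k2]] := grid_cell_oc grid tT.
have kT : (tn k.+1.-1 < t <= tn k.+1) by rewrite k1.
rewrite (sum_cell grid _ kN k1 k2).
by rewrite !(piecewise_constantE grid _ (n := k.+1))//= euler_scheme.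
Qed.

Lemma sum_fctE (J : Type) (r : seq J) (F : J -> E -> R) v :
  (\sum_(j <- r) F j) v = \sum_(j <- r) F j v.
Proof. by elim/big_rec2: _ => // j _ x _ <-. Qed.

Lemma L2dot_U_tau t v : 0 <= t <= T -> H10 Om v ->
  L2dot Om (U_tau t) v =
  L2dot Om (un 0) v + \sum_(n < N) ramp n t * L2dot Om (increment n) v.
Proof.
move=> tT Hv; have Lv := H10_L2 Hv.
have Lw (n : 'I_N) : L2 Om (increment n) by exact: H10_L2 (increment_H10 _).
have Ls (r : seq 'I_N) : L2 Om (\sum_(n <- r) ramp n t *: increment n).
  by apply: sp_sum => // n _; exact: (spZ _ LS).
rewrite (piecewise_affine_ramp grid)// (psdlD pL)//; last first.
  by apply: H10_L2; exact: euler_H10.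
congr (_ + _); elim: (index_enum _) Ls => [|n r IH] Ls.
  by rewrite !big_nil (psdl0 pL).
rewrite !big_cons (psdlD pL)//; last exact: (spZ _ LS).
by rewrite (psdlZ pL)// IH.
Qed.

(** Termwise [integral_dtest_ramp]; the constant term drops out because the integral of the
    derivative of [psi] is zero. Integrability is proved along the way, as it is needed to split the
    integral for [u - U_tau]. *)
Lemma U_tau_weak_dt psi v : time_test_fun T psi -> H10 Om v ->
  aeint mu I (fun t => derive1 psi t * L2dot Om (U_tau t) v) /\
  \int[mu]_(t in I) (derive1 psi t * L2dot Om (U_tau t) v) =
  - \int[mu]_(t in I) (psi t * DU t v).
Proof.
move=> tpsi Hv; have cd := dtest_cont tpsi; have cp := test_cont tpsi.
have icont g : continuous g -> aeint mu I g.
  move=> cg; have := aeint_continuous_mul T0 cg (aeint_cst T 1).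
  by apply: aeint_eq; apply: aeW => t _; rewrite mulr1.
have i0 := icont _ cd.
have ir (n : 'I_N) : aeint mu I (fun t => derive1 psi t * ramp n t).
  by apply: icont => t; apply: cvgM; [exact: cd|exact: ramp_continuous].
have ic (n : 'I_N) : aeint mu I (fun t => psi t * (cell n t / (tn n.+1 - tn n))).
  apply: aeint_continuous_mul => //; apply: (aeint_le mI _ (aeint_cst T `|(tn n.+1 - tn n)^-1|)).
    apply: measurable_aemeas; apply: measurable_funTS.
    by apply: measurable_funM; [exact: measurable_cell|exact: measurable_cst].
  apply: ae_in0 => t _; rewrite normrM ler_piMl//.
  have /andP[h0 h1] : 0 <= cell n t <= 1 by exact: indic_bound.
  by rewrite ger0_norm.
pose b (n : 'I_N) := L2dot Om (increment n) v.
have e1 t : t \in `]0, T[ -> derive1 psi t * L2dot Om (U_tau t) v =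
    L2dot Om (un 0) v * derive1 psi t + \sum_(n < N) b n * (derive1 psi t * ramp n t).
  rewrite in_itv/= => /andP[/ltW t0 /ltW tT]; rewrite L2dot_U_tau ?t0//.
  rewrite mulrDr mulrC; congr (_ + _); rewrite mulr_sumr.
  by apply: eq_bigr => n _; rewrite mulrA mulrC.
have e2 t : psi t * DU t v =
    \sum_(n < N) b n * (psi t * (cell n t / (tn n.+1 - tn n))).
  rewrite sum_fctE mulr_sumr; apply: eq_bigr => n _.
  rewrite -[(_ *: _) v]/(cell n t * ((tn n.+1 - tn n)^-1 * b n)).
  by move: (b n) (_^-1) => *; ring.
have isum : aeint mu I (fun t => \sum_(n < N) b n * (derive1 psi t * ramp n t)).
  by apply: (aeint_sum mI) => n; exact: aeintZ.
have it := aeintZ mI (L2dot Om (un 0) v) i0.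
split; first by apply: aeint_eq (aeintD mI it isum); apply: aeW => t /e1.
have -> : \int[mu]_(t in I) (psi t * DU t v) =
    \int[mu]_(t in I) (\sum_(n < N) b n * (psi t * (cell n t / (tn n.+1 - tn n)))).
  by apply: eq_Rintegral => t _; rewrite e2.
transitivity (\int[mu]_(t in I) (L2dot Om (un 0) v * derive1 psi t +
    \sum_(n < N) b n * (derive1 psi t * ramp n t))).
  by apply: eq_Rintegral => t; rewrite inE/= => tI; rewrite e1.
rewrite (aeRintD mI it isum) (aeRintZ mI _ i0) (integral_dtest0 tpsi T0) mulr0 add0r.
rewrite !(aeRint_sum mI) -?sumrN; try by move=> n; exact: aeintZ.
apply: eq_bigr => n _.
by rewrite !(aeRintZ mI)// (integral_dtest_ramp grid tpsi T0)// mulrN.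
Qed.

Lemma DU_inL2Hm1 : inL2Hm1 Om T DU.
Proof. by apply: cell_combination_inL2Hm1; exact: difference_quotient_dual. Qed.

Lemma error_weak_dt : weak_dt Om T (u - U_tau) (fun t => dt Om T u t - DU t).
Proof.
have [[hX hL exg] _ _] := hu.
have [hdt wdt] : weak_dt Om T u (dt Om T u) by exact: (xgetPex _ exg).
split; first exact: (bL2B sD hdt DU_inL2Hm1).
move=> psi v tpsi Hv; have Lv := H10_L2 Hv.
have [iU wU] := U_tau_weak_dt tpsi Hv; have cp := test_cont tpsi.
have iu := aeint_continuous_mul T0 (dtest_cont tpsi)
  (aeint_dual_pairing Om_open Om_bounded hL Hv).
have ig := aeint_continuous_mul T0 cp (aeint_dual_pairing Om_open Om_bounded hdt Hv).
have iD := aeint_continuous_mul T0 cp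
  (aeint_dual_pairing Om_open Om_bounded DU_inL2Hm1 Hv).
transitivity (\int[mu]_(t in I) (derive1 psi t * L2_to_Hm1 Om (u t) v
    - derive1 psi t * L2dot Om (U_tau t) v)).
  apply: ae_eq_Rintegral; have [Hu _ _] := hX; apply: (ae_in1 Hu) => t tI Ht.
  rewrite -mulrBr -(psdlB pL)//; first exact: H10_L2.
  apply: H10_L2; apply: U_tau_H10; move: tI.
  by rewrite in_itv/= => /andP[/ltW-> /ltW->].
rewrite (aeRintB mI iu iU) (wdt _ _ tpsi Hv) wU -opprD -(aeRintB mI ig iD).
by congr (- _); apply: eq_Rintegral => t _; rewrite -mulrBr.
Qed.

Let ae_eq_subr (a b w : E) : ae_eq leb Om a b -> ae_eq leb Om (a - w) (b - w).
Proof. by move=> e; apply: (ae_in1 e) => x _ ex; rewrite !fctE ex. Qed.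

(** In L^2 the variation of [U_tau] is at most the sum of the variations of the ramps weighted by
    the norms of the increments, and the ramps are continuous. *)
Lemma error_continuous_representative c : continuous_representative Om T u c ->
  continuous_representative Om T (u - U_tau) (fun t => c t - U_tau t).
Proof.
move=> [cL cc cu].
have UL s : s \in `[0, T] -> L2 Om (U_tau s).
  by rewrite in_itv/= => sT; apply: H10_L2; exact: U_tau_H10.
split.
- by move=> s sT; apply: (spB LS); [exact: cL|exact: UL].
- move=> s sT; pose b r := L2norm Om (c r \- c s) +
    \sum_(n < N) `|ramp n r - ramp n s| * L2norm Om (increment n).
  have b0 : b r @[r --> within `[0, T] (nbhs s)] --> (0 : R).
    have b1 : \sum_(n < N) `|ramp n r - ramp n s| * L2norm Om (increment n)
        @[r --> within `[0, T] (nbhs s)] -->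
        \sum_(n < N) `|ramp n s - ramp n s| * L2norm Om (increment n).
      apply: cvg_within_filter; apply: cvg_big => [|n _]; first exact: add_continuous.
      apply: cvgMl; apply: cvg_norm.
      by apply: cvgB; [exact: ramp_continuous|exact: cvg_cst].
    rewrite [X in _ --> X]big1 in b1; last by move=> n _; rewrite subrr normr0 mul0r.
    by rewrite -[0 in X in _ --> X]addr0; exact: cvgD (cc _ sT) b1.
  apply: (squeeze_cvgr _ (cvg_cst 0) b0); rewrite near_withinE; apply: nearW => r rT.
  rewrite sqrtr_ge0/=.
  have Lw (n : 'I_N) : L2 Om (increment n) by exact: H10_L2 (increment_H10 _).
  have Lz (n : 'I_N) : L2 Om ((ramp n r - ramp n s) *: increment n) by exact: (spZ _ LS).
  have eU : U_tau r - U_tau s = \sum_(n < N) (ramp n r - ramp n s) *: increment n.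
    rewrite !(piecewise_affine_ramp grid) ?(itvP rT) ?(itvP sT)//.
    rewrite opprD addrACA subrr add0r -sumrB.
    by apply: eq_bigr => n _; rewrite scalerBl.
  have Lc := spB LS (cL _ rT) (cL _ sT); have LU := spB LS (UL _ rT) (UL _ sT).
  rewrite [X in L2norm Om X](_ : _ = (c r - c s) - (U_tau r - U_tau s)); last first.
    by apply/funext => x /=; rewrite !fctE; ring.
  apply: le_trans (snB sL Lc LU) _; rewrite lerD2l eU.
  have h := sn_sum sL (index_enum 'I_N) Lz.
  have {}h : L2norm Om (\sum_(n < N) (ramp n r - ramp n s) *: increment n) <=
      \sum_(n < N) L2norm Om ((ramp n r - ramp n s) *: increment n) by exact: h.
  apply: (le_trans h).
  apply: ler_sum => n _. have := sn_Z sL (ramp n r - ramp n s) (Lw n).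
  by move=> e; rewrite -[L2norm Om (increment n)]/(form_norm (L2dot Om) (increment n)) -e.
- apply: (ae_in1 cu) => s _ e. exact: (ae_eq_subr (U_tau s) e).
Qed.

Lemma U_tau_0 : U_tau 0 = u0.
Proof.
have [N1 t0 _ _] := grid; have TT : 0 <= (0 : R) <= T by rewrite lexx ltW.
rewrite (piecewise_affine_ramp grid)// (@sum_ramp R T N tn grid E un 0) ?t0//.
  by rewrite subr0 mul0r scale0r addr0; have [] := hun.
by rewrite -t0; apply: (tn_le grid).
Qed.

Local Notation Res :=
  (fun t => (f t - f_tau t) + graddot Om (u_tau t - U_tau t)).

Lemma jump_inX : inX Om T (u_tau - U_tau).
Proof. exact: (bL2B sN u_tau_inX U_tau_inX). Qed.

Lemma oscillation_inL2Hm1 : inL2Hm1 Om T (f - f_tau).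
Proof. exact: (bL2B sD hf f_tau_inL2Hm1). Qed.

Lemma residual_inL2Hm1 : inL2Hm1 Om T Res.
Proof.
apply: (bL2D sD oscillation_inL2Hm1).
exact: (bL2_graddot Om_open Om_bounded jump_inX).
Qed.

(** The heat equation minus [discrete_equation]. The scheme holds with [u_tau] whereas the error
    involves [U_tau], which leaves [graddot Om (u_tau t - U_tau t)] in the residual. As [dt] is a
    choice, [weak_dt_uniq] identifies it with the explicit derivative. *)
Lemma error_equation v : H10 Om v -> {ae mu, forall t, t \in `]0, T[ ->
  dt Om T (u - U_tau) t v + graddot Om ((u - U_tau) t) v = Res t v}.
Proof.
move=> Hv; have [[[Hu _ _] _ _] _ /(_ v Hv) heat] := hu.
have wE : weak_dt Om T (u - U_tau) (dt Om T (u - U_tau)).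
  by apply: (xgetPex _ (ex_intro _ _ error_weak_dt)).
have eE := weak_dt_uniq Om_open Om_bounded T0 wE error_weak_dt Hv.
have [Hj _ _] := u_tau_inX.
apply: (ae_in4 Hu heat eE Hj) => t tI Ht he e1 Hjt; rewrite e1.
move: tI; rewrite in_itv/= => /andP[t0 tT].
have HU : H10 Om (U_tau t) by apply: U_tau_H10; rewrite !ltW.
have := @discrete_equation t v; rewrite t0 (ltW tT) => /(_ isT Hv) hd.
rewrite -[(dt Om T u t - DU t) v]/(dt Om T u t v - DU t v).
rewrite -[Res t v]/((f t v - f_tau t v) + graddot Om (u_tau t - U_tau t) v).
rewrite -[(u - U_tau) t]/(u t - U_tau t) (psdlB pB Ht HU Hv) (psdlB pB Hjt HU Hv) -he -hd.
move: (dt _ _ _ _ _) (DU t v) (graddot _ _ _) (graddot _ _ _) (graddot _ _ _) => *; ring.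
Qed.

Lemma error_normY : normY Om T (u - U_tau) = normL2Hm1 Om T Res.
Proof.
have [[hX _ _] [Lu0 [c hc c0]] _] := hu.
have hE := error_continuous_representative hc.
apply: (normY_residual Om_open Om_bounded T0 _ _ hE).
- exact: (bL2B sN hX U_tau_inX).
- by exists (fun t => dt Om T u t - DU t); exact: error_weak_dt.
- have TT : 0 <= (0 : R) <= T by rewrite lexx ltW.
  rewrite U_tau_0; apply: (L2norm_ae0 Om_open (spB LS (crep_L2 hc TT) Lu0)).
  by apply: (ae_in1 c0) => x _ e; change (c 0 x - u0 x = 0); rewrite e subrr.
- exact: residual_inL2Hm1.
- exact: error_equation.
Qed.

End implicit_euler.

Theorem theorem4p1 (R : realType) (d : nat) (Om : set 'rV[R]_d) (T : R)
    (N : nat) (tn : nat -> R)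
    (u0 : 'rV[R]_d -> R) (f : R -> ('rV[R]_d -> R) -> R)
    (u : R -> 'rV[R]_d -> R)
    (fn : nat -> ('rV[R]_d -> R) -> R) (un : nat -> 'rV[R]_d -> R)
    (hd : (1 <= d)%N)
    (Om_open : open Om) (Om_bounded : bounded_set Om)
    (Om_lipschitz : lipschitz_boundary Om)
    (hT : 0 < T) (hgrid : time_grid T N tn)
    (hu0 : H10 Om u0) (hf : inL2Hm1 Om T f)
    (hu : heat_solution Om T f u0 u)
    (hfn : forall n, (1 <= n <= N)%N -> Hm1 Om (fn n))
    (hun : implicit_euler Om N tn u0 fn un) :
  let u_tau := piecewise_constant N tn un in
  let U_tau := piecewise_affine N tn un in
  let f_tau := piecewise_constant N tn fn in
  let eta_J := normX Om T (u_tau - U_tau) in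
  let eta_osc := normL2Hm1 Om T (f - f_tau) in
  normY Om T (u - U_tau) <= eta_J + eta_osc /\
  eta_J <= normY Om T (u - U_tau) + eta_osc.
Proof.
move=> u_tau U_tau f_tau eta_J eta_osc.
have sD := dual_seminorm (Hm1norm_dual Om_open Om_bounded).
have bR := residual_inL2Hm1 Om_open Om_bounded hgrid hu0 hf hfn hun.
have bO := oscillation_inL2Hm1 Om_open Om_bounded hgrid hf hfn.
have bJ := bL2_graddot Om_open Om_bounded (jump_inX Om_open Om_bounded hgrid hu0 hun).
have [DO _ _] := bO; have [DJ _ _] := bJ.
rewrite (error_normY Om_open Om_bounded hT hgrid hu0 hf hu hfn hun).
(* By the isometry, the jump estimator is an H^{-1} norm and can be compared with the residual and
   the oscillation. *)
have -> : eta_J = bochnerL2_norm (Hm1norm Om) T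
    (fun t => graddot Om ((u_tau - U_tau) t)).
  rewrite (bL2_graddot_norm Om_open Om_bounded)//.
  exact: (jump_inX Om_open Om_bounded hgrid hu0 hun).
split.
  rewrite addrC; apply: (bL2_minkowski sD bO bJ bR).
  by apply: (ae_in2 DO DJ) => t _ D1 D2; exact: (sn_D sD).
apply: (bL2_minkowski sD bR bO bJ); have [DR _ _] := bR.
apply: (ae_in2 DO DR) => t _ D1 D2.
(* For the second bound the jump functional is written as residual minus oscillation. *)
rewrite [X in Hm1norm Om X <= _](_ : _ =
    ((f t - f_tau t) + graddot Om (u_tau t - U_tau t)) - (f - f_tau) t).
  exact: (snB sD).
by rewrite -[(f - f_tau) t]/(f t - f_tau t) addrAC subrr add0r.
Qed.
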